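(* Let $d\in\mathbb N$. Suppose $n\in(3/2,3)$ and $H>0$ for $x\in(0,1]$. Then the unique solution $H\in C^3((0,1))\cap C^1([0,1])$ of the problem $$H^{n-1}\Big(\frac{d^3H}{dx^3}-\frac{d-1}{1-x}\frac{d^2H}{dx^2}-\frac{d-1}{(1-x)^2}\frac{dH}{dx}\Big)=-1+x\ \text{ for } x\in(0,1),$$ $$\Big(H,\frac{dH}{dx}\Big)=(0,0)\ \text{ at } x=0,\qquad \frac{dH}{dx}=0\ \text{ at } x=1,$$ fulfills the asymptotic $$H=\mu^{-\frac1n}x^{\frac3n}\Big(1+v\big(x,x^{\beta}\big)\Big)\qquad\text{for } 0\le x\ll1,$$ where $$\mu=\tfrac3n\big(\tfrac3n-1\big)\big(2-\tfrac3n\big),\qquad \beta=\frac{\sqrt{-27+36n-8n^2}-9+4n}{2n}\in(0,1),$$ and $v=v(x_1,x_2)$ is an analytic function in a neighborhood of $(x_1,x_2)=(0,0)$, $v(0,0)=0$ but $v\not\equiv0$, with an in general non-trivial dependence on both $x_1$ and $x_2$.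
   Context: Here $d$ denotes the (fixed) space dimension in the coefficients $d-1$, whereas $\frac{d^k}{dx^k}$ denotes differentiation in $x$. $\mathbb N=\{1,2,3,\dots\}$. ''For $0\le x\ll1$'' means: there is a constant $c>0$ such that the assertion holds for all $0\le x\le c$. Existence and uniqueness of classical solutions (i.e. in the class $C^3((0,1))\cap C^1([0,1])$) of this problem are known and may be presupposed. *)

(* Defs.v *)
From Stdlib Require Import Reals.
From Coquelicot Require Import Coquelicot.
Open Scope R_scope.

(* Real power of a base x >= 0 with exponent a > 0.  [Rpower] alone would give
   the wrong value at the base 0, since [Rpower 0 a = 1]. *)
Definition rpow (x a : R) : R :=
  if Req_EM_T x 0 then 0 else Rpower x a.

(* [l] is the derivative of [f] at [x] relative to [D]: one-sided when [x] is
   an end point of an interval [D], so that values of [f] off [D] play no role. *)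
Definition is_derive_within (D : R -> Prop) (f : R -> R) (x l : R) : Prop :=
  filterlim (fun y => (f y - f x) / (y - x))
    (within (fun y => D y /\ y <> x) (locally x)) (locally l).

Definition continuous_within (D : R -> Prop) (f : R -> R) (x : R) : Prop :=
  filterlim f (within D (locally x)) (locally (f x)).

Definition unit_cc (x : R) : Prop := 0 <= x <= 1.

Definition C1_cc01 (f : R -> R) : Prop :=
  exists f' : R -> R, forall x, unit_cc x ->
    is_derive_within unit_cc f x (f' x) /\ continuous_within unit_cc f' x.

(* All orders k <= 3 are listed because [ex_derive_n f 3] only says that the
   total function [Derive_n f 2] is differentiable. *)
Definition C3_oo01 (f : R -> R) : Prop :=
  forall x, 0 < x < 1 ->
    (forall k, (k <= 3)%nat -> ex_derive_n f k x) /\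
    continuous (Derive_n f 3) x.

(* Expansion in a power series that converges absolutely on a square around
   (p1, p2); the double series is grouped by total degree N, which is harmless
   by absolute convergence. *)
Definition analytic2_at (v : R -> R -> R) (p1 p2 : R) : Prop :=
  exists (a : nat -> nat -> R) (r : R), 0 < r /\
    forall x1 x2, Rabs (x1 - p1) < r -> Rabs (x2 - p2) < r ->
      let term i j := a i j * (x1 - p1) ^ i * (x2 - p2) ^ j in
      ex_series (fun N => sum_n (fun i => Rabs (term i (N - i)%nat)) N) /\
      is_series (fun N => sum_n (fun i => term i (N - i)%nat) N) (v x1 x2).

(* The next three notions concern the germ of v at the origin: they ask for
   witnesses in every square around it. *)
Definition nontrivial_near0 (v : R -> R -> R) : Prop :=
  forall eps, 0 < eps -> exists x1 x2,
    Rabs x1 < eps /\ Rabs x2 < eps /\ v x1 x2 <> 0.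

Definition depends_on_fst_near0 (v : R -> R -> R) : Prop :=
  forall eps, 0 < eps -> exists x1 y1 x2,
    Rabs x1 < eps /\ Rabs y1 < eps /\ Rabs x2 < eps /\ v x1 x2 <> v y1 x2.

Definition depends_on_snd_near0 (v : R -> R -> R) : Prop :=
  forall eps, 0 < eps -> exists x1 x2 y2,
    Rabs x1 < eps /\ Rabs x2 < eps /\ Rabs y2 < eps /\ v x1 x2 <> v x1 y2.

Definition mu (n : R) : R := 3 / n * (3 / n - 1) * (2 - 3 / n).

Definition beta (n : R) : R :=
  (sqrt (- 27 + 36 * n - 8 * n ^ 2) - 9 + 4 * n) / (2 * n).

Definition profile_equation (d : nat) (n : R) (H : R -> R) (x : R) : Prop :=
  Rpower (H x) (n - 1) *
    (Derive_n H 3 x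
     - (INR d - 1) / (1 - x) * Derive_n H 2 x
     - (INR d - 1) / (1 - x) ^ 2 * Derive_n H 1 x) = - 1 + x.

(* Main.v *)
Require Import Defs.
From Stdlib Require Import Reals Lra Lia Arith Classical Ranalysis5.
From Coquelicot Require Import Coquelicot.
Open Scope R_scope.

(* With nu = 3/n, A = mu^(-1/n) and r = 1 - x, a solution satisfies L H = - r H^(1-n), where
   L f = f''' - (d-1)/r f'' - (d-1)/r^2 f'.

   Writing H = A x^nu z and w = z^(1-n), the equation becomes a recursion for the
   coefficients of z and w in x^i (x^beta)^j. The indicial polynomial vanishes at beta but at
   no other exponent i + j beta > 0, so the coefficient of x^beta is free; by scaling x2 this
   yields a family H_c of local solutions with z = z(x, c x^beta), convergent on a box that
   does not depend on c. The coefficient of x is positive.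

   Two local solutions with H(0) = H'(0) = 0 that agree at one point x1 agree to the left of
   it: for their difference D the energy r^(d-1) (r (D D'' - D'^2/2) + D D') is nondecreasing,
   because D L D >= 0, vanishes at 0, and is nonpositive at a zero of D.

   Integrating the equation three times shows that H/(A x^nu) can neither stay above 1 + eta
   nor below 1 - eta near 0. Hence at some small x1 it lies in the range of
   z(x1, .), and some H_c agrees with H at x1, so H = H_c on [0, x1].

   Finally c <> 0: otherwise H > A x^nu near 0, and the same energy shows that H - A x^nu
   stays positive and that its derivative is nonnegative near 1, contradicting H'(1) = 0. *)

(** The given solution carries only two conditions at 0 and nothing is known beforehand about its
    expansion; a contraction argument would first have to place it in a suitable weighted space. The
    energy avoids this: s -> -r s^(1-n) is nondecreasing, so a single value at x1 fixes the solution
    to the left of x1, and matching one number is enough. The real power in w = z^(1-n) does not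
    obstruct a coefficient recursion, because w is characterised by z theta w + (n-1) w theta z = 0
    with theta = x d/dx and z = w = 1 at 0, a quadratic relation. There are no small divisors: the
    indicial polynomial grows cubically, as the third derivative does, and all exponents other than
    0 and beta stay a fixed distance above beta. Its remaining roots are negative: -1, which
    reflects the translations in x of the leading equation H''' = -H^(1-n), and 4 - 3 nu - beta.
    Hence a single coefficient is free. In the end v(x1, x2) = z(x1, c x2) - 1, so dependence on x2
    amounts to c <> 0; this is where the condition at x = 1 enters. *)

Lemma mean_value (f df : R -> R) (x y : R) :
  x < y -> (forall t, x <= t <= y -> is_derive f t (df t)) ->
  exists c, f y - f x = df c * (y - x) /\ x < c < y.
Proof.
  intros Hxy Hd. apply MVT_cor2; [assumption|].
  intros c Hc. apply is_derive_Reals, Hd, Hc.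
Qed.

Lemma derive_nonneg_incr (f df : R -> R) (a b : R) :
  (forall x, a < x < b -> is_derive f x (df x)) ->
  (forall x, a < x < b -> 0 <= df x) ->
  forall x y, a < x -> x <= y -> y < b -> f x <= f y.
Proof.
  intros Hd Hp x y Hx Hxy Hy.
  destruct (Rle_lt_or_eq_dec x y Hxy) as [Hlt| ->]; [|lra].
  destruct (mean_value f df x y Hlt) as [c [E Hc]].
  - intros t Ht. apply Hd. lra.
  - assert (0 <= df c) by (apply Hp; lra). nra.
Qed.

Lemma derive_nonpos_decr (f df : R -> R) (a b : R) :
  (forall x, a < x < b -> is_derive f x (df x)) ->
  (forall x, a < x < b -> df x <= 0) ->
  forall x y, a < x -> x <= y -> y < b -> f y <= f x.
Proof.
  intros Hd Hp x y Hx Hxy Hy.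
  apply Ropp_le_cancel.
  apply (derive_nonneg_incr (fun t => - f t) (fun t => - df t) a b); auto.
  - intros t Ht. apply (is_derive_opp f), Hd, Ht.
  - intros t Ht. specialize (Hp t Ht). lra.
Qed.

(** * Functions vanishing at 0+ *)

(** Only points x > 0 are tested: functions such as x f''(x) need not have a meaningful value at
    0. *)
Definition vanishes0 (f : R -> R) : Prop :=
  forall eps, 0 < eps ->
    exists delta, 0 < delta /\ forall x, 0 < x < delta -> Rabs (f x) <= eps.

Lemma vanishes0_le (f g : R -> R) (a : R) :
  0 < a -> (forall x, 0 < x < a -> Rabs (f x) <= Rabs (g x)) ->
  vanishes0 g -> vanishes0 f.
Proof.
  intros Ha Hfg Hg eps Heps. destruct (Hg eps Heps) as [d [Hd H]].
  exists (Rmin a d). split. { apply Rmin_case; lra. }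
  intros x Hx. assert (H1 := Rmin_l a d). assert (H2 := Rmin_r a d).
  eapply Rle_trans. apply Hfg; lra. apply H; lra.
Qed.

Lemma vanishes0_ext (f g : R -> R) (a : R) :
  0 < a -> (forall x, 0 < x < a -> f x = g x) -> vanishes0 g -> vanishes0 f.
Proof.
  intros Ha Hfg. apply (vanishes0_le f g a Ha). intros x Hx.
  rewrite Hfg by assumption. lra.
Qed.

Lemma vanishes0_plus (f g : R -> R) :
  vanishes0 f -> vanishes0 g -> vanishes0 (fun x => f x + g x).
Proof.
  intros Hf Hg eps Heps.
  destruct (Hf (eps / 2)) as [d [Hd H]]; [lra|].
  destruct (Hg (eps / 2)) as [d' [Hd' H']]; [lra|].
  exists (Rmin d d'). split. { apply Rmin_case; lra. }
  intros x Hx. assert (H1 := Rmin_l d d'). assert (H2 := Rmin_r d d').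
  specialize (H x). specialize (H' x).
  eapply Rle_trans. apply Rabs_triang. lra.
Qed.

Lemma vanishes0_bounded_mult (f g : R -> R) (a C : R) :
  0 < a -> (forall x, 0 < x < a -> Rabs (g x) <= C) ->
  vanishes0 f -> vanishes0 (fun x => g x * f x).
Proof.
  intros Ha Hg Hf eps Heps.
  assert (HC : 0 <= C).
  { eapply Rle_trans. apply Rabs_pos. apply (Hg (a / 2)). lra. }
  destruct (Hf (eps / (C + 1))) as [d [Hd H]].
  { apply Rdiv_lt_0_compat; lra. }
  exists (Rmin a d). split. { apply Rmin_case; lra. }
  intros x Hx. assert (H1 := Rmin_l a d). assert (H2 := Rmin_r a d).
  rewrite Rabs_mult.
  apply Rle_trans with (C * (eps / (C + 1))).
  - apply Rmult_le_compat; try apply Rabs_pos. apply Hg; lra. apply H; lra.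
  - unfold Rdiv. rewrite <- Rmult_assoc. apply Rle_div_l; [lra|]. nra.
Qed.

Lemma vanishes0_scal (f : R -> R) (c : R) :
  vanishes0 f -> vanishes0 (fun x => c * f x).
Proof.
  apply (vanishes0_bounded_mult f (fun _ => c) 1 (Rabs c)); intros; lra.
Qed.

Lemma vanishes0_minus (f g : R -> R) :
  vanishes0 f -> vanishes0 g -> vanishes0 (fun x => f x - g x).
Proof.
  intros Hf Hg. apply (vanishes0_ext _ (fun x => f x + (-1) * g x) 1); [lra| |].
  - intros; ring.
  - apply vanishes0_plus, vanishes0_scal; assumption.
Qed.

Lemma vanishes0_bounded (f : R -> R) :
  vanishes0 f -> exists a, 0 < a /\ forall x, 0 < x < a -> Rabs (f x) <= 1.
Proof. intros H. apply (H 1). lra. Qed.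

Lemma vanishes0_mult (f g : R -> R) :
  vanishes0 f -> vanishes0 g -> vanishes0 (fun x => f x * g x).
Proof.
  intros Hf Hg. destruct (vanishes0_bounded f Hf) as [a [Ha H]].
  apply (vanishes0_bounded_mult g f a 1); assumption.
Qed.

Lemma vanishes0_id : vanishes0 (fun x => x).
Proof.
  intros eps Heps. exists eps. split; [assumption|].
  intros x Hx. rewrite Rabs_pos_eq; lra.
Qed.

(** The limit at 0+ takes the place of an initial value, so that every integration from 0 becomes a
    monotonicity argument. *)
Lemma incr_from_vanishes0 (f : R -> R) (a : R) :
  (forall x y, 0 < x -> x <= y -> y < a -> f x <= f y) ->
  vanishes0 f -> forall x, 0 < x < a -> 0 <= f x.
Proof.
  intros Hi Hv x Hx. apply Rnot_lt_le. intros Hn.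
  destruct (Hv (- f x / 2)) as [d [Hd H]]; [lra|].
  assert (Hm : 0 < Rmin x d) by (apply Rmin_case; lra).
  assert (H1 := Rmin_l x d). assert (H2 := Rmin_r x d).
  specialize (H (Rmin x d / 2)). specialize (Hi (Rmin x d / 2) x).
  assert (H3 := H ltac:(lra)). apply Rabs_le_between in H3.
  assert (f (Rmin x d / 2) <= f x) by (apply Hi; lra). lra.
Qed.

(** * The energy and uniqueness *)

(* [-(1-x) H^(1-n)] is the value of this operator at a solution H of the
   profile equation in dimension e + 1. *)
Definition thin_op (e : nat) (f1 f2 f3 : R -> R) (x : R) : R :=
  f3 x - INR e / (1 - x) * f2 x - INR e / (1 - x) ^ 2 * f1 x.

Definition derive_chain (a : R) (f f1 f2 f3 : R -> R) : Prop :=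
  forall x, 0 < x < a ->
    is_derive f x (f1 x) /\ is_derive f1 x (f2 x) /\ is_derive f2 x (f3 x).

Lemma derive_chain_minus (a : R) (f f1 f2 f3 g g1 g2 g3 : R -> R) :
  derive_chain a f f1 f2 f3 -> derive_chain a g g1 g2 g3 ->
  derive_chain a (fun x => f x - g x) (fun x => f1 x - g1 x)
    (fun x => f2 x - g2 x) (fun x => f3 x - g3 x).
Proof.
  intros Hf Hg x Hx. destruct (Hf x Hx) as (? & ? & ?).
  destruct (Hg x Hx) as (? & ? & ?).
  split; [|split]; apply (is_derive_minus (V := R_NormedModule)); assumption.
Qed.

Lemma thin_op_minus (e : nat) (f1 f2 f3 g1 g2 g3 : R -> R) (x : R) :
  thin_op e (fun x => f1 x - g1 x) (fun x => f2 x - g2 x) (fun x => f3 x - g3 x) x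
  = thin_op e f1 f2 f3 x - thin_op e g1 g2 g3 x.
Proof. unfold thin_op. ring. Qed.

Lemma is_derive_pow_1m (e : nat) (x : R) :
  x < 1 -> is_derive (fun y => (1 - y) ^ e) x (- (INR e * (1 - x) ^ e / (1 - x))).
Proof.
  intros Hx. destruct e as [|e].
  - evar_last; [apply (is_derive_const 1)|]. change (0 = - (0 * 1 / (1 - x))). field. lra.
  - evar_last.
    { apply (is_derive_pow (fun y => 1 - y) (S e) x (-1)). auto_derive; [trivial|ring]. }
    unfold Init.Nat.pred. rewrite <- tech_pow_Rmult. field. lra.
Qed.

(* The weights are chosen such that all terms of indefinite sign in the
   derivative of the energy cancel. *)
Definition energy (e : nat) (f f1 f2 : R -> R) (x : R) : R :=
  (1 - x) ^ e * ((1 - x) * (f x * f2 x - f1 x ^ 2 / 2) + f x * f1 x).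

(** Since (f f'' - f'^2/2)' = f f''', no product f' f'' arises. The weight (1-x)^e supplies the
    lower-order terms of the operator, and the summand f f' cancels the f f'' that comes from
    differentiating the factor 1 - x. *)
Lemma is_derive_energy (e : nat) (f f1 f2 f3 : R -> R) (x : R) :
  x < 1 ->
  is_derive f x (f1 x) -> is_derive f1 x (f2 x) -> is_derive f2 x (f3 x) ->
  is_derive (energy e f f1 f2) x
    ((1 - x) ^ e * ((1 - x) * (f x * thin_op e f1 f2 f3 x)
                    + (3 + INR e) / 2 * f1 x ^ 2)).
Proof.
  intros Hx H0 H1 H2. unfold energy.
  evar_last.
  - apply (is_derive_mult (fun y => (1 - y) ^ e)
             (fun x => (1 - x) * (f x * f2 x - f1 x ^ 2 / 2) + f x * f1 x)).
    + apply is_derive_pow_1m, Hx.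
    + auto_derive.
      * repeat split; eexists; eassumption.
      * reflexivity.
    + intros; apply Rmult_comm.
  - replace (Derive (fun x => f x) x) with (f1 x) by (symmetry; apply is_derive_unique, H0).
    replace (Derive (fun x => f1 x) x) with (f2 x) by (symmetry; apply is_derive_unique, H1).
    replace (Derive (fun x => f2 x) x) with (f3 x) by (symmetry; apply is_derive_unique, H2).
    unfold thin_op, plus, mult; simpl. field. lra.
Qed.

Lemma energy_incr (e : nat) (f f1 f2 f3 : R -> R) (a : R) :
  a <= 1 -> derive_chain a f f1 f2 f3 ->
  (forall x, 0 < x < a -> 0 <= f x * thin_op e f1 f2 f3 x) ->
  forall x y, 0 < x -> x <= y -> y < a -> energy e f f1 f2 x <= energy e f f1 f2 y.
Proof.
  intros Ha Hc Hp.
  eapply derive_nonneg_incr.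
  - intros x Hx. destruct (Hc x Hx) as (? & ? & ?).
    apply is_derive_energy; try eassumption. lra.
  - intros x Hx. specialize (Hp x Hx).
    apply Rmult_le_pos. { apply pow_le. lra. }
    apply Rplus_le_le_0_compat.
    + apply Rmult_le_pos; [lra|assumption].
    + assert (H := pos_INR e). assert (H' := pow2_ge_0 (f1 x)). nra.
Qed.

(** The second derivative may blow up like x^(nu-2). The condition on x f'' is what the energy
    needs, because f f'' = (f/x) (x f'') and f/x tends to 0 together with f'. *)
Definition small_at_0 (f f1 f2 : R -> R) : Prop :=
  vanishes0 f /\ vanishes0 f1 /\ vanishes0 (fun x => x * f2 x).

Lemma small_at_0_minus (f f1 f2 g g1 g2 : R -> R) :
  small_at_0 f f1 f2 -> small_at_0 g g1 g2 ->
  small_at_0 (fun x => f x - g x) (fun x => f1 x - g1 x) (fun x => f2 x - g2 x).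
Proof.
  intros (? & ? & ?) (? & ? & ?).
  split; [|split]; try (apply vanishes0_minus; assumption).
  apply (vanishes0_ext _ (fun x => x * f2 x - x * g2 x) 1); [lra|intros; ring|].
  apply vanishes0_minus; assumption.
Qed.

Lemma vanishes0_quotient (f f1 : R -> R) (a : R) :
  0 < a -> (forall x, 0 < x < a -> is_derive f x (f1 x)) ->
  vanishes0 f -> vanishes0 f1 -> vanishes0 (fun x => f x / x).
Proof.
  intros Ha Hd Hf Hf1 eps Heps.
  destruct (Hf1 eps Heps) as [d [Hd0 H]].
  assert (Hm : 0 < Rmin a d) by (apply Rmin_case; lra).
  assert (H1 := Rmin_l a d). assert (H2 := Rmin_r a d).
  exists (Rmin a d). split; [assumption|].
  intros x Hx.
  assert (Hup : forall g g1 : R -> R,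
    (forall x, 0 < x < Rmin a d -> is_derive g x (g1 x)) -> vanishes0 g ->
    (forall x, 0 < x < Rmin a d -> g1 x <= eps) -> g x <= eps * x).
  { intros g g1 Hg Hg0 Hle.
    assert (0 <= eps * x - g x); [|lra].
    apply (incr_from_vanishes0 (fun x => eps * x - g x) (Rmin a d)); [|  |assumption].
    - apply (derive_nonneg_incr _ (fun x => eps - g1 x)).
      + intros t Ht. apply (is_derive_minus (fun x => eps * x) g).
        * auto_derive; [trivial|ring].
        * apply Hg, Ht.
      + intros t Ht. specialize (Hle t Ht). lra.
    - apply (vanishes0_minus (fun x => eps * x)); [|assumption].
      apply vanishes0_scal, vanishes0_id. }
  unfold Rdiv. rewrite Rabs_mult, (Rabs_pos_eq (/ x)).
  2:{ left. apply Rinv_0_lt_compat. lra. }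
  apply Rle_div_l; [lra|].
  apply Rabs_le. split.
  - enough (- f x <= eps * x) by lra.
    apply (Hup (fun x => - f x) (fun x => - f1 x)).
    + intros t Ht. apply (is_derive_opp f), Hd. lra.
    + apply (vanishes0_ext _ (fun x => (-1) * f x) 1); [lra|intros; ring|].
      apply vanishes0_scal, Hf.
    + intros t Ht. specialize (H t ltac:(lra)). apply Rabs_le_between in H. lra.
  - apply (Hup f f1).
    + intros t Ht. apply Hd. lra.
    + assumption.
    + intros t Ht. specialize (H t ltac:(lra)). apply Rabs_le_between in H. lra.
Qed.

Lemma energy_vanishes0 (e : nat) (f f1 f2 f3 : R -> R) (a : R) :
  0 < a -> derive_chain a f f1 f2 f3 -> small_at_0 f f1 f2 ->
  vanishes0 (energy e f f1 f2).
Proof.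
  intros Ha Hc (H0 & H1 & H2).
  assert (Hq : vanishes0 (fun x => f x / x)).
  { apply (vanishes0_quotient f f1 a); try assumption. intros x Hx. apply (Hc x Hx). }
  apply (vanishes0_ext _ (fun x => (1 - x) ^ e *
     ((1 - x) * ((f x / x) * (x * f2 x) - (1 / 2) * (f1 x * f1 x)) + f x * f1 x)) 1).
  { lra. }
  { intros x Hx. unfold energy. field. lra. }
  apply (vanishes0_bounded_mult _ _ 1 1); [lra| |].
  { intros x Hx. rewrite Rabs_pos_eq by (apply pow_le; lra).
    apply Rle_trans with (1 ^ e); [apply pow_incr; lra|rewrite pow1; lra]. }
  apply vanishes0_plus; [|apply vanishes0_mult; assumption].
  apply (vanishes0_bounded_mult _ _ 1 1); [lra| |].
  { intros x Hx. rewrite Rabs_pos_eq; lra. }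
  apply vanishes0_minus; [apply vanishes0_mult; assumption|].
  apply vanishes0_scal, vanishes0_mult; assumption.
Qed.

Lemma energy_nonneg (e : nat) (f f1 f2 f3 : R -> R) (a : R) :
  0 < a <= 1 -> derive_chain a f f1 f2 f3 -> small_at_0 f f1 f2 ->
  (forall x, 0 < x < a -> 0 <= f x * thin_op e f1 f2 f3 x) ->
  forall x, 0 < x < a -> 0 <= energy e f f1 f2 x.
Proof.
  intros Ha Hc Hs Hp. apply incr_from_vanishes0.
  - apply (energy_incr e f f1 f2 f3 a); [lra|assumption|assumption].
  - apply (energy_vanishes0 e f f1 f2 f3 a); [lra|assumption|assumption].
Qed.

(* At a zero of f the energy is nonpositive, so it vanishes up to there. *)
Lemma zero_propagates_left (e : nat) (f f1 f2 f3 : R -> R) (a b : R) :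
  0 < b < a -> a <= 1 -> derive_chain a f f1 f2 f3 -> small_at_0 f f1 f2 ->
  (forall x, 0 < x < b -> 0 <= f x * thin_op e f1 f2 f3 x) ->
  f b = 0 -> forall x, 0 < x <= b -> f x = 0.
Proof.
  intros Hb Ha Hc Hs Hp Hf.
  assert (Hcb : derive_chain b f f1 f2 f3) by (intros x Hx; apply Hc; lra).
  assert (HE : forall x, 0 < x < b -> 0 <= energy e f f1 f2 x).
  { apply (energy_nonneg e f f1 f2 f3 b); try assumption. lra. }
  assert (Hend : energy e f f1 f2 b <= 0).
  { unfold energy. rewrite Hf. assert (H := pow2_ge_0 (f1 b)).
    assert (H' : 0 <= (1 - b) ^ e) by (apply pow_le; lra).
    assert (0 <= (1 - b) ^ e * ((1 - b) * f1 b ^ 2)); [|nra].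
    apply Rmult_le_pos; [assumption|]. apply Rmult_le_pos; lra. }
  (* As [b] lies inside (0, a), the energy is differentiable at [b] too, so the mean value theorem
     reaches the zero itself. *)
  assert (Hder : forall x, 0 < x < a -> is_derive (energy e f f1 f2) x
      ((1 - x) ^ e * ((1 - x) * (f x * thin_op e f1 f2 f3 x)
                    + (3 + INR e) / 2 * f1 x ^ 2))).
  { intros x Hx. destruct (Hc x Hx) as (? & ? & ?).
    apply is_derive_energy; try assumption. lra. }
  assert (HE0 : forall x, 0 < x < b -> energy e f f1 f2 x = 0).
  { intros x Hx. apply Rle_antisym; [|apply HE, Hx].
    apply Rle_trans with (2 := Hend).
    destruct (mean_value (energy e f f1 f2) (fun x => (1 - x) ^ e *
       ((1 - x) * (f x * thin_op e f1 f2 f3 x) + (3 + INR e) / 2 * f1 x ^ 2))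
       x b (proj2 Hx)) as [c [Hmv Hcc]].
    { intros t Ht. apply Hder. lra. }
    enough (0 <= (1 - c) ^ e * ((1 - c) * (f c * thin_op e f1 f2 f3 c)
                        + (3 + INR e) / 2 * f1 c ^ 2)) by nra.
    apply Rmult_le_pos. { apply pow_le. lra. }
    assert (H := pos_INR e). assert (H' := pow2_ge_0 (f1 c)).
    apply Rplus_le_le_0_compat; [|nra].
    apply Rmult_le_pos; [lra|]. apply Hp. lra. }
  (* An identically vanishing energy has derivative 0; that derivative is a sum of two nonnegative
     terms, one of them a positive multiple of f'^2. *)
  assert (Hf1 : forall x, 0 < x < b -> f1 x = 0).
  { intros x Hx.
    assert (Hz : is_derive (energy e f f1 f2) x 0).
    { apply (is_derive_ext_loc (fun _ => 0)).
      - exists (mkposreal (Rmin x (b - x)) ltac:(apply Rmin_case; lra)).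
        intros y Hy. symmetry. apply HE0. apply Rabs_def2 in Hy. simpl in Hy.
        assert (H1 := Rmin_l x (b - x)). assert (H2 := Rmin_r x (b - x)).
        unfold minus, plus, opp in Hy; simpl in Hy. lra.
      - apply (is_derive_const 0). }
    apply is_derive_unique in Hz. rewrite (is_derive_unique _ _ _ (Hder x ltac:(lra))) in Hz.
    assert (Hq : 0 < (1 - x) ^ e) by (apply pow_lt; lra).
    apply Rmult_integral in Hz. destruct Hz as [Hz|Hz]; [lra|].
    specialize (Hp x Hx). assert (H := pos_INR e). assert (H' := pow2_ge_0 (f1 x)).
    assert (0 <= (1 - x) * (f x * thin_op e f1 f2 f3 x)) by (apply Rmult_le_pos; lra).
    assert (f1 x ^ 2 = 0) by nra. nra. }
  intros x Hx. destruct (Rle_lt_or_eq_dec x b (proj2 Hx)) as [Hlt| ->]; [|assumption].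
  destruct (mean_value f f1 x b Hlt) as [c [Hmv Hcc]].
  - intros t Ht. apply (Hc t). lra.
  - rewrite Hf1 in Hmv; lra.
Qed.

(** The operator is an exact derivative, because e/(1-x)^2 is the derivative of e/(1-x). *)
Definition thin_primitive (e : nat) (f1 f2 : R -> R) (x : R) : R :=
  f2 x - INR e / (1 - x) * f1 x.

Lemma is_derive_thin_primitive (e : nat) (f1 f2 f3 : R -> R) (x : R) :
  x < 1 -> is_derive f1 x (f2 x) -> is_derive f2 x (f3 x) ->
  is_derive (thin_primitive e f1 f2) x (thin_op e f1 f2 f3 x).
Proof.
  intros Hx H1 H2. unfold thin_primitive. evar_last.
  - apply (is_derive_minus f2); [exact H2|].
    apply (is_derive_mult (fun x => INR e / (1 - x)) f1); [|exact H1|].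
    + auto_derive; [lra|reflexivity].
    + intros; apply Rmult_comm.
  - unfold thin_op, minus, plus, opp, mult; simpl. field. lra.
Qed.

(** The primitive is nondecreasing, hence bounded above near 0, and so is f'' because f' is bounded.
    Two integrations from 0 give the bound, which will be played off against x^nu with nu < 2. *)
Lemma thin_supersolution_bound (e : nat) (f f1 f2 f3 : R -> R) (a : R) :
  0 < a <= 1 -> derive_chain a f f1 f2 f3 ->
  (forall x, 0 < x < a -> 0 <= thin_op e f1 f2 f3 x) ->
  vanishes0 f -> vanishes0 f1 ->
  exists C delta, 0 < delta /\ forall x, 0 < x < delta -> f x <= C * x ^ 2.
Proof.
  intros Ha Hc Hp H0 H1.
  destruct (vanishes0_bounded f1 H1) as [b [Hb Hf1]].
  set (x0 := Rmin a b / 2).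
  assert (Hm : 0 < Rmin a b) by (apply Rmin_case; lra).
  assert (Hm1 := Rmin_l a b). assert (Hm2 := Rmin_r a b).
  assert (Hx0 : 0 < x0 < a /\ x0 <= 1 / 2 /\ x0 < b) by (unfold x0; lra).
  clearbody x0. clear Hm Hm1 Hm2.
  (* [2 * INR e] bounds e f'/(1-x), because |f'| <= 1 and 1 - x >= 1/2 on (0, x0). *)
  set (C := Rabs (thin_primitive e f1 f2 x0) + 2 * INR e).
  assert (He := pos_INR e).
  assert (Hf2 : forall x, 0 < x < x0 -> f2 x <= C).
  { intros x Hx.
    assert (HW : thin_primitive e f1 f2 x <= thin_primitive e f1 f2 x0).
    { apply (derive_nonneg_incr _ (thin_op e f1 f2 f3) 0 a); try lra; [|exact Hp].
      intros t Ht. apply is_derive_thin_primitive; [lra| |]; apply (Hc t Ht). }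
    assert (Hi : INR e / (1 - x) * f1 x <= 2 * INR e).
    { specialize (Hf1 x ltac:(lra)). apply Rabs_le_between in Hf1.
      assert (0 <= / (1 - x) <= 2).
      { split. left; apply Rinv_0_lt_compat; lra.
        apply Rmult_le_reg_l with (1 - x); [lra|]. rewrite Rinv_r; lra. }
      unfold Rdiv. rewrite (Rmult_comm 2), Rmult_assoc.
      apply Rmult_le_compat_l; nra. }
    assert (Hab := Rle_abs (thin_primitive e f1 f2 x0)).
    unfold C. unfold thin_primitive at 1 in HW. lra. }
  assert (Hf1' : forall x, 0 < x < x0 -> 0 <= C * x - f1 x).
  { apply incr_from_vanishes0.
    - apply (derive_nonneg_incr _ (fun x => C - f2 x)).
      + intros t Ht. apply (is_derive_minus (fun x => C * x) f1).
        * auto_derive; [trivial|ring].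
        * apply (Hc t). lra.
      + intros t Ht. specialize (Hf2 t Ht). lra.
    - apply (vanishes0_minus (fun x => C * x)); [|assumption].
      apply vanishes0_scal, vanishes0_id. }
  exists (C / 2), x0. split; [lra|]. intros x Hx.
  enough (0 <= C / 2 * x ^ 2 - f x) by lra.
  apply (incr_from_vanishes0 (fun x => C / 2 * x ^ 2 - f x) x0); [| |assumption].
  - apply (derive_nonneg_incr _ (fun x => C * x - f1 x)); [|exact Hf1'].
    intros t Ht. apply (is_derive_minus (fun x => C / 2 * x ^ 2) f).
    + auto_derive; [trivial|field].
    + apply (Hc t). lra.
  - apply (vanishes0_minus (fun x => C / 2 * x ^ 2)); [|assumption].
    apply vanishes0_scal. simpl. apply vanishes0_mult; [apply vanishes0_id|].
    apply (vanishes0_ext _ (fun x => x) 1); [lra|intros; ring|apply vanishes0_id].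
Qed.

(* The primitive W = f'' - e f' / (1 - x) of the operator is decreasing, so x W(x) is
   controlled by the increment of f' over (x/2, x). *)
Lemma thin_subsolution_small (e : nat) (f f1 f2 f3 : R -> R) (a : R) :
  0 < a <= 1 -> derive_chain a f f1 f2 f3 ->
  (forall x, 0 < x < a -> thin_op e f1 f2 f3 x <= 0) ->
  vanishes0 f -> vanishes0 f1 -> small_at_0 f f1 f2.
Proof.
  intros Ha Hc Hp H0 H1. split; [assumption|]. split; [assumption|].
  set (x0 := a / 2). set (W := thin_primitive e f1 f2).
  assert (HW : forall x y, 0 < x -> x <= y -> y < a -> W y <= W x).
  { apply (derive_nonpos_decr _ (thin_op e f1 f2 f3)); [|exact Hp].
    intros t Ht. apply is_derive_thin_primitive; [lra| |]; apply (Hc t Ht). }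
  assert (He := pos_INR e).
  intros eps Heps.
  (* The mean value theorem on (x/2, x) costs [4 * eta], and passing between W and f'' at the two
     points c and x costs [2 * INR e * eta] each. *)
  set (eta := eps / (2 * (4 + 4 * INR e))).
  assert (Heta : 0 < eta) by (apply Rdiv_lt_0_compat; lra).
  assert (Heta' : (4 + 4 * INR e) * eta = eps / 2) by (unfold eta; field; lra).
  destruct (H1 eta Heta) as [d [Hd Hf1]].
  (* For the estimate from below W(x) >= W(x0) suffices, and [d'] makes x |W(x0)| at most eps/2. *)
  set (d' := eps / (2 * (Rabs (W x0) + 1))).
  assert (HWp := Rabs_pos (W x0)).
  assert (Hd' : 0 < d') by (apply Rdiv_lt_0_compat; lra).
  assert (Hd'' : d' * (Rabs (W x0) + 1) = eps / 2) by (unfold d'; field; lra).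
  exists (Rmin (Rmin d d') x0). split.
  { repeat apply Rmin_case; unfold x0; lra. }
  intros x Hx.
  assert (Hm1 := Rmin_l (Rmin d d') x0). assert (Hm2 := Rmin_r (Rmin d d') x0).
  assert (Hm3 := Rmin_l d d'). assert (Hm4 := Rmin_r d d').
  assert (Hx0 : x0 <= 1 / 2 /\ x0 < a) by (unfold x0; lra).
  assert (Hx' : 0 < x < d /\ x < d' /\ x < x0 ) by lra. clear Hx Hm1 Hm2 Hm3 Hm4.
  assert (Hterm : forall t, 0 < t <= x -> Rabs (INR e / (1 - t) * f1 t) <= 2 * INR e * eta).
  { intros t Ht. rewrite Rabs_mult. apply Rmult_le_compat; try apply Rabs_pos.
    - unfold Rdiv. rewrite Rabs_mult, (Rabs_pos_eq (INR e)), (Rmult_comm 2) by lra.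
      apply Rmult_le_compat_l; [lra|].
      rewrite Rabs_pos_eq. 2:{ left; apply Rinv_0_lt_compat; lra. }
      apply Rmult_le_reg_l with (1 - t); [lra|]. rewrite Rinv_r; lra.
    - apply Hf1. lra. }
  destruct (mean_value f1 f2 (x / 2) x) as [c [Hmv Hcx]]; [lra| |].
  { intros t Ht. apply (Hc t). lra. }
  assert (Ha1 := Hf1 x ltac:(lra)). apply Rabs_le_between in Ha1.
  assert (Ha2 := Hf1 (x / 2) ltac:(lra)). apply Rabs_le_between in Ha2.
  assert (Ht1 := Hterm x ltac:(lra)). apply Rabs_le_between in Ht1.
  assert (Ht2 := Hterm c ltac:(lra)). apply Rabs_le_between in Ht2.
  assert (HW1 := HW c x ltac:(lra) ltac:(lra) ltac:(lra)).
  assert (HW2 := HW x x0 ltac:(lra) ltac:(lra) ltac:(lra)).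
  assert (Hab := Rle_abs (- W x0)). rewrite Rabs_Ropp in Hab.
  assert (E1 : f2 c = W c + INR e / (1 - c) * f1 c) by (unfold W, thin_primitive; ring).
  assert (E2 : f2 x = W x + INR e / (1 - x) * f1 x) by (unfold W, thin_primitive; ring).
  assert (Hee : 0 <= 2 * INR e * eta) by (apply Rmult_le_pos; lra).
  rewrite E2. apply Rabs_le_between.
  set (T := 2 * INR e * eta) in *.
  assert (HT : 4 * eta + 2 * T = eps / 2) by (unfold T; lra).
  assert (Hxx : x * Rabs (W x0) <= eps / 2) by nra.
  split.
  - nra.
  - assert (x * (W x - T) <= 4 * eta); [|nra].
    apply Rle_trans with (x * f2 c); [|nra].
    apply Rmult_le_compat_l; lra.
Qed.

(** * Local solutions and comparison with powers *)

(** No behaviour of f'' at 0 is demanded: x f'' -> 0 follows from the sign of the operator, see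
    [local_solution_small]. The dimension is e + 1. *)
Definition local_solution (e : nat) (n a : R) (f f1 f2 f3 : R -> R) : Prop :=
  derive_chain a f f1 f2 f3 /\ vanishes0 f /\ vanishes0 f1 /\
  forall x, 0 < x < a ->
    0 < f x /\ thin_op e f1 f2 f3 x = - ((1 - x) * Rpower (f x) (1 - n)).

Lemma local_solution_restrict (e : nat) (n a b : R) (f f1 f2 f3 : R -> R) :
  b <= a -> local_solution e n a f f1 f2 f3 -> local_solution e n b f f1 f2 f3.
Proof.
  intros Hb (H1 & H2 & H3 & H4). repeat split; try assumption;
    first [apply H1; lra | apply H4; lra].
Qed.

Lemma Rpower_pos (x y : R) : 0 < Rpower x y.
Proof. apply exp_pos. Qed.

Lemma local_solution_small (e : nat) (n a : R) (f f1 f2 f3 : R -> R) :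
  0 < a <= 1 -> local_solution e n a f f1 f2 f3 -> small_at_0 f f1 f2.
Proof.
  intros Ha (Hc & H0 & H1 & Heq).
  apply (thin_subsolution_small e f f1 f2 f3 a); try assumption.
  intros x Hx. destruct (Heq x Hx) as [_ ->].
  assert (H := Rpower_pos (f x) (1 - n)). nra.
Qed.

Lemma Rpower_neg_decr (s x y : R) :
  s <= 0 -> 0 < x -> x <= y -> Rpower y s <= Rpower x s.
Proof.
  intros Hs Hx Hxy.
  replace s with (- (- s)) by ring. rewrite !(Rpower_Ropp _ (- s)).
  apply Rinv_le_contravar; [apply Rpower_pos|].
  apply Rle_Rpower_l; lra.
Qed.

(** The right-hand side -(1-x) s^(1-n) is nondecreasing in s for n >= 1, so the difference of two
    solutions and its image under the operator have the same sign. *)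
Lemma local_solution_unique (e : nat) (n a b : R) (f f1 f2 f3 g g1 g2 g3 : R -> R) :
  1 <= n -> 0 < b < a -> a <= 1 ->
  local_solution e n a f f1 f2 f3 -> local_solution e n a g g1 g2 g3 ->
  f b = g b -> forall x, 0 < x <= b -> f x = g x.
Proof.
  intros Hn Hb Ha Hf Hg Hfg x Hx.
  assert (Hsf := local_solution_small e n a f f1 f2 f3 ltac:(lra) Hf).
  assert (Hsg := local_solution_small e n a g g1 g2 g3 ltac:(lra) Hg).
  destruct Hf as (Hcf & _ & _ & Hf). destruct Hg as (Hcg & _ & _ & Hg).
  apply Rminus_diag_uniq.
  apply (zero_propagates_left e (fun x => f x - g x) (fun x => f1 x - g1 x)
    (fun x => f2 x - g2 x) (fun x => f3 x - g3 x) a b); try lra.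
  - apply derive_chain_minus; assumption.
  - apply small_at_0_minus; assumption.
  - intros t Ht. rewrite thin_op_minus.
    destruct (Hf t ltac:(lra)) as [Hfp ->]. destruct (Hg t ltac:(lra)) as [Hgp ->].
    replace (- _ - - _) with
      ((1 - t) * (Rpower (g t) (1 - n) - Rpower (f t) (1 - n))) by ring.
    destruct (Rle_dec (f t) (g t)) as [Hle|Hle].
    + assert (H := Rpower_neg_decr (1 - n) _ _ ltac:(lra) Hfp Hle).
      assert ((1 - t) * (Rpower (g t) (1 - n) - Rpower (f t) (1 - n)) <= 0); nra.
    + assert (H := Rpower_neg_decr (1 - n) _ (f t) ltac:(lra) Hgp ltac:(lra)).
      apply Rmult_le_pos; nra.
Qed.

Lemma is_derive_Rpower (s x : R) :
  0 < x -> is_derive (fun y => Rpower y s) x (s * Rpower x (s - 1)).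
Proof. intros Hx. apply is_derive_Reals, derivable_pt_lim_power, Hx. Qed.

Lemma Rpower_Rpower_inv (s x : R) : s <> 0 -> 0 < x -> Rpower (Rpower x (/ s)) s = x.
Proof. intros Hs Hx. rewrite Rpower_mult, Rinv_l, Rpower_1; auto. Qed.

Lemma vanishes0_Rpower (s : R) : 0 < s -> vanishes0 (fun x => Rpower x s).
Proof.
  intros Hs eps Heps. exists (Rpower eps (/ s)). split; [apply Rpower_pos|].
  intros x Hx. rewrite Rabs_pos_eq by (left; apply Rpower_pos).
  rewrite <- (Rpower_Rpower_inv s eps) by lra.
  apply Rle_Rpower_l; lra.
Qed.

(** * The pure power A x^nu as a barrier *)

Section PowerProfile.

Variable n : R.
Hypothesis n_range : 3 / 2 < n < 3.

Local Notation nu := (3 / n).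
Local Notation A := (Rpower (mu n) (- (1 / n))).

Lemma nu_range : 1 < nu < 2.
Proof.
  split; apply Rmult_lt_reg_r with n; try lra;
    unfold Rdiv; rewrite Rmult_assoc, Rinv_l; lra.
Qed.

Lemma mu_pos : 0 < mu n.
Proof. assert (H := nu_range). unfold mu. repeat apply Rmult_lt_0_compat; lra. Qed.

Lemma amplitude_pos : 0 < A.
Proof. apply Rpower_pos. Qed.

Lemma amplitude_power : Rpower A (1 - n) = A * mu n.
Proof.
  rewrite Rpower_mult. transitivity (A * Rpower (mu n) 1).
  - rewrite <- Rpower_plus. f_equal. field. lra.
  - now rewrite Rpower_1 by apply mu_pos.
Qed.

(** The two balances behind the leading term: nu (1-n) = nu - 3 matches the exponents of H^(1-n) and
    H''', and A^(-n) = mu matches their coefficients. A multiple k of the profile is off by the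
    factor k^(1-n) on one side and k on the other. *)
Lemma profile_power (k x : R) :
  0 < k -> 0 < x ->
  Rpower (k * A * Rpower x nu) (1 - n)
  = Rpower k (1 - n) * A * mu n * Rpower x (nu - 3).
Proof.
  intros Hk Hx. assert (HA := amplitude_pos).
  rewrite <- !Rpower_mult_distr, amplitude_power, Rpower_mult;
    try apply Rpower_pos; try apply Rmult_lt_0_compat; try assumption.
  replace (nu * (1 - n)) with (nu - 3) by (field; lra). ring.
Qed.

Definition power0 (K x : R) := K * Rpower x nu.
Definition power1 (K x : R) := K * nu * Rpower x (nu - 1).
Definition power2 (K x : R) := K * nu * (nu - 1) * Rpower x (nu - 2).
Definition power3 (K x : R) := - (K * mu n * Rpower x (nu - 3)).

Lemma power_chain (a K : R) :
  derive_chain a (power0 K) (power1 K) (power2 K) (power3 K).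
Proof.
  intros x [Hx _]. unfold power0, power1, power2, power3, mu.
  split; [|split].
  - evar_last. { apply (is_derive_scal (fun x => Rpower x nu)), is_derive_Rpower, Hx. }
    unfold scal; simpl; unfold mult; simpl. ring.
  - evar_last. { apply (is_derive_scal (fun x => Rpower x (nu - 1))), is_derive_Rpower, Hx. }
    replace (nu - 1 - 1) with (nu - 2) by ring. unfold scal; simpl; unfold mult; simpl. ring.
  - evar_last. { apply (is_derive_scal (fun x => Rpower x (nu - 2))), is_derive_Rpower, Hx. }
    replace (nu - 2 - 1) with (nu - 3) by ring. unfold scal; simpl; unfold mult; simpl. ring.
Qed.

Lemma Rpower_step (s x : R) : 0 < x -> Rpower x s = x * Rpower x (s - 1).
Proof.
  intros Hx. rewrite <- (Rpower_1 x) at 2 by assumption.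
  rewrite <- Rpower_plus. f_equal. ring.
Qed.

Lemma power_small (K : R) : small_at_0 (power0 K) (power1 K) (power2 K).
Proof.
  assert (H := nu_range). split; [|split].
  - apply vanishes0_scal, vanishes0_Rpower. lra.
  - apply vanishes0_scal, vanishes0_Rpower. lra.
  - apply (vanishes0_ext _ (fun x => K * nu * (nu - 1) * Rpower x (nu - 1)) 1); [lra| |].
    + intros x Hx. unfold power2. rewrite (Rpower_step (nu - 1)) by lra.
      replace (nu - 1 - 1) with (nu - 2) by ring. ring.
    + apply vanishes0_scal, vanishes0_Rpower. lra.
Qed.

Lemma power_thin_op_upper (e : nat) (K x : R) :
  0 <= K -> 0 < x < 1 ->
  thin_op e (power1 K) (power2 K) (power3 K) x <= - (K * mu n * Rpower x (nu - 3)).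
Proof.
  intros HK Hx. assert (Hn := nu_range). assert (He := pos_INR e).
  unfold thin_op, power1, power2, power3.
  assert (0 <= INR e / (1 - x) * (K * nu * (nu - 1) * Rpower x (nu - 2))).
  { assert (0 <= / (1 - x)) by (left; apply Rinv_0_lt_compat; lra).
    assert (Hp := Rpower_pos x (nu - 2)).
    repeat (apply Rmult_le_pos; try lra). }
  assert (0 <= INR e / (1 - x) ^ 2 * (K * nu * Rpower x (nu - 1))).
  { assert (0 <= / (1 - x) ^ 2).
    { left; apply Rinv_0_lt_compat, pow_lt; lra. }
    assert (Hp := Rpower_pos x (nu - 1)).
    repeat (apply Rmult_le_pos; try lra). }
  lra.
Qed.

(** Relative to x^(nu-3) the lower-order terms carry factors x and x^2, so an arbitrarily small
    increase of the coefficient absorbs them near 0. *)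
Lemma power_thin_op_lower (e : nat) (K eps : R) :
  0 < eps -> exists a, 0 < a /\ forall x, 0 < x < a ->
  - ((K + eps) * mu n * Rpower x (nu - 3)) <= thin_op e (power1 K) (power2 K) (power3 K) x.
Proof.
  intros Heps. assert (Hn := nu_range). assert (He := pos_INR e). assert (Hm := mu_pos).
  assert (Hv : vanishes0 (fun x => INR e / (1 - x) * (K * nu * (nu - 1)) * x
     + (INR e / (1 - x) ^ 2 * (K * nu)) * x * x)).
  { assert (Hi : forall x, 0 < x < 1 / 2 -> 0 <= / (1 - x) <= 2).
    { intros x Hx. split. left; apply Rinv_0_lt_compat; lra.
      apply Rmult_le_reg_l with (1 - x); [lra|]. rewrite Rinv_r; lra. }
    apply (vanishes0_ext _ (fun x => / (1 - x) * (INR e * (K * nu * (nu - 1)) * x)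
      + / (1 - x) * (/ (1 - x) * (INR e * (K * nu) * (x * x)))) (1 / 2)); [lra| |].
    - intros x Hx. field. lra.
    - assert (HB : forall f, vanishes0 f -> vanishes0 (fun x => / (1 - x) * f x)).
      { intros f. apply (vanishes0_bounded_mult f _ (1 / 2) 2); [lra|].
        intros x Hx. rewrite Rabs_pos_eq; apply Hi, Hx. }
      apply vanishes0_plus; repeat apply HB; apply vanishes0_scal;
        try apply vanishes0_mult; apply vanishes0_id. }
  destruct (Hv (eps * mu n)) as [a [Ha H]]. { apply Rmult_lt_0_compat; assumption. }
  exists (Rmin a 1). split. { apply Rmin_case; lra. }
  intros x Hx. assert (Hm1 := Rmin_l a 1). assert (Hm2 := Rmin_r a 1).
  specialize (H x ltac:(lra)). apply Rabs_le_between in H.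
  unfold thin_op, power1, power2, power3.
  rewrite (Rpower_step (nu - 1)), (Rpower_step (nu - 2)) by lra.
  replace (nu - 1 - 1) with (nu - 2) by ring.
  rewrite (Rpower_step (nu - 2)) by lra.
  replace (nu - 2 - 1) with (nu - 3) by ring.
  assert (Hp := Rpower_pos x (nu - 3)). set (P := Rpower x (nu - 3)) in *.
  set (t1 := INR e / (1 - x)) in *. set (t2 := INR e / (1 - x) ^ 2) in *.
  nra.
Qed.

(** Here n > 3/2 enters as nu < 2: the quotient x^(2-nu) of the two powers tends to 0. *)
Lemma power_dominates_square (k C : R) :
  (exists delta, 0 < delta /\ forall x, 0 < x < delta -> k * Rpower x nu <= C * x ^ 2) ->
  k <= 0.
Proof.
  intros [d [Hd H]]. assert (Hn := nu_range). apply Rnot_lt_le. intros Hk.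
  destruct (vanishes0_scal _ C (vanishes0_Rpower (2 - nu) ltac:(lra)) (k / 2)) as [b [Hb HC]];
    [lra|].
  assert (Hm : 0 < Rmin d b) by (apply Rmin_case; lra).
  assert (Hm1 := Rmin_l d b). assert (Hm2 := Rmin_r d b).
  set (x := Rmin d b / 2) in *.
  specialize (H x ltac:(unfold x; lra)). specialize (HC x ltac:(unfold x; lra)).
  apply Rabs_le_between in HC.
  assert (E : x ^ 2 = Rpower x nu * Rpower x (2 - nu)).
  { rewrite <- Rpower_plus. replace (nu + (2 - nu)) with (INR 2) by (simpl; ring).
    rewrite Rpower_pow; [reflexivity|unfold x; lra]. }
  rewrite E in H. assert (Hp := Rpower_pos x nu). nra.
Qed.

Lemma Rpower_gt_1_neg (k s : R) : s < 0 -> 1 < k -> Rpower k s < 1.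
Proof.
  intros Hs Hk. rewrite <- (Rpower_O k) by lra. apply Rpower_lt; lra.
Qed.

Lemma Rpower_lt_1_neg (k s : R) : s < 0 -> 0 < k < 1 -> 1 < Rpower k s.
Proof.
  intros Hs Hk. unfold Rpower. rewrite <- exp_0. apply exp_increasing.
  assert (ln k < 0) by (rewrite <- ln_1; apply ln_increasing; lra). nra.
Qed.

(** A large f makes f^(1-n) small, hence the third derivative too weak to keep f large: with k =
    (1+eta)^(1-n) < 1 the difference f - k A x^nu has a nonnegative image under the operator, so it
    is at most C x^2, contradicting k < 1 + eta. *)
Lemma not_eventually_above (e : nat) (a eta : R) (f f1 f2 f3 : R -> R) :
  0 < a <= 1 -> 0 < eta -> local_solution e n a f f1 f2 f3 ->
  ~ (forall x, 0 < x < a -> (1 + eta) * A * Rpower x nu <= f x).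
Proof.
  intros Ha Heta (Hc & H0 & H1 & Heq) Habs.
  assert (HA := amplitude_pos). assert (Hm := mu_pos).
  set (k := Rpower (1 + eta) (1 - n)).
  assert (Hk : k < 1) by (apply Rpower_gt_1_neg; lra).
  assert (Hk0 : 0 < k) by apply Rpower_pos.
  assert (HkA : 0 < k * A) by (apply Rmult_lt_0_compat; assumption).
  destruct (power_small (k * A)) as (Hp0 & Hp1 & _).
  destruct (thin_supersolution_bound e (fun x => f x - power0 (k * A) x)
    (fun x => f1 x - power1 (k * A) x) (fun x => f2 x - power2 (k * A) x)
    (fun x => f3 x - power3 (k * A) x) a) as [C [d [Hd HC]]].
  - lra.
  - apply derive_chain_minus; [assumption|apply power_chain].
  - intros x Hx. rewrite thin_op_minus. destruct (Heq x Hx) as [Hfp ->].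
    assert (Hup := power_thin_op_upper e (k * A) x ltac:(lra) ltac:(lra)).
    assert (Hle : Rpower (f x) (1 - n) <= k * A * mu n * Rpower x (nu - 3)).
    { unfold k. rewrite <- profile_power by lra.
      apply Rpower_neg_decr; [lra| |apply Habs, Hx].
      repeat apply Rmult_lt_0_compat; try apply Rpower_pos; lra. }
    assert (Hp := Rpower_pos (f x) (1 - n)). nra.
  - apply vanishes0_minus; assumption.
  - apply vanishes0_minus; assumption.
  - assert (Hneg : (1 + eta - k) * A <= 0).
    { apply (power_dominates_square _ C). exists (Rmin a d).
      split. { apply Rmin_case; lra. }
      intros x Hx. assert (Hm1 := Rmin_l a d). assert (Hm2 := Rmin_r a d).
      specialize (HC x ltac:(lra)). specialize (Habs x ltac:(lra)).
      unfold power0 in HC. lra. }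
    nra.
Qed.

(** The mirror image, applied to A x^nu - f with k = (1-eta)^(1-n) > 1. Now the factor 1 - x and the
    lower-order terms have the unfavourable sign, and the gap k - 1 pays for both. *)
Lemma not_eventually_below (e : nat) (a eta : R) (f f1 f2 f3 : R -> R) :
  0 < a <= 1 -> 0 < eta < 1 -> local_solution e n a f f1 f2 f3 ->
  ~ (forall x, 0 < x < a -> f x <= (1 - eta) * A * Rpower x nu).
Proof.
  intros Ha Heta (Hc & H0 & H1 & Heq) Habs.
  assert (HA := amplitude_pos). assert (Hm := mu_pos).
  set (k := Rpower (1 - eta) (1 - n)).
  assert (Hk : 1 < k) by (apply Rpower_lt_1_neg; lra).
  destruct (power_small A) as (Hp0 & Hp1 & _).
  set (eps := (k - 1) * A / 2).
  assert (Heps : 0 < eps) by (unfold eps; nra).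
  destruct (power_thin_op_lower e A eps Heps) as [b [Hb Hlow]].
  (* Half of the gap goes into [eps] for the lower-order terms; for x < t the other half covers the
     factor 1 - x, since then (1-x) k >= (1+k)/2. *)
  set (t := (k - 1) / (2 * k)).
  assert (Ht : 0 < t) by (apply Rdiv_lt_0_compat; lra).
  assert (Hkt : t * k = (k - 1) / 2) by (unfold t; field; lra).
  set (c := Rmin (Rmin a b) t).
  assert (Hcp : 0 < c) by (unfold c; repeat apply Rmin_case; lra).
  assert (Hcl : c <= a /\ c <= b /\ c <= t).
  { unfold c. assert (Hm1 := Rmin_l (Rmin a b) t). assert (Hm2 := Rmin_r (Rmin a b) t).
    assert (Hm3 := Rmin_l a b). assert (Hm4 := Rmin_r a b). lra. }
  destruct (thin_supersolution_bound e (fun x => power0 A x - f x)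
    (fun x => power1 A x - f1 x) (fun x => power2 A x - f2 x)
    (fun x => power3 A x - f3 x) c) as [C [d [Hd HC]]].
  - lra.
  - apply derive_chain_minus; [apply power_chain|].
    intros x Hx. apply Hc. lra.
  - intros x Hx. rewrite thin_op_minus. destruct (Heq x ltac:(lra)) as [Hfp ->].
    specialize (Hlow x ltac:(lra)).
    assert (Hle : k * A * mu n * Rpower x (nu - 3) <= Rpower (f x) (1 - n)).
    { unfold k. rewrite <- profile_power by lra.
      apply Rpower_neg_decr; [lra|assumption|apply Habs; lra]. }
    assert (Hp := Rpower_pos x (nu - 3)).
    assert (HQ : 0 < A * mu n * Rpower x (nu - 3)) by (repeat (assumption || apply Rmult_lt_0_compat)).
    assert (Hge : (1 - x) * (k * A * mu n * Rpower x (nu - 3))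
             <= (1 - x) * Rpower (f x) (1 - n)) by (apply Rmult_le_compat_l; lra).
    assert (Hxk : (A + eps) * mu n * Rpower x (nu - 3)
             <= (1 - x) * (k * A * mu n * Rpower x (nu - 3))).
    { replace ((A + eps) * mu n * Rpower x (nu - 3))
        with ((1 + (k - 1) / 2) * (A * mu n * Rpower x (nu - 3))) by (unfold eps; field).
      replace ((1 - x) * (k * A * mu n * Rpower x (nu - 3)))
        with (((1 - x) * k) * (A * mu n * Rpower x (nu - 3))) by ring.
      apply Rmult_le_compat_r; [lra|]. nra. }
    lra.
  - apply vanishes0_minus; assumption.
  - apply vanishes0_minus; assumption.
  - assert (Hneg : eta * A <= 0).
    { apply (power_dominates_square _ C). exists (Rmin c d).
      split. { apply Rmin_case; lra. }
      intros x Hx. assert (Hm1 := Rmin_l c d). assert (Hm2 := Rmin_r c d).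
      specialize (HC x ltac:(lra)). specialize (Habs x ltac:(lra)).
      unfold power0 in HC. lra. }
    nra.
Qed.

End PowerProfile.

(** * Zeros, and the comparison of a solution with A x^nu *)

Lemma is_derive_continuity_pt (f : R -> R) (x l : R) :
  is_derive f x l -> continuity_pt f x.
Proof.
  intros H. apply derivable_continuous_pt. exists l. apply is_derive_Reals, H.
Qed.

Lemma sign_change_zero (f : R -> R) (x y : R) :
  (forall t, Rmin x y <= t <= Rmax x y -> continuity_pt f t) ->
  f x < 0 -> 0 < f y -> exists z, Rmin x y <= z <= Rmax x y /\ f z = 0.
Proof.
  intros Hc Hx Hy. destruct (Rtotal_order x y) as [Hlt|[Heq|Hgt]].
  - rewrite Rmin_left, Rmax_right in * by lra.
    destruct (IVT_interv f x y Hc Hlt Hx Hy) as [z Hz]. exists z. exact Hz.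
  - subst. lra.
  - rewrite Rmin_right, Rmax_left in * by lra.
    destruct (IVT_interv (fun t => - f t) y x) as [z [Hz E]]; try lra.
    + intros t Ht. apply continuity_pt_opp, Hc, Ht.
    + exists z. split; lra.
Qed.

(** Positivity on (0, d) keeps the zeros away from 0; the first one is the supremum of the t for
    which f > 0 on (0, t]. *)
Lemma first_zero (f : R -> R) (b d y : R) :
  (forall x, 0 < x < b -> continuity_pt f x) ->
  0 < d -> (forall x, 0 < x < d -> 0 < f x) -> 0 < y < b -> f y <= 0 ->
  exists z, 0 < z <= y /\ f z = 0 /\ forall x, 0 < x < z -> 0 < f x.
Proof.
  intros Hc Hd Hpos Hy Hfy.
  set (E := fun t => 0 < t <= y /\ forall s, 0 < s <= t -> 0 < f s).
  assert (Hdy : d <= y) by (apply Rnot_lt_le; intros H; specialize (Hpos y); lra).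
  assert (HE0 : E (d / 2)).
  { split; [lra|]. intros s Hs. apply Hpos. lra. }
  destruct (completeness E) as [z [Hub Hlub]].
  { exists y. intros t [Ht _]. lra. }
  { exists (d / 2). exact HE0. }
  assert (Hz0 : 0 < z) by (specialize (Hub _ HE0); lra).
  assert (Hzy : z <= y) by (apply Hlub; intros t [Ht _]; lra).
  assert (Hleft : forall x, 0 < x < z -> 0 < f x).
  { intros x Hx. apply Rnot_le_lt. intros Hn.
    assert (z <= x); [|lra]. apply Hlub. intros t [Ht Hs].
    apply Rnot_lt_le. intros Hxt. specialize (Hs x). lra. }
  exists z. split; [lra|]. split; [|exact Hleft].
  assert (Hcz := Hc z ltac:(lra)).
  destruct (Rtotal_order (f z) 0) as [Hneg|[Hzero|Hp]]; [|assumption|].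
  - destruct (Hcz (- f z) ltac:(lra)) as [al [Hal H]].
    set (s := Rmax (z - al / 2) (z / 2)).
    assert (Hs : 0 < s < z /\ z - s < al).
    { unfold s. apply Rmax_case_strong; lra. }
    specialize (H s). specialize (Hleft s ltac:(lra)).
    assert (Hds : R_dist (f s) (f z) < - f z).
    { apply H. split; [split; [exact I|lra]|].
      simpl. unfold R_dist. rewrite Rabs_left; lra. }
    unfold R_dist in Hds. rewrite Rabs_right in Hds; lra.
  - destruct (Hcz (f z) ltac:(lra)) as [al [Hal H]].
    assert (Hne : z <> y) by (intros ->; lra).
    set (t := Rmin (z + al / 2) y).
    assert (Ht : z < t <= y /\ t - z < al).
    { unfold t. apply Rmin_case_strong; lra. }
    assert (t <= z); [|lra]. apply Hub. split; [lra|].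
    intros s Hs. destruct (Rtotal_order s z) as [Hlt|[->|Hgt]].
    + apply Hleft. lra.
    + assumption.
    + assert (Hds : R_dist (f s) (f z) < f z).
      { apply H. split; [split; [exact I|lra]|].
        simpl. unfold R_dist. rewrite Rabs_right; lra. }
      unfold R_dist in Hds. apply Rabs_def2 in Hds. lra.
Qed.

Lemma ratio_close_to_1 (e : nat) (n a eta : R) (f f1 f2 f3 : R -> R) :
  3 / 2 < n < 3 -> 0 < a <= 1 -> 0 < eta < 1 -> local_solution e n a f f1 f2 f3 ->
  exists x, 0 < x < a /\
    (1 - eta) * Rpower (mu n) (- (1 / n)) * Rpower x (3 / n) < f x <
    (1 + eta) * Rpower (mu n) (- (1 / n)) * Rpower x (3 / n).
Proof.
  intros Hn Ha Heta Hsol.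
  assert (Hab := not_eventually_above n Hn e a eta f f1 f2 f3 Ha ltac:(lra) Hsol).
  assert (Hbe := not_eventually_below n Hn e a eta f f1 f2 f3 Ha Heta Hsol).
  apply not_all_ex_not in Hab. destruct Hab as [x Hx].
  apply not_all_ex_not in Hbe. destruct Hbe as [y Hy].
  apply imply_to_and in Hx. destruct Hx as [Hx Hfx].
  apply imply_to_and in Hy. destruct Hy as [Hy Hfy].
  apply Rnot_le_lt in Hfx. apply Rnot_le_lt in Hfy.
  set (A := Rpower (mu n) (- (1 / n))) in *.
  assert (HA : forall t, 0 < A * Rpower t (3 / n)).
  { intros t. apply Rmult_lt_0_compat; apply Rpower_pos. }
  assert (Hlt : forall t k l, k < l -> k * A * Rpower t (3 / n) < l * A * Rpower t (3 / n)).
  { intros t k l Hkl. specialize (HA t). nra. }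
  destruct (Rlt_dec ((1 - eta) * A * Rpower x (3 / n)) (f x)) as [H|H].
  { exists x. lra. }
  destruct (Rlt_dec (f y) ((1 + eta) * A * Rpower y (3 / n))) as [H'|H'].
  { exists y. lra. }
  destruct (sign_change_zero (fun t => f t - power0 n A t) x y) as [z [Hz Ez]].
  - intros t Ht. apply (is_derive_continuity_pt _ _ (f1 t - power1 n A t)).
    destruct Hsol as [Hc _].
    apply (derive_chain_minus a _ _ _ _ _ _ _ _ Hc (power_chain n a A)).
    revert Ht. unfold Rmin, Rmax. destruct (Rle_dec x y); lra.
  - unfold power0. specialize (Hlt x (1 - eta) 1 ltac:(lra)). lra.
  - unfold power0. specialize (Hlt y 1 (1 + eta) ltac:(lra)). lra.
  - exists z. split.
    + revert Hz. unfold Rmin, Rmax. destruct (Rle_dec x y); lra.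
    + assert (Ez' : f z = A * Rpower z (3 / n)) by (unfold power0 in Ez; lra).
      rewrite Ez'. specialize (HA z). split; nra.
Qed.

(** While D = f - A x^nu is positive, monotonicity of s^(1-n) makes D L D nonnegative, because A
    x^nu satisfies L (A x^nu) <= -(A x^nu)^(1-n). Positivity of D therefore reproduces itself
    through the energy. *)
Lemma slope_above_power (e : nat) (n d : R) (f f1 f2 f3 : R -> R) :
  3 / 2 < n < 3 -> local_solution e n 1 f f1 f2 f3 -> 0 < d ->
  (forall x, 0 < x < d -> Rpower (mu n) (- (1 / n)) * Rpower x (3 / n) < f x) ->
  exists x0, 0 < x0 < 1 /\ forall x, x0 < x < 1 ->
    Rpower (mu n) (- (1 / n)) * (3 / n) * Rpower x (3 / n - 1) <= f1 x.
Proof.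
  intros Hn Hsol Hd Habove.
  assert (Hsm := local_solution_small e n 1 f f1 f2 f3 ltac:(lra) Hsol).
  destruct Hsol as (Hc & H0 & H1 & Heq).
  set (A := Rpower (mu n) (- (1 / n))) in *.
  assert (HA : 0 < A) by apply Rpower_pos.
  set (D := fun x => f x - power0 n A x). set (D1 := fun x => f1 x - power1 n A x).
  set (D2 := fun x => f2 x - power2 n A x). set (D3 := fun x => f3 x - power3 n A x).
  assert (HcD : derive_chain 1 D D1 D2 D3).
  { apply derive_chain_minus; [assumption|apply (power_chain n)]. }
  assert (HsD : small_at_0 D D1 D2).
  { apply small_at_0_minus; [assumption|apply (power_small n Hn)]. }
  assert (Hop : forall x, 0 < x < 1 -> 0 < D x -> 0 <= D x * thin_op e D1 D2 D3 x).
  { intros x Hx HD. apply Rmult_le_pos; [lra|].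
    unfold D1, D2, D3. rewrite thin_op_minus. destruct (Heq x Hx) as [Hfp ->].
    assert (Hup := power_thin_op_upper n Hn e A x ltac:(lra) Hx).
    assert (Hpp := profile_power n Hn 1 x ltac:(lra) ltac:(lra)). fold A in Hpp.
    replace (Rpower 1 (1 - n)) with 1 in Hpp
      by (unfold Rpower; rewrite ln_1, Rmult_0_r, exp_0; reflexivity).
    rewrite !Rmult_1_l in Hpp. rewrite <- Hpp in Hup.
    assert (HAx : 0 < A * Rpower x (3 / n)) by (apply Rmult_lt_0_compat; [exact HA|apply Rpower_pos]).
    assert (Hle := Rpower_neg_decr (1 - n) (A * Rpower x (3 / n)) (f x)
       ltac:(lra) HAx ltac:(unfold D, power0 in HD; lra)).
    assert (Hp := Rpower_pos (f x) (1 - n)). nra. }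
  assert (HD : forall x, 0 < x < 1 -> 0 < D x).
  (* At a first zero of D the energy argument would force D = 0 everywhere to its left. *)
  { intros x Hx. apply Rnot_le_lt. intros Hn'.
    destruct (first_zero D 1 d x) as (z & Hz & Ez & Hzp); try assumption.
    - intros t Ht. apply (is_derive_continuity_pt _ _ (D1 t)), HcD, Ht.
    - intros t Ht. specialize (Habove t Ht). unfold D, power0. lra.
    - assert (D (z / 2) = 0).
      { apply (zero_propagates_left e D D1 D2 D3 1 z); try assumption; try lra.
        intros t Ht. apply Hop; [lra|]. apply Hzp, Ht. }
      specialize (Hzp (z / 2)). lra. }
  assert (HE : forall x, 0 < x < 1 -> 0 <= energy e D D1 D2 x).
  { apply (energy_nonneg e D D1 D2 D3 1); try assumption; [lra|].
    intros x Hx. apply Hop; [assumption|]. apply HD, Hx. }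
  (* A nonnegative energy with D > 0 gives (1-x) D'' + D' >= (1-x) D'^2 / (2 D) >= 0, and the left
     side is (1-x)^2 times the derivative of D'/(1-x). *)
  assert (Hinc : forall x y, 0 < x -> x <= y -> y < 1 -> D1 x / (1 - x) <= D1 y / (1 - y)).
  { apply (derive_nonneg_incr _ (fun x => ((1 - x) * D2 x + D1 x) / (1 - x) ^ 2)).
    - intros x Hx. evar_last.
      + apply (is_derive_div D1 (fun x => 1 - x) x (D2 x) (-1)); [apply HcD, Hx| |lra].
        auto_derive; [trivial|ring].
      + simpl. field. lra.
    - intros x Hx. specialize (HE x Hx). specialize (HD x Hx).
      apply Rmult_le_pos. 2:{ left. apply Rinv_0_lt_compat, pow_lt. lra. }
      unfold energy in HE. assert (Hq : 0 < (1 - x) ^ e) by (apply pow_lt; lra).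
      assert (HE' : 0 <= (1 - x) * (D x * D2 x - D1 x ^ 2 / 2) + D x * D1 x).
      { apply Rmult_le_reg_l with ((1 - x) ^ e); [assumption|]. lra. }
      assert (0 <= (1 - x) * (D1 x ^ 2 / 2)).
      { assert (H := pow2_ge_0 (D1 x)). apply Rmult_le_pos; lra. }
      apply Rmult_le_reg_l with (D x); [assumption|]. lra. }
  (* Otherwise D would be nonincreasing from its limit 0, hence nowhere positive. From [x0] on,
     D'/(1-x) stays positive. *)
  assert (Hex : exists x0, 0 < x0 < 1 /\ 0 < D1 x0).
  { apply NNPP. intros Hno.
    assert (0 <= - D (1 / 2)).
    { apply (incr_from_vanishes0 (fun x => - D x) 1); [| |lra].
      - apply (derive_nonneg_incr _ (fun x => - D1 x)).
        + intros x Hx. apply (is_derive_opp D), HcD, Hx.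
        + intros x Hx. apply Ropp_0_ge_le_contravar. apply Rle_ge, Rnot_lt_le.
          intros Hp. apply Hno. exists x. split; assumption.
      - apply (vanishes0_ext _ (fun x => (-1) * D x) 1); [lra|intros; ring|].
        apply vanishes0_scal, HsD. }
    specialize (HD (1 / 2)). lra. }
  destruct Hex as (x0 & Hx0 & Hp). exists x0. split; [assumption|].
  intros x Hx. specialize (Hinc x0 x ltac:(lra) ltac:(lra) ltac:(lra)).
  assert (0 < D1 x0 / (1 - x0)) by (apply Rdiv_lt_0_compat; lra).
  assert (0 <= D1 x).
  { replace (D1 x) with (D1 x / (1 - x) * (1 - x)) by (field; lra).
    apply Rmult_le_pos; lra. }
  unfold D1, power1 in H2. lra.
Qed.

(** * Double power series *)

(** Grouping by total degree, as in [analytic2_at]; it reduces estimates on double arrays to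
    sequences in one index. *)
Definition diag (f : nat -> nat -> R) (N : nat) : R :=
  sum_f_R0 (fun i => f i (N - i)%nat) N.

Definition conv (u v : nat -> R) (N : nat) : R :=
  sum_f_R0 (fun m => u m * v (N - m)%nat) N.

Definition conv2 (f g : nat -> nat -> R) (i j : nat) : R :=
  sum_f_R0 (fun k => sum_f_R0 (fun l => f k l * g (i - k)%nat (j - l)%nat) j) i.

Lemma sum_f_R0_plus (u v : nat -> R) (N : nat) :
  sum_f_R0 (fun i => u i + v i) N = sum_f_R0 u N + sum_f_R0 v N.
Proof. apply plus_sum. Qed.

Lemma sum_f_R0_scal_l (c : R) (u : nat -> R) (N : nat) :
  sum_f_R0 (fun i => c * u i) N = c * sum_f_R0 u N.
Proof. rewrite scal_sum. apply sum_eq. intros. ring. Qed.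

Lemma sum_f_R0_nonneg (u : nat -> R) (N : nat) :
  (forall i, (i <= N)%nat -> 0 <= u i) -> 0 <= sum_f_R0 u N.
Proof.
  intros H. induction N as [|N IH]; simpl.
  - apply H. lia.
  - apply Rplus_le_le_0_compat; [apply IH; intros; apply H; lia|apply H; lia].
Qed.

Lemma sum_f_R0_term_le (u : nat -> R) (N k : nat) :
  (forall i, (i <= N)%nat -> 0 <= u i) -> (k <= N)%nat -> u k <= sum_f_R0 u N.
Proof.
  intros H Hk. induction N as [|N IH].
  - replace k with 0%nat by lia. simpl. lra.
  - simpl. destruct (Nat.eq_dec k (S N)) as [->|Hne].
    + assert (0 <= sum_f_R0 u N); [|lra].
      apply sum_f_R0_nonneg. intros; apply H; lia.
    + assert (0 <= u (S N)) by (apply H; lia).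
      assert (u k <= sum_f_R0 u N); [|lra].
      apply IH; [|lia]. intros; apply H; lia.
Qed.

Lemma sum_triangle (G : nat -> nat -> R) (N : nat) :
  sum_f_R0 (diag G) N = sum_f_R0 (fun k => sum_f_R0 (G k) (N - k)%nat) N.
Proof.
  induction N as [|N IH]; [reflexivity|].
  simpl sum_f_R0 at 1. rewrite IH. unfold diag. simpl.
  rewrite (sum_eq (fun k => sum_f_R0 (G k) (S N - k)%nat)
    (fun k => sum_f_R0 (G k) (N - k)%nat + G k (S N - k)%nat)).
  - rewrite sum_f_R0_plus, Nat.sub_diag. simpl. ring.
  - intros k Hk. rewrite Nat.sub_succ_l by assumption. reflexivity.
Qed.

Lemma diag_flip (G : nat -> nat -> R) (N : nat) :
  diag (fun i j => G j i) N = diag G N.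
Proof.
  unfold diag. induction N as [|N IH] in G |- *; [reflexivity|].
  rewrite (decomp_sum (fun i => G (S N - i)%nat i)) by lia. simpl pred.
  rewrite tech5, Nat.sub_diag, Nat.sub_0_r, Rplus_comm. f_equal.
  transitivity (sum_f_R0 (fun k => G k (S (N - k))) N).
  - rewrite <- (IH (fun i j => G i (S j))). apply sum_eq. intros k Hk. reflexivity.
  - apply sum_eq. intros k Hk. f_equal. lia.
Qed.

(** The homogeneous parts of a product form the one-variable Cauchy product of the homogeneous
    parts. Both the multiplication of series and the majorant estimate rest on this. *)
Lemma diag_conv2 (f g : nat -> nat -> R) (N : nat) :
  diag (conv2 f g) N = conv (diag f) (diag g) N.
Proof.
  (* Both sides range over quadruples of indices with sum N. In this intermediate form k, k', l are
     free, and the order of k' and l can be exchanged. *)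
  transitivity (sum_f_R0 (fun k => sum_f_R0 (fun k' => sum_f_R0 (fun l =>
     f k l * g k' (N - k - k' - l)%nat) (N - k - k')%nat) (N - k)%nat) N).
  - transitivity (sum_f_R0 (diag (fun k k' => sum_f_R0 (fun l =>
     f k l * g k' (N - k - k' - l)%nat) (N - k - k')%nat)) N); [|apply sum_triangle].
    apply sum_eq. intros i Hi. apply sum_eq. intros k Hk.
    replace (N - k - (i - k))%nat with (N - i)%nat by lia. reflexivity.
  - transitivity (sum_f_R0 (diag (fun k l => sum_f_R0 (fun k' =>
     f k l * g k' (N - k - l - k')%nat) (N - k - l)%nat)) N).
    + rewrite sum_triangle. apply sum_eq. intros k Hk.
      set (M := (N - k)%nat).
      rewrite <- (sum_triangle (fun k' l => f k l * g k' (M - k' - l)%nat)).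
      rewrite <- (sum_triangle (fun l k' => f k l * g k' (M - l - k')%nat)).
      apply sum_eq. intros m Hm. rewrite <- diag_flip.
      apply sum_eq. intros i Hi. do 2 f_equal. lia.
    + apply sum_eq. intros m Hm. unfold diag at 1.
      unfold diag. rewrite Rmult_comm, scal_sum.
      apply sum_eq. intros k Hk. rewrite scal_sum.
      replace (N - k - (m - k))%nat with (N - m)%nat by lia.
      apply sum_eq. intros; ring.
Qed.

Lemma conv_sum_le (u v : nat -> R) (N : nat) :
  (forall k, 0 <= u k) -> (forall k, 0 <= v k) ->
  sum_f_R0 (conv u v) N <= sum_f_R0 u N * sum_f_R0 v N.
Proof.
  intros Hu Hv.
  change (conv u v) with (diag (fun k l => u k * v l)).
  rewrite sum_triangle, Rmult_comm, scal_sum. apply sum_Rle. intros k Hk.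
  rewrite sum_f_R0_scal_l. apply Rmult_le_compat_l; [apply Hu|].
  destruct (Nat.eq_dec k 0) as [->|Hk0]. { rewrite Nat.sub_0_r. lra. }
  rewrite (tech2 v (N - k) N) by lia.
  assert (0 <= sum_f_R0 (fun i => v (S (N - k) + i)%nat) (N - S (N - k))); [|lra].
  apply sum_f_R0_nonneg. intros; apply Hv.
Qed.

Lemma sum_geom_from_1_le (r : R) (N : nat) :
  0 <= r <= 1 / 2 ->
  sum_f_R0 (fun k => match k with O => 0 | S _ => r ^ k end) N <= 2 * r.
Proof.
  intros Hr.
  assert (H : sum_f_R0 (fun k => match k with O => 0 | S _ => r ^ k end) N
     <= 2 * r - 2 * r ^ S N).
  { induction N as [|N IH]; [simpl; lra|].
    rewrite tech5. change (r ^ S (S N)) with (r * r ^ S N).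
    assert (0 <= r ^ S N) by (apply pow_le; lra). nra. }
  assert (0 <= r ^ S N) by (apply pow_le; lra). lra.
Qed.

(* The weighted partial sums s_N of Y satisfy s_(N+1) <= C (2 r + 2 r s_N + s_N^2), which
   keeps them below 4 C r once r is small. *)
Lemma quadratic_recursion_bound (Y : nat -> R) (C : R) :
  1 <= C -> Y O = 0 -> (forall N, 0 <= Y N) ->
  (forall N, Y (S N) <= C * (1 + sum_f_R0 Y N + conv Y Y (S N))) ->
  exists M K, 1 <= K /\ 0 <= M /\ forall N, Y N <= M * K ^ N.
Proof.
  intros HC Y0 Yp Hrec.
  (* With 16 C^2 r = 1 the bound s <= 4 C r reproduces itself: 2 r + 8 C r^2 + 16 C^2 r^2 = 3 r + 8
     C r^2 <= 4 r. *)
  set (r := / (16 * C ^ 2)).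
  assert (HC2 : 1 <= C ^ 2) by nra.
  assert (Hr : 0 < r) by (apply Rinv_0_lt_compat; lra).
  assert (HrC : 16 * C ^ 2 * r = 1) by (unfold r; field; lra).
  assert (Hr2 : r <= 1 / 2) by nra.
  assert (HrC1 : 16 * C * r <= 1) by nra.
  (* The weighted partial sum r^(M+1) (Y 0 + ... + Y M) is the convolution of these powers with the
     u k = Y k r^k; the missing power r^0 encodes that Y (M+1) itself does not occur. *)
  set (E := fun k => match k with O => 0 | S _ => r ^ k end).
  assert (HEp : forall k, 0 <= E k).
  { intros [|k]; unfold E; [lra|apply pow_le; lra]. }
  assert (HE : forall N, sum_f_R0 E N <= 2 * r) by (intros; apply sum_geom_from_1_le; lra).
  set (u := fun k => Y k * r ^ k).
  assert (Hup : forall k, 0 <= u k).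
  { intros k. apply Rmult_le_pos; [apply Yp|apply pow_le; lra]. }
  assert (HS : forall N, sum_f_R0 u N <= 4 * C * r).
  { induction N as [|N IH].
    { simpl. unfold u. rewrite Y0. nra. }
    (* As Y 0 = 0, a convolution of Y with itself up to degree N + 1 sees only the entries up to N.
       Cutting u off there allows both factors to be estimated by the induction hypothesis. *)
    set (t := fun k => if le_dec k N then u k else 0).
    assert (Htp : forall k, 0 <= t k).
    { intros k. unfold t. destruct (le_dec k N); [apply Hup|lra]. }
    assert (Htu : forall M, (M <= N)%nat -> sum_f_R0 t M = sum_f_R0 u M).
    { intros M HM. apply sum_eq. intros i Hi. unfold t.
      destruct (le_dec i N); [reflexivity|lia]. }
    assert (Ht : sum_f_R0 t (S N) = sum_f_R0 u N).
    { rewrite tech5, Htu by lia. unfold t. destruct (le_dec (S N) N); [lia|ring]. }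
    assert (Hstep : forall M, (M <= S N)%nat -> u M <= C * (E M + conv E t M + conv t t M)).
    { intros [|M] HM.
      { unfold u, conv. simpl. rewrite Y0. unfold t, u. simpl.
        destruct (le_dec 0 N); [|lia]. rewrite Y0. lra. }
      assert (Hrp : 0 < r ^ S M) by (apply pow_lt; lra).
      apply Rle_trans with (C * (1 + sum_f_R0 Y M + conv Y Y (S M)) * r ^ S M).
      { unfold u. apply Rmult_le_compat_r; [lra|apply Hrec]. }
      rewrite Rmult_assoc. apply Rmult_le_compat_l; [lra|].
      rewrite !Rmult_plus_distr_r, Rmult_1_l.
      apply Rplus_le_compat; [apply Rplus_le_compat|].
      - unfold E. lra.
      - rewrite Rmult_comm, scal_sum.
        change (conv E t (S M)) with (diag (fun k l => E k * t l) (S M)).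
        rewrite <- diag_flip. unfold diag. rewrite tech5, Nat.sub_diag.
        change (E 0%nat) with 0. rewrite Rmult_0_l, Rplus_0_r.
        apply sum_Rle. intros k Hk. unfold t, u.
        destruct (le_dec k N); [|lia].
        rewrite Nat.sub_succ_l by assumption. unfold E. rewrite <- Nat.sub_succ_l by assumption.
        right. replace (r ^ S M) with (r ^ (S M - k) * r ^ k); [ring|].
        rewrite <- pow_add. f_equal. lia.
      - unfold conv. rewrite Rmult_comm, scal_sum.
        apply sum_Rle. intros k Hk. right.
        destruct (Nat.eq_dec k 0) as [->|Hk0].
        { unfold t, u. simpl. destruct (le_dec 0 N); [|lia]. rewrite Y0. ring. }
        destruct (Nat.eq_dec k (S M)) as [->|HkM].
        { rewrite Nat.sub_diag. unfold t, u. destruct (le_dec 0 N); [|lia].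
          rewrite Y0. ring. }
        unfold t, u. destruct (le_dec k N); [|lia]. destruct (le_dec (S M - k) N); [|lia].
        replace (r ^ S M) with (r ^ (S M - k) * r ^ k); [ring|].
        rewrite <- pow_add. f_equal. lia. }
    apply Rle_trans with (sum_f_R0 (fun M => C * (E M + conv E t M + conv t t M)) (S N)).
    { apply sum_Rle. intros M HM. apply Hstep, HM. }
    rewrite sum_f_R0_scal_l, !sum_f_R0_plus.
    assert (H1 := HE (S N)). assert (H2 := conv_sum_le E t (S N) HEp Htp).
    assert (H3 := conv_sum_le t t (S N) Htp Htp). rewrite Ht in H2, H3.
    assert (HSp : 0 <= sum_f_R0 u N) by (apply sum_f_R0_nonneg; intros; apply Hup).
    set (s := sum_f_R0 u N) in *.
    assert (H4 : sum_f_R0 E (S N) * s <= 2 * r * s) by (apply Rmult_le_compat_r; lra).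
    assert (H5 : s * s <= (4 * C * r) * (4 * C * r)) by (apply Rmult_le_compat; lra).
    assert (H6 : 2 * r * s <= 2 * r * (4 * C * r)) by (apply Rmult_le_compat_l; lra).
    apply Rle_trans with (C * (2 * r + 2 * r * (4 * C * r) + (4 * C * r) * (4 * C * r))).
    { apply Rmult_le_compat_l; lra. }
    replace (4 * C * r * (4 * C * r)) with (r * (16 * C ^ 2 * r)) by ring.
    rewrite HrC. nra. }
  exists (4 * C * r), (/ r). split; [|split].
  - rewrite <- (Rinv_1). apply Rinv_le_contravar; lra.
  - nra.
  - intros N. assert (Hrp : 0 < r ^ N) by (apply pow_lt; lra).
    rewrite pow_inv. apply Rle_div_r; [lra|].
    apply Rle_trans with (sum_f_R0 u N); [|apply HS].
    apply (sum_f_R0_term_le u N N); [intros; apply Hup|lia].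
Qed.

(** * Evaluation of dominated double series *)

Definition homog (a : nat -> nat -> R) (x y : R) (N : nat) : R :=
  diag (fun i j => a i j * x ^ i * y ^ j) N.

Definition absdiag (a : nat -> nat -> R) : nat -> R := diag (fun i j => Rabs (a i j)).

(** Geometric growth in the total degree; 1/K bounds the half-width of the box of convergence from
    below. Only K is tracked, as no later argument needs the value of M. *)
Definition dominated (K : R) (a : nat -> nat -> R) : Prop :=
  exists M, 0 <= M /\ forall N, absdiag a N <= M * K ^ N.

Definition ev (a : nat -> nat -> R) (x y : R) : R := Series (homog a x y).

Lemma diag_le (f g : nat -> nat -> R) (N : nat) :
  (forall i j, (i + j = N)%nat -> f i j <= g i j) -> diag f N <= diag g N.
Proof. intros H. apply sum_Rle. intros i Hi. apply H. lia. Qed.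

Lemma diag_ext (f g : nat -> nat -> R) (N : nat) :
  (forall i j, (i + j = N)%nat -> f i j = g i j) -> diag f N = diag g N.
Proof. intros H. apply sum_eq. intros i Hi. apply H. lia. Qed.

Lemma diag_plus (f g : nat -> nat -> R) (N : nat) :
  diag (fun i j => f i j + g i j) N = diag f N + diag g N.
Proof. apply sum_f_R0_plus. Qed.

Lemma diag_scal (c : R) (f : nat -> nat -> R) (N : nat) :
  diag (fun i j => c * f i j) N = c * diag f N.
Proof. apply (sum_f_R0_scal_l c (fun i => f i (N - i)%nat)). Qed.

Lemma absdiag_nonneg (a : nat -> nat -> R) (N : nat) : 0 <= absdiag a N.
Proof. apply sum_f_R0_nonneg. intros; apply Rabs_pos. Qed.

Lemma dominated_le (K L : R) (a : nat -> nat -> R) :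
  0 <= K -> K <= L -> dominated K a -> dominated L a.
Proof.
  intros HK HL (M & HM & H). exists M. split; [assumption|]. intros N.
  eapply Rle_trans. apply H. apply Rmult_le_compat_l; [assumption|].
  apply pow_incr. lra.
Qed.

Lemma INR_le_pow2 (N : nat) : 1 + INR N <= 2 ^ N.
Proof.
  induction N as [|N IH]; [simpl; lra|]. rewrite S_INR. simpl.
  assert (H := pos_INR N). lra.
Qed.

Lemma dominated_weight (K C : R) (a b : nat -> nat -> R) :
  0 <= K -> 0 <= C ->
  (forall i j, Rabs (b i j) <= C * (1 + INR (i + j)) * Rabs (a i j)) ->
  dominated K a -> dominated (2 * K) b.
Proof.
  intros HK HC Hb (M & HM & H). exists (C * M). split; [apply Rmult_le_pos; assumption|].
  intros N. apply Rle_trans with (C * (1 + INR N) * absdiag a N).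
  - unfold absdiag. rewrite <- diag_scal. apply diag_le. intros i j <-. apply Hb.
  - rewrite Rpow_mult_distr.
    replace (C * M * (2 ^ N * K ^ N)) with (C * 2 ^ N * (M * K ^ N)) by ring.
    assert (HN := pos_INR N).
    apply Rmult_le_compat.
    + apply Rmult_le_pos; lra.
    + apply absdiag_nonneg.
    + apply Rmult_le_compat_l; [assumption|apply INR_le_pow2].
    + apply H.
Qed.

Lemma homog_abs_le (a : nat -> nat -> R) (x y rho : R) (N : nat) :
  Rabs x <= rho -> Rabs y <= rho ->
  diag (fun i j => Rabs (a i j * x ^ i * y ^ j)) N <= absdiag a N * rho ^ N.
Proof.
  intros Hx Hy. unfold absdiag. rewrite Rmult_comm, <- diag_scal.
  apply diag_le. intros i j <-. rewrite !Rabs_mult, pow_add, <- !RPow_abs.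
  rewrite Rmult_assoc, Rmult_comm.
  apply Rmult_le_compat_r; [apply Rabs_pos|].
  apply Rmult_le_compat; try (apply pow_le, Rabs_pos);
    apply pow_incr; split; try apply Rabs_pos; assumption.
Qed.

Lemma homog_le (a : nat -> nat -> R) (x y rho : R) (N : nat) :
  Rabs x <= rho -> Rabs y <= rho ->
  Rabs (homog a x y N) <= absdiag a N * rho ^ N.
Proof.
  intros Hx Hy. eapply Rle_trans; [|apply (homog_abs_le a x y); eassumption].
  apply (Rsum_abs (fun i => a i (N - i)%nat * x ^ i * y ^ (N - i))).
Qed.

Lemma ex_series_geom_le (u : nat -> R) (M q : R) :
  0 <= q < 1 -> (forall N, Rabs (u N) <= M * q ^ N) -> ex_series u.
Proof.
  intros Hq Hu. apply (ex_series_le u (fun N => M * q ^ N) Hu).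
  apply (ex_series_scal M (fun N => q ^ N)). exists (/ (1 - q)).
  apply is_series_geom. rewrite Rabs_pos_eq; lra.
Qed.

Lemma homog_geom_le (K M rho x y : R) (a : nat -> nat -> R) (N : nat) :
  0 <= rho -> Rabs x <= rho -> Rabs y <= rho ->
  (forall N, absdiag a N <= M * K ^ N) ->
  Rabs (homog a x y N) <= M * (K * rho) ^ N.
Proof.
  intros Hrho Hx Hy H. eapply Rle_trans. apply (homog_le a x y rho); assumption.
  rewrite Rpow_mult_distr, <- Rmult_assoc.
  apply Rmult_le_compat_r; [apply pow_le; assumption|apply H].
Qed.

Section Convergence.

Variables (K rho x y : R).
Hypothesis K_nonneg : 0 <= K.
Hypothesis rho_nonneg : 0 <= rho.
Hypothesis K_rho : K * rho < 1.
Hypothesis x_le : Rabs x <= rho.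
Hypothesis y_le : Rabs y <= rho.

Lemma ex_series_homog_abs (a : nat -> nat -> R) :
  dominated K a -> ex_series (fun N => Rabs (homog a x y N)).
Proof.
  intros (M & HM & H). apply (ex_series_geom_le _ M (K * rho)).
  - split; [apply Rmult_le_pos; assumption|assumption].
  - intros N. rewrite Rabs_Rabsolu. apply homog_geom_le; assumption.
Qed.

Lemma ex_series_term_abs (a : nat -> nat -> R) :
  dominated K a -> ex_series (diag (fun i j => Rabs (a i j * x ^ i * y ^ j))).
Proof.
  intros (M & HM & H). apply (ex_series_geom_le _ M (K * rho)).
  - split; [apply Rmult_le_pos; assumption|assumption].
  - intros N. rewrite Rabs_pos_eq.
    + eapply Rle_trans. apply (homog_abs_le a x y rho); assumption.
      rewrite Rpow_mult_distr, <- Rmult_assoc.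
      apply Rmult_le_compat_r; [apply pow_le; assumption|apply H].
    + apply sum_f_R0_nonneg. intros; apply Rabs_pos.
Qed.

Lemma is_series_ev (a : nat -> nat -> R) :
  dominated K a -> is_series (homog a x y) (ev a x y).
Proof.
  intros H. apply Series_correct, ex_series_Rabs, ex_series_homog_abs, H.
Qed.

End Convergence.

(** Multiplication of the series by its first variable. *)
Definition shift (a : nat -> nat -> R) (i j : nat) : R :=
  match i with O => 0 | S k => a k j end.

Lemma diag_shift (a : nat -> nat -> R) (N : nat) :
  diag (shift a) N = match N with O => 0 | S k => diag a k end.
Proof.
  unfold diag. destruct N as [|N]; [reflexivity|].
  rewrite decomp_sum by lia. simpl. ring.
Qed.

Lemma sums_plus (a b : nat -> nat -> R) (x y l m : R) :
  is_series (homog a x y) l -> is_series (homog b x y) m ->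
  is_series (homog (fun i j => a i j + b i j) x y) (l + m).
Proof.
  intros Ha Hb. eapply is_series_ext; [|apply (is_series_plus _ _ _ _ Ha Hb)].
  intros N. unfold plus; simpl. unfold homog. rewrite <- diag_plus.
  apply diag_ext. intros; ring.
Qed.

Lemma sums_scal (c : R) (a : nat -> nat -> R) (x y l : R) :
  is_series (homog a x y) l ->
  is_series (homog (fun i j => c * a i j) x y) (c * l).
Proof.
  intros Ha. eapply is_series_ext; [|apply (is_series_scal c _ _ Ha)].
  intros N. unfold scal; simpl; unfold mult; simpl. unfold homog. rewrite <- diag_scal.
  apply diag_ext. intros; ring.
Qed.

Lemma sums_shift (a : nat -> nat -> R) (x y l : R) :
  is_series (homog a x y) l -> is_series (homog (shift a) x y) (x * l).
Proof.
  intros Ha.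
  assert (E : forall N, homog (shift a) x y N
    = match N with O => 0 | S k => x * homog a x y k end).
  { intros N. transitivity (diag (shift (fun i j => x * (a i j * x ^ i * y ^ j))) N).
    - apply diag_ext. intros [|i] j _; simpl; ring.
    - rewrite diag_shift. destruct N; [reflexivity|]. apply diag_scal. }
  apply is_series_decr_1. change (plus (x * l) _) with (x * l + - homog (shift a) x y 0).
  rewrite (E 0%nat), Ropp_0, Rplus_0_r.
  eapply is_series_ext; [|apply (is_series_scal x _ _ Ha)].
  intros N. rewrite E. reflexivity.
Qed.

Lemma homog_conv2 (a b : nat -> nat -> R) (x y : R) (N : nat) :
  homog (conv2 a b) x y N = conv (homog a x y) (homog b x y) N.
Proof.
  unfold homog at 2 3. rewrite <- diag_conv2. apply diag_ext. intros i j _.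
  unfold conv2. rewrite Rmult_assoc, Rmult_comm, scal_sum. apply sum_eq. intros k Hk.
  rewrite Rmult_comm, scal_sum. apply sum_eq. intros l Hl.
  replace (x ^ i) with (x ^ k * x ^ (i - k)) by (rewrite <- pow_add; f_equal; lia).
  replace (y ^ j) with (y ^ l * y ^ (j - l)) by (rewrite <- pow_add; f_equal; lia).
  ring.
Qed.

Lemma sums_conv2 (a b : nat -> nat -> R) (x y l m : R) :
  ex_series (fun N => Rabs (homog a x y N)) ->
  ex_series (fun N => Rabs (homog b x y N)) ->
  is_series (homog a x y) l -> is_series (homog b x y) m ->
  is_series (homog (conv2 a b) x y) (l * m).
Proof.
  intros Ha' Hb' Ha Hb.
  eapply is_series_ext; [|apply (is_series_mult _ _ _ _ Ha Hb Ha' Hb')].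
  intros N. symmetry. apply homog_conv2.
Qed.

Lemma Series_geom_le (u : nat -> R) (M q : R) :
  0 <= M -> 0 <= q <= 1 / 2 -> (forall N, Rabs (u N) <= M * q ^ N) ->
  Rabs (Series u) <= 2 * M.
Proof.
  intros HM Hq Hu.
  assert (Hg : is_series (fun N => M * q ^ N) (M * / (1 - q))).
  { apply (is_series_scal M (fun N => q ^ N)), is_series_geom. rewrite Rabs_pos_eq; lra. }
  eapply Rle_trans.
  { apply Series_Rabs, (ex_series_geom_le _ M q); [lra|].
    intros N. rewrite Rabs_Rabsolu. apply Hu. }
  apply Rle_trans with (Series (fun N => M * q ^ N)).
  - apply Series_le; [|eexists; exact Hg]. intros N. split; [apply Rabs_pos|apply Hu].
  - rewrite (is_series_unique _ _ Hg). rewrite Rmult_comm. apply Rmult_le_compat_r; [assumption|].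
    apply Rmult_le_reg_l with (1 - q); [lra|]. rewrite Rinv_r; lra.
Qed.

(** The terms of total degree at least 2 are dominated by a geometric series of ratio K rho <= 1/2.
    Since C does not depend on rho, the linear part prevails on small boxes. *)
Lemma ev_remainder (K : R) (a : nat -> nat -> R) :
  1 <= K -> dominated K a ->
  exists C, 0 <= C /\ forall rho x y, 0 <= rho -> 2 * K * rho <= 1 ->
    Rabs x <= rho -> Rabs y <= rho ->
    Rabs (ev a x y - (a 0%nat 0%nat + a 1%nat 0%nat * x + a 0%nat 1%nat * y)) <= C * rho ^ 2.
Proof.
  intros HK Hd. destruct (Hd) as (M & HM & H).
  exists (2 * (M * K ^ 2)). split.
  { apply Rmult_le_pos; [lra|]. apply Rmult_le_pos; [assumption|apply pow2_ge_0]. }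
  intros rho x y Hrho HKr Hx Hy.
  assert (Hex : ex_series (homog a x y)).
  { eexists. apply (is_series_ev K rho); try assumption; nra. }
  unfold ev. rewrite Series_incr_1 by assumption.
  rewrite Series_incr_1 by (apply ex_series_incr_1 in Hex; assumption).
  replace (_ - _) with (Series (fun k => homog a x y (S (S k)))).
  2:{ unfold homog at 2 3. unfold diag. simpl. ring. }
  replace (2 * (M * K ^ 2) * rho ^ 2) with (2 * (M * (K * rho) ^ 2)) by ring.
  apply (Series_geom_le _ _ (K * rho)).
  - apply Rmult_le_pos; [assumption|apply pow2_ge_0].
  - nra.
  - intros N. eapply Rle_trans. apply (homog_geom_le K M rho); assumption.
    right. simpl. ring.
Qed.

(** The factor rho on the left replaces the exponent j - 1 on the right and so covers j = 0. *)
Lemma pow_diff_le (x y rho : R) (j : nat) :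
  Rabs x <= rho -> Rabs y <= rho ->
  rho * Rabs (x ^ j - y ^ j) <= INR j * rho ^ j * Rabs (x - y).
Proof.
  intros Hx Hy. assert (Hr : 0 <= rho) by (eapply Rle_trans; [apply Rabs_pos|exact Hx]).
  induction j as [|j IH].
  - simpl. rewrite Rminus_diag, Rabs_R0. lra.
  - rewrite S_INR. simpl.
    replace (x * x ^ j - y * y ^ j) with (x * (x ^ j - y ^ j) + y ^ j * (x - y)) by ring.
    eapply Rle_trans. { apply Rmult_le_compat_l; [assumption|apply Rabs_triang]. }
    rewrite !Rabs_mult, <- RPow_abs.
    assert (H1 : Rabs x * (rho * Rabs (x ^ j - y ^ j)) <= rho * (INR j * rho ^ j * Rabs (x - y))).
    { apply Rmult_le_compat; try apply Rabs_pos; try assumption.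
      apply Rmult_le_pos; [assumption|apply Rabs_pos]. }
    assert (H2 : rho * (Rabs y ^ j * Rabs (x - y)) <= rho * (rho ^ j * Rabs (x - y))).
    { apply Rmult_le_compat_l; [assumption|]. apply Rmult_le_compat_r; [apply Rabs_pos|].
      apply pow_incr. split; [apply Rabs_pos|assumption]. }
    lra.
Qed.

(** Gives the continuity in y for the intermediate value theorem. The factor j from the difference
    of powers is again absorbed by 2^N, hence 4 K rho <= 1. *)
Lemma ev_lipschitz_snd (K rho x : R) (a : nat -> nat -> R) :
  1 <= K -> dominated K a -> 0 < rho -> 4 * K * rho <= 1 -> Rabs x <= rho ->
  exists C, 0 <= C /\ forall y y', Rabs y <= rho -> Rabs y' <= rho ->
    Rabs (ev a x y - ev a x y') <= C * Rabs (y - y').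
Proof.
  intros HK Hd Hrho HKr Hx. destruct (Hd) as (M & HM & H).
  exists (2 * (M / rho)). split.
  { apply Rmult_le_pos; [lra|]. apply Rdiv_le_0_compat; assumption. }
  intros y y' Hy Hy'.
  assert (Hex : forall y, Rabs y <= rho -> ex_series (homog a x y)).
  { intros t Ht. eexists. apply (is_series_ev K rho); try assumption; nra. }
  unfold ev. rewrite <- Series_minus by (apply Hex; assumption).
  replace (2 * (M / rho) * Rabs (y - y')) with (2 * (M / rho * Rabs (y - y'))) by ring.
  apply (Series_geom_le _ _ (2 * K * rho)).
  - apply Rmult_le_pos; [|apply Rabs_pos]. apply Rdiv_le_0_compat; assumption.
  - nra.
  - intros N.
    apply Rle_trans with (INR N * rho ^ N * Rabs (y - y') / rho * absdiag a N).
    + unfold absdiag. rewrite <- diag_scal.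
      replace (homog a x y N - homog a x y' N)
        with (diag (fun i j => a i j * x ^ i * (y ^ j - y' ^ j)) N).
      2:{ unfold Rminus. replace (- homog a x y' N) with ((-1) * homog a x y' N) by ring.
          unfold homog. rewrite <- diag_scal, <- diag_plus. apply diag_ext. intros; ring. }
      eapply Rle_trans.
      { apply (Rsum_abs (fun i => a i (N - i)%nat * x ^ i * (y ^ (N - i) - y' ^ (N - i)))). }
      apply (diag_le (fun i j => Rabs (a i j * x ^ i * (y ^ j - y' ^ j)))).
      intros i j Hij. rewrite !Rabs_mult, <- RPow_abs.
      rewrite Rmult_assoc, Rmult_comm. apply Rmult_le_compat_r; [apply Rabs_pos|].
      apply (Rle_div_r _ _ rho); [lra|].
      apply Rle_trans with (rho ^ i * (INR j * rho ^ j * Rabs (y - y'))).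
      * rewrite Rmult_assoc, (Rmult_comm _ rho).
        apply Rmult_le_compat.
        -- apply pow_le, Rabs_pos.
        -- apply Rmult_le_pos; [lra|apply Rabs_pos].
        -- apply pow_incr. split; [apply Rabs_pos|assumption].
        -- apply pow_diff_le; assumption.
      * replace (rho ^ N) with (rho ^ i * rho ^ j) by (rewrite <- pow_add; f_equal; assumption).
        assert (HjN : INR j <= INR N) by (apply le_INR; lia).
        replace (rho ^ i * (INR j * rho ^ j * Rabs (y - y')))
          with (INR j * (rho ^ i * rho ^ j * Rabs (y - y'))) by ring.
        rewrite (Rmult_assoc (INR N)). apply Rmult_le_compat_r; [|assumption].
        apply Rmult_le_pos; [|apply Rabs_pos].
        apply Rmult_le_pos; apply pow_le; lra.
    + assert (HN := INR_le_pow2 N). assert (HN' := pos_INR N).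
      apply Rle_trans with (2 ^ N * rho ^ N * Rabs (y - y') / rho * (M * K ^ N)).
      * apply Rmult_le_compat; [|apply absdiag_nonneg| |apply H].
        -- apply Rdiv_le_0_compat; [|assumption]. apply Rmult_le_pos; [|apply Rabs_pos].
           apply Rmult_le_pos; [assumption|apply pow_le; lra].
        -- apply Rmult_le_compat_r; [left; apply Rinv_0_lt_compat; assumption|].
           apply Rmult_le_compat_r; [apply Rabs_pos|].
           apply Rmult_le_compat_r; [apply pow_le; lra|lra].
      * right. rewrite !Rpow_mult_distr. field. lra.
Qed.

(** * Termwise differentiation along the curve y = c x^b *)

Lemma taylor_1 (f f1 f2 : R -> R) (l u x t B : R) :
  l < x < u -> l < t < u ->
  (forall s, l < s < u -> is_derive f s (f1 s) /\ is_derive f1 s (f2 s) /\ Rabs (f2 s) <= B) ->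
  Rabs (f t - f x - f1 x * (t - x)) <= B * (t - x) ^ 2.
Proof.
  intros Hx Ht H.
  assert (Hmm : l < Rmin x t /\ Rmax x t < u).
  { unfold Rmin, Rmax. destruct (Rle_dec x t); lra. }
  destruct (MVT_gen f x t f1) as [c [Hc E]].
  { intros s Hs. apply H. lra. }
  { intros s Hs. apply (is_derive_continuity_pt _ _ (f1 s)), H. lra. }
  assert (Hc' : l < c < u) by lra.
  assert (Hmm' : l < Rmin x c /\ Rmax x c < u).
  { unfold Rmin, Rmax. destruct (Rle_dec x c); lra. }
  destruct (MVT_gen f1 x c f2) as [c' [Hc'' E']].
  { intros s Hs. apply H. lra. }
  { intros s Hs. apply (is_derive_continuity_pt _ _ (f2 s)), H. lra. }
  assert (HB : Rabs (f2 c') <= B) by (apply H; lra).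
  assert (Hcx : Rabs (c - x) <= Rabs (t - x)).
  { revert Hc. unfold Rmin, Rmax. destruct (Rle_dec x t); intros.
    - rewrite !Rabs_pos_eq; lra.
    - rewrite !Rabs_left1; lra. }
  replace (f t - f x - f1 x * (t - x)) with (f2 c' * ((c - x) * (t - x))).
  2:{ rewrite E. replace (f1 c) with (f1 x + f2 c' * (c - x)) by lra. ring. }
  rewrite !Rabs_mult, <- pow2_abs.
  apply Rmult_le_compat; [apply Rabs_pos| |assumption|].
  { apply Rmult_le_pos; apply Rabs_pos. }
  replace (Rabs (t - x) ^ 2) with (Rabs (t - x) * Rabs (t - x)) by ring.
  apply Rmult_le_compat_r; [apply Rabs_pos|assumption].
Qed.

(** A summable bound on the second derivatives lets the Taylor remainders of the terms be added up
    to [Series B * (t - x) ^ 2], which gives the derivative of the sum directly. *)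
Lemma is_derive_Series (F dF ddF : nat -> R -> R) (B : nat -> R) (l u x : R) :
  l < x < u -> ex_series B ->
  (forall N t, l < t < u ->
     is_derive (F N) t (dF N t) /\ is_derive (dF N) t (ddF N t) /\
     Rabs (F N t) <= B N /\ Rabs (dF N t) <= B N /\ Rabs (ddF N t) <= B N) ->
  is_derive (fun t => Series (fun N => F N t)) x (Series (fun N => dF N x)).
Proof.
  intros Hx HB H.
  assert (Hex : forall t, l < t < u -> ex_series (fun N => F N t)).
  { intros t Ht. apply (ex_series_le (fun N => F N t) B); [|assumption].
    intros N. apply (H N t Ht). }
  assert (Hdex : ex_series (fun N => dF N x)).
  { apply (ex_series_le (fun N => dF N x) B); [|assumption]. intros N. apply (H N x Hx). }
  assert (HS : 0 <= Series B).
  { apply Rle_trans with (Rabs (Series (fun N => F N x))); [apply Rabs_pos|].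
    apply Rle_trans with (Series (fun N => Rabs (F N x))).
    - apply Series_Rabs, (ex_series_le (fun N => Rabs (F N x)) B); [|assumption].
      intros N. unfold norm; simpl. unfold abs; simpl. rewrite Rabs_Rabsolu. apply (H N x Hx).
    - apply Series_le; [|assumption]. intros N. split; [apply Rabs_pos|apply (H N x Hx)]. }
  assert (Hquad : forall t, l < t < u ->
    Rabs (Series (fun N => F N t) - Series (fun N => F N x)
       - Series (fun N => dF N x) * (t - x)) <= Series B * (t - x) ^ 2).
  { intros t Ht.
    rewrite (Rmult_comm _ (t - x)), <- Series_scal_l, <- !Series_minus; try apply Hex;
      try assumption.
    2:{ apply (ex_series_minus (fun N => F N t)); apply Hex; assumption. }
    2:{ apply (ex_series_scal (t - x) (fun N => dF N x)); assumption. }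
    rewrite Rmult_comm, <- Series_scal_l.
    assert (HBex : ex_series (fun N => (t - x) ^ 2 * B N)).
    { apply (ex_series_scal ((t - x) ^ 2) B); assumption. }
    assert (Hle : forall N, Rabs (F N t - F N x - (t - x) * dF N x) <= (t - x) ^ 2 * B N).
    { intros N. rewrite (Rmult_comm _ (dF N x)), (Rmult_comm _ (B N)).
      apply (taylor_1 _ _ (ddF N) l u); try assumption.
      intros s Hs. destruct (H N s Hs) as (? & ? & ? & ? & ?).
      split; [|split]; assumption. }
    eapply Rle_trans.
    - apply Series_Rabs.
      apply (ex_series_le (fun N => Rabs (F N t - F N x - (t - x) * dF N x))
        (fun N => (t - x) ^ 2 * B N)); [|assumption].
      intros N. unfold norm; simpl. unfold abs; simpl. rewrite Rabs_Rabsolu. apply Hle.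
    - apply Series_le; [|assumption]. intros N. split; [apply Rabs_pos|apply Hle]. }
  apply is_derive_Reals. intros eps Heps.
  set (S := Series B) in *.
  set (d := Rmin (Rmin (x - l) (u - x)) (eps / (S + 1))).
  assert (Hd : 0 < d).
  { unfold d. repeat apply Rmin_case; try lra. apply Rdiv_lt_0_compat; lra. }
  exists (mkposreal d Hd). intros h Hh0 Hh. simpl in Hh.
  assert (Hdl : d <= x - l /\ d <= u - x /\ d <= eps / (S + 1)).
  { unfold d. assert (H1 := Rmin_l (Rmin (x - l) (u - x)) (eps / (S + 1))).
    assert (H2 := Rmin_r (Rmin (x - l) (u - x)) (eps / (S + 1))).
    assert (H3 := Rmin_l (x - l) (u - x)). assert (H4 := Rmin_r (x - l) (u - x)). lra. }
  assert (Hh' := Rabs_def2 _ _ Hh).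
  specialize (Hquad (x + h) ltac:(lra)).
  replace (x + h - x) with h in Hquad by ring.
  assert (Hhp : 0 < Rabs h) by (apply Rabs_pos_lt; assumption).
  apply Rmult_lt_reg_r with (Rabs h); [assumption|].
  rewrite <- Rabs_mult.
  match goal with |- Rabs ?e < _ => replace e with
    (Series (fun N => F N (x + h)) - Series (fun N => F N x) - Series (fun N => dF N x) * h)
    by (field; assumption) end.
  eapply Rle_lt_trans; [exact Hquad|].
  rewrite <- pow2_abs. simpl. rewrite Rmult_1_r, <- Rmult_assoc.
  apply Rmult_lt_compat_r; [assumption|].
  apply Rle_lt_trans with (S * (eps / (S + 1))).
  - apply Rmult_le_compat_l; lra.
  - assert (0 < eps / (S + 1)) by (apply Rdiv_lt_0_compat; lra).
    assert (eps / (S + 1) * (S + 1) = eps) by (field; lra). lra.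
Qed.

(* Coefficients of (s + x d/dx) applied to the sum of the a i j x^i y^j, where y = c x^b. *)
Definition weight (b s : R) (a : nat -> nat -> R) (i j : nat) : R :=
  (s + INR i + b * INR j) * a i j.

Lemma dominated_weight_exp (K b s : R) (a : nat -> nat -> R) :
  0 <= K -> 0 <= b <= 1 -> dominated K a -> dominated (2 * K) (weight b s a).
Proof.
  intros HK Hb. apply (dominated_weight K (Rabs s + 1)); [assumption| |].
  { assert (H := Rabs_pos s). lra. }
  intros i j. unfold weight. rewrite Rabs_mult.
  apply Rmult_le_compat_r; [apply Rabs_pos|].
  assert (Hi := pos_INR i). assert (Hj := pos_INR j). rewrite plus_INR.
  rewrite Rplus_assoc. eapply Rle_trans; [apply Rabs_triang|].
  rewrite (Rabs_pos_eq (INR i + b * INR j)) by nra.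
  assert (H := Rabs_pos s). nra.
Qed.

Lemma Rpower_pow_pos (x s : R) (i : nat) : 0 < x -> Rpower x s ^ i = Rpower x (s * INR i).
Proof.
  intros Hx. rewrite <- Rpower_pow by apply Rpower_pos. apply Rpower_mult.
Qed.

Lemma is_derive_monomial (al b c s x : R) (i j : nat) :
  0 < x ->
  is_derive (fun t => Rpower t s * (al * t ^ i * (c * Rpower t b) ^ j)) x
    (Rpower x (s - 1) * ((s + INR i + b * INR j) * al * x ^ i * (c * Rpower x b) ^ j)).
Proof.
  intros Hx.
  assert (E : forall sg t, 0 < t -> Rpower t sg * (t ^ i * (c * Rpower t b) ^ j)
     = c ^ j * Rpower t (sg + INR i + b * INR j)).
  { intros sg t Ht. rewrite Rpow_mult_distr, Rpower_pow_pos, <- Rpower_pow by assumption.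
    rewrite !Rpower_plus. ring. }
  apply (is_derive_ext_loc (fun t => al * c ^ j * Rpower t (s + INR i + b * INR j))).
  - exists (mkposreal x Hx). intros t Ht.
    assert (0 < t).
    { apply Rabs_def2 in Ht. unfold minus, plus, opp in Ht; simpl in Ht. lra. }
    transitivity (al * (c ^ j * Rpower t (s + INR i + b * INR j))).
    { apply Rmult_assoc. }
    rewrite <- E by assumption. rewrite <- !Rmult_assoc, (Rmult_comm al). reflexivity.
  - evar_last.
    { apply (is_derive_scal (fun t => Rpower t (s + INR i + b * INR j))),
        is_derive_Rpower, Hx. }
    unfold scal; simpl; unfold mult; simpl.
    replace (s + INR i + b * INR j - 1) with (s - 1 + INR i + b * INR j) by ring.
    assert (E' := E (s - 1) x Hx). unfold mult; simpl.
    transitivity (al * (s + INR i + b * INR j) * (c ^ j * Rpower x (s - 1 + INR i + b * INR j))).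
    + ring.
    + rewrite <- E'. ring.
Qed.

Lemma is_derive_sum_f_R0 (f df : nat -> R -> R) (x : R) (N : nat) :
  (forall i, (i <= N)%nat -> is_derive (f i) x (df i x)) ->
  is_derive (fun t => sum_f_R0 (fun i => f i t) N) x (sum_f_R0 (fun i => df i x) N).
Proof.
  intros H. induction N as [|N IH]; simpl.
  - apply H. lia.
  - apply (is_derive_plus (fun t => sum_f_R0 (fun i => f i t) N)).
    + apply IH. intros; apply H; lia.
    + apply H. lia.
Qed.

Lemma is_derive_homog (a : nat -> nat -> R) (b c s x : R) (N : nat) :
  0 < x ->
  is_derive (fun t => Rpower t s * homog a t (c * Rpower t b) N) x
    (Rpower x (s - 1) * homog (weight b s a) x (c * Rpower x b) N).
Proof.
  intros Hx. unfold homog, diag. rewrite <- sum_f_R0_scal_l.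
  apply (is_derive_ext (fun t => sum_f_R0 (fun i => Rpower t s *
     (a i (N - i)%nat * t ^ i * (c * Rpower t b) ^ (N - i))) N)).
  { intros t. apply sum_f_R0_scal_l. }
  apply (is_derive_sum_f_R0 (fun i t => Rpower t s *
     (a i (N - i)%nat * t ^ i * (c * Rpower t b) ^ (N - i)))
    (fun i x => Rpower x (s - 1) *
     (weight b s a i (N - i)%nat * x ^ i * (c * Rpower x b) ^ (N - i)))).
  intros i _. apply is_derive_monomial, Hx.
Qed.

Lemma Rpower_between (s l u t : R) :
  0 < l -> l <= t <= u -> Rpower t s <= Rpower l s + Rpower u s.
Proof.
  intros Hl Ht. assert (H1 := Rpower_pos l s). assert (H2 := Rpower_pos u s).
  destruct (Rle_dec 0 s) as [Hs|Hs].
  - assert (Rpower t s <= Rpower u s) by (apply Rle_Rpower_l; lra). lra.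
  - assert (Rpower t s <= Rpower l s) by (apply Rpower_neg_decr; lra). lra.
Qed.

(** With the prefactor x^s the functions form a class closed under differentiation: s drops by 1 and
    the coefficients are weighted. The bound 4 K rho < 1 makes room for two weights, because second
    derivatives have to be dominated as well. *)
Lemma is_derive_ev_curve (a : nat -> nat -> R) (K b c s rho u x : R) :
  1 <= K -> dominated K a -> 0 < b <= 1 -> 0 < rho -> 4 * K * rho < 1 ->
  u <= rho -> Rabs c * Rpower u b <= rho -> 0 < x < u ->
  is_derive (fun t => Rpower t s * ev a t (c * Rpower t b)) x
    (Rpower x (s - 1) * ev (weight b s a) x (c * Rpower x b)).
Proof.
  intros HK Ha Hb Hrho HKr Hu Hc Hx.
  assert (Hd1 : dominated (2 * K) (weight b s a)) by (apply dominated_weight_exp; try assumption; lra).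
  assert (Hd2 : dominated (2 * (2 * K)) (weight b (s - 1) (weight b s a))).
  { apply dominated_weight_exp; try assumption; lra. }
  apply (dominated_le _ (2 * (2 * K))) in Ha; try lra.
  apply (dominated_le _ (2 * (2 * K))) in Hd1; try lra.
  destruct Ha as (M0 & HM0 & H0). destruct Hd1 as (M1 & HM1 & H1).
  destruct Hd2 as (M2 & HM2 & H2).
  (* Bounds t^s on (x/2, u) for either sign of s; starting at x/2 keeps negative powers away from
     0. *)
  set (P := fun s => Rpower (x / 2) s + Rpower u s).
  assert (HP : forall s, 0 <= P s).
  { intros t. apply Rplus_le_le_0_compat; left; apply Rpower_pos. }
  set (C := P s * M0 + P (s - 1) * M1 + P (s - 1 - 1) * M2).
  assert (HPM0 : 0 <= P s * M0) by (apply Rmult_le_pos; [apply HP|assumption]).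
  assert (HPM1 : 0 <= P (s - 1) * M1) by (apply Rmult_le_pos; [apply HP|assumption]).
  assert (HPM2 : 0 <= P (s - 1 - 1) * M2) by (apply Rmult_le_pos; [apply HP|assumption]).
  assert (Hbound : forall sg M (d : nat -> nat -> R), P sg * M <= C ->
    (forall N, absdiag d N <= M * (2 * (2 * K)) ^ N) -> forall N t, x / 2 < t < u ->
    Rabs (Rpower t sg * homog d t (c * Rpower t b) N) <= C * (2 * (2 * K) * rho) ^ N).
  { intros sg M d HM Hd N t Ht.
    rewrite Rabs_mult, (Rabs_pos_eq (Rpower t sg)) by (left; apply Rpower_pos).
    apply Rle_trans with (P sg * (M * (2 * (2 * K) * rho) ^ N)).
    - apply Rmult_le_compat; [left; apply Rpower_pos|apply Rabs_pos| |].
      + apply Rpower_between; lra.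
      + apply homog_geom_le; [lra| | |assumption].
        * rewrite Rabs_pos_eq; lra.
        * rewrite Rabs_mult, (Rabs_pos_eq (Rpower t b)) by (left; apply Rpower_pos).
          eapply Rle_trans; [|exact Hc]. apply Rmult_le_compat_l; [apply Rabs_pos|].
          apply Rle_Rpower_l; lra.
    - rewrite <- Rmult_assoc. apply Rmult_le_compat_r; [|assumption].
      apply pow_le. nra. }
  unfold ev. rewrite <- Series_scal_l.
  apply (is_derive_ext (fun t =>
    Series (fun N => Rpower t s * homog a t (c * Rpower t b) N))).
  { intros t. apply Series_scal_l. }
  apply (is_derive_Series (fun N t => Rpower t s * homog a t (c * Rpower t b) N)
    (fun N t => Rpower t (s - 1) * homog (weight b s a) t (c * Rpower t b) N)
    (fun N t => Rpower t (s - 1 - 1)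
       * homog (weight b (s - 1) (weight b s a)) t (c * Rpower t b) N)
    (fun N => C * (2 * (2 * K) * rho) ^ N) (x / 2) u).
  - lra.
  - apply (ex_series_scal C (fun N => (2 * (2 * K) * rho) ^ N)).
    eexists. apply is_series_geom. rewrite Rabs_pos_eq; nra.
  - intros N t Ht. split; [|split; [|split; [|split]]].
    + apply is_derive_homog. lra.
    + apply is_derive_homog. lra.
    + apply (Hbound s M0); try assumption. unfold C. lra.
    + apply (Hbound (s - 1) M1); try assumption. unfold C. lra.
    + apply (Hbound (s - 1 - 1) M2); try assumption. unfold C. lra.
Qed.

(** * Coefficient arrays and recursions graded by total degree *)

Lemma sum_f_R0_single (u : nat -> R) (N k : nat) :
  (k <= N)%nat -> (forall i, (i <= N)%nat -> i <> k -> u i = 0) -> sum_f_R0 u N = u k.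
Proof.
  intros Hk H. induction N as [|N IH].
  - replace k with 0%nat by lia. reflexivity.
  - simpl. destruct (Nat.eq_dec k (S N)) as [->|Hne].
    + rewrite sum_eq_R0; [ring|]. intros i Hi. apply H; lia.
    + rewrite IH by (try lia; intros; apply H; lia). rewrite (H (S N)) by lia. ring.
Qed.

Definition off0 (a : nat -> nat -> R) (i j : nat) : R :=
  match i, j with O, O => 0 | _, _ => a i j end.

Definition delta00 (i j : nat) : R :=
  match i, j with O, O => 1 | _, _ => 0 end.

Definition delta01 (i j : nat) : R :=
  match i, j with O, S O => 1 | _, _ => 0 end.

Lemma conv2_ext (f g f' g' : nat -> nat -> R) (i j : nat) :
  (forall k l k' l', (k + k' = i)%nat -> (l + l' = j)%nat ->
     f k l * g k' l' = f' k l * g' k' l') ->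
  conv2 f g i j = conv2 f' g' i j.
Proof.
  intros H. apply sum_eq. intros k Hk. apply sum_eq. intros l Hl. apply H; lia.
Qed.

Lemma conv2_le (f g f' g' : nat -> nat -> R) (i j : nat) :
  (forall k l k' l', (k + k' = i)%nat -> (l + l' = j)%nat ->
     f k l * g k' l' <= f' k l * g' k' l') ->
  conv2 f g i j <= conv2 f' g' i j.
Proof.
  intros H. apply sum_Rle. intros k Hk. apply sum_Rle. intros l Hl. apply H; lia.
Qed.

Lemma conv2_scal_l (c : R) (f g : nat -> nat -> R) (i j : nat) :
  conv2 (fun i j => c * f i j) g i j = c * conv2 f g i j.
Proof.
  unfold conv2. rewrite <- sum_f_R0_scal_l. apply sum_eq. intros k Hk.
  rewrite <- sum_f_R0_scal_l. apply sum_eq. intros; ring.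
Qed.

Lemma conv2_abs_le (f g : nat -> nat -> R) (i j : nat) :
  Rabs (conv2 f g i j)
  <= conv2 (fun i j => Rabs (f i j)) (fun i j => Rabs (g i j)) i j.
Proof.
  unfold conv2. eapply Rle_trans.
  { apply (Rsum_abs (fun k => sum_f_R0 (fun l => f k l * g (i - k)%nat (j - l)%nat) j)). }
  apply sum_Rle. intros k Hk. eapply Rle_trans.
  { apply (Rsum_abs (fun l => f k l * g (i - k)%nat (j - l)%nat)). }
  apply sum_Rle. intros l Hl. rewrite Rabs_mult. lra.
Qed.

Lemma conv2_plus_l (f f' g : nat -> nat -> R) (i j : nat) :
  conv2 (fun i j => f i j + f' i j) g i j = conv2 f g i j + conv2 f' g i j.
Proof.
  unfold conv2. rewrite <- sum_f_R0_plus. apply sum_eq. intros k Hk.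
  rewrite <- sum_f_R0_plus. apply sum_eq. intros; ring.
Qed.

Lemma conv2_plus_r (f g g' : nat -> nat -> R) (i j : nat) :
  conv2 f (fun i j => g i j + g' i j) i j = conv2 f g i j + conv2 f g' i j.
Proof.
  unfold conv2. rewrite <- sum_f_R0_plus. apply sum_eq. intros k Hk.
  rewrite <- sum_f_R0_plus. apply sum_eq. intros; ring.
Qed.

Lemma conv2_delta00_l (g : nat -> nat -> R) (i j : nat) : conv2 delta00 g i j = g i j.
Proof.
  unfold conv2. rewrite (sum_f_R0_single _ i 0).
  - rewrite (sum_f_R0_single _ j 0); [rewrite !Nat.sub_0_r; simpl; ring|lia|].
    intros [|l] Hl Hne; [lia|]. simpl. ring.
  - lia.
  - intros [|k] Hk Hne; [lia|]. apply sum_eq_R0. intros. simpl. ring.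
Qed.

Lemma conv2_delta00_r (f : nat -> nat -> R) (i j : nat) : conv2 f delta00 i j = f i j.
Proof.
  unfold conv2. rewrite (sum_f_R0_single _ i i).
  - rewrite (sum_f_R0_single _ j j); [rewrite !Nat.sub_diag; simpl; ring|lia|].
    intros l Hl Hne. rewrite Nat.sub_diag.
    replace (j - l)%nat with (S (j - l - 1)) by lia. simpl. ring.
  - lia.
  - intros k Hk Hne. apply sum_eq_R0. intros l Hl.
    replace (i - k)%nat with (S (i - k - 1)) by lia. simpl. ring.
Qed.

Lemma off0_split (a : nat -> nat -> R) (i j : nat) :
  a i j = a 0%nat 0%nat * delta00 i j + off0 a i j.
Proof. destruct i, j; simpl; ring. Qed.

Lemma diag_delta00_le (N : nat) : diag delta00 N <= 1.
Proof.
  unfold diag. destruct N as [|N]; [simpl; lra|].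
  rewrite sum_eq_R0; [lra|]. intros [|i] Hi; reflexivity.
Qed.

Lemma diag_delta01_le (N : nat) : diag delta01 N <= 1.
Proof.
  unfold diag. rewrite (sum_f_R0_single _ N 0).
  - destruct N as [|[|N]]; simpl; lra.
  - lia.
  - intros [|i] Hi Hne; [lia|reflexivity].
Qed.

(** A step in degree N reads only entries of lower degree, so the k-th iterate is final below degree
    k, whatever the start. The entry (i, j) is read off the iterate i + j + 1. *)
Lemma graded_fixpoint {A : Type} (s0 : A) (step : (nat -> nat -> A) -> nat -> nat -> A) :
  (forall N s s', (forall i j, (i + j < N)%nat -> s i j = s' i j) ->
     forall i j, (i + j <= N)%nat -> step s i j = step s' i j) ->
  exists s, forall i j, s i j = step s i j.
Proof.
  intros Hloc.
  set (it := fun k => Nat.iter k step (fun _ _ => s0)).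
  assert (H1 : forall k i j, (i + j < k)%nat -> it k i j = it (S k) i j).
  { induction k as [|k IH]; intros i j Hij; [lia|].
    simpl. apply (Hloc k); [|lia]. intros i' j' Hij'. apply IH, Hij'. }
  assert (H2 : forall m k i j, (i + j < k)%nat -> it k i j = it (m + k)%nat i j).
  { induction m as [|m IH]; intros k i j Hij; [reflexivity|].
    rewrite (IH k) by assumption. apply H1. lia. }
  exists (fun i j => it (S (i + j)) i j). intros i j.
  change (it (S (i + j)) i j) with (step (it (i + j)%nat) i j).
  apply (Hloc (i + j)%nat); [|lia]. intros i' j' Hij.
  rewrite (H2 (i + j - S (i' + j'))%nat (S (i' + j'))) by lia. f_equal. lia.
Qed.

(** Summation over diagonals turns this into the one-index recursion. In the application y sums |z|
    and |w| without their constant terms, and [2 * delta00] restores these. *)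
Lemma graded_quadratic_bound (y : nat -> nat -> R) (C : R) :
  1 <= C -> y 0%nat 0%nat = 0 -> (forall i j, 0 <= y i j) ->
  (let g i j := y i j + 2 * delta00 i j in
   forall i j, y i j <= C * (delta01 i j + shift g i j + shift (shift g) i j
       + shift (shift (shift g)) i j + conv2 y y i j)) ->
  exists M K, 1 <= K /\ 0 <= M /\ forall N, diag y N <= M * K ^ N.
Proof.
  intros HC Hy0 Hyp H. set (g := fun i j => y i j + 2 * delta00 i j) in H.
  simpl in H. fold g in H.
  assert (HYp : forall N, 0 <= diag y N) by (intros; apply sum_f_R0_nonneg; intros; apply Hyp).
  (* With S the partial sum, [delta01] contributes at most 1 and each of the three shifts at most S
     + 2; the total 7 + 3 S explains the 7. *)
  apply (quadratic_recursion_bound (diag y) (7 * C)); [lra| |exact HYp|].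
  { unfold diag. simpl. assumption. }
  intros N.
  assert (Hg : forall k, (k <= N)%nat -> diag g k <= sum_f_R0 (diag y) N + 2).
  { intros k Hk. unfold g. rewrite diag_plus, diag_scal.
    assert (H1 := diag_delta00_le k).
    assert (H2 := sum_f_R0_term_le (diag y) N k (fun i _ => HYp i) Hk). lra. }
  assert (HS : 0 <= sum_f_R0 (diag y) N) by (apply sum_f_R0_nonneg; intros; apply HYp).
  assert (Hcv : 0 <= conv (diag y) (diag y) (S N)).
  { apply sum_f_R0_nonneg. intros; apply Rmult_le_pos; apply HYp. }
  apply Rle_trans with (diag (fun i j => C * (delta01 i j + shift g i j + shift (shift g) i j
       + shift (shift (shift g)) i j + conv2 y y i j)) (S N)).
  { apply diag_le. intros; apply H. }
  rewrite diag_scal, !diag_plus, !diag_shift, diag_conv2.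
  assert (H1 := diag_delta01_le (S N)).
  assert (H2 := Hg N ltac:(lia)).
  assert (H3 : match N with O => 0 | S k => diag g k end <= sum_f_R0 (diag y) N + 2).
  { destruct N; [lra|]. apply Hg. lia. }
  assert (H4 : match N with O => 0 | S k => match k with O => 0 | S k' => diag g k' end end
      <= sum_f_R0 (diag y) N + 2).
  { destruct N as [|[|N]]; [lra|lra|]. apply Hg. lia. }
  assert (H4' : match N with O => 0 | S k => diag (shift g) k end
      <= sum_f_R0 (diag y) N + 2).
  { destruct N; [lra|]. rewrite diag_shift. exact H4. }
  rewrite (Rmult_comm 7 C), Rmult_assoc. apply Rmult_le_compat_l; [lra|].
  destruct N as [|N]; rewrite ?diag_shift in *; lra.
Qed.

(** * The formal solution *)

Section FormalSolution.

Variables (n : R) (e : nat).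
Hypothesis n_range : 3 / 2 < n < 3.

Local Notation nu := (3 / n).
Local Notation b := (beta n).
Local Notation m := (mu n).

Lemma beta_range : 0 < b < 1.
Proof.
  unfold beta. set (D := -27 + 36 * n - 8 * n ^ 2).
  (* Both bounds come from perfect factorisations: D - (9-4n)^2 = 12 (2n-3) (3-n) and (9-2n)^2 - D =
     12 (n-3)^2. *)
  assert (HD : 0 < D) by (unfold D; nra).
  assert (Hs := sqrt_lt_R0 D HD). assert (Hss := sqrt_sqrt D ltac:(lra)).
  assert (H1 : 9 - 4 * n < sqrt D).
  { apply Rnot_le_lt. intros H.
    assert (sqrt D * sqrt D <= (9 - 4 * n) * (9 - 4 * n)) by (apply Rmult_le_compat; lra).
    unfold D in *. nra. }
  assert (H2 : sqrt D < 9 - 2 * n).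
  { apply Rnot_le_lt. intros H.
    assert ((9 - 2 * n) * (9 - 2 * n) <= sqrt D * sqrt D) by (apply Rmult_le_compat; lra).
    unfold D in *. nra. }
  split.
  - apply Rdiv_lt_0_compat; lra.
  - apply Rmult_lt_reg_r with (2 * n); [lra|].
    unfold Rdiv. rewrite Rmult_assoc, Rinv_l; lra.
Qed.

Lemma beta_quadratic : b ^ 2 + (3 * nu - 4) * b = n * m.
Proof.
  unfold beta, mu. set (D := -27 + 36 * n - 8 * n ^ 2).
  assert (HD : 0 < D) by (unfold D; nra).
  assert (Hss := sqrt_sqrt D ltac:(lra)). set (s := sqrt D) in *.
  assert (E : s ^ 2 = D) by (simpl; lra).
  apply Rminus_diag_uniq.
  replace (_ - _) with ((s ^ 2 - D) / (4 * n ^ 2)) by (unfold D; field; lra).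
  rewrite E. field. lra.
Qed.

(** The factor that three differentiations produce on x^(nu+g). *)
Definition indicial3 (g : R) : R := (nu - 2 + g) * (nu - 1 + g) * (nu + g).

(** The second term is the linearisation -(n-1) z of w = z^(1-n) at z = 1, multiplied by mu. *)
Definition indicial (g : R) : R := indicial3 g - (n - 1) * m.

(** The root -1 belongs to x^(nu-1), the derivative of the leading profile. After division by g + 1
    the quadratic of [beta_quadratic] remains. *)
Lemma indicial_factor (g : R) :
  indicial g = (g + 1) * (g - b) * (g + b + 3 * nu - 4).
Proof.
  assert (Hq := beta_quadratic).
  assert (Hn : n * m = 3 * (nu - 1) * (2 - nu)) by (unfold mu; field; lra).
  assert (Hm : m = nu * (nu - 1) * (2 - nu)) by reflexivity.
  unfold indicial, indicial3.
  replace ((n - 1) * m) with (n * m - m) by ring.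
  replace ((g + 1) * (g - b) * (g + b + 3 * nu - 4))
    with ((g + 1) * (g ^ 2 + (3 * nu - 4) * g - (b ^ 2 + (3 * nu - 4) * b))) by ring.
  rewrite Hq, Hn, Hm. ring.
Qed.

Definition exponent (i j : nat) : R := INR i + b * INR j.

(** The least exponent apart from 0 and b, attained at (1, 0) or (0, 2). *)
Definition min_exponent : R := Rmin 1 (2 * b).

Lemma exponent_ge (i j : nat) :
  (i, j) <> (0, 0)%nat -> (i, j) <> (0, 1)%nat -> min_exponent <= exponent i j.
Proof.
  intros H0 H1. assert (Hb := beta_range). unfold exponent, min_exponent.
  assert (Hj := pos_INR j).
  destruct i as [|i].
  - eapply Rle_trans; [apply Rmin_r|].
    assert (2 <= INR j).
    { replace 2 with (INR 2) by (simpl; ring). apply le_INR.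
      destruct j as [|[|j]]; [congruence|congruence|lia]. }
    simpl. nra.
  - eapply Rle_trans; [apply Rmin_l|]. rewrite S_INR.
    assert (Hi := pos_INR i). nra.
Qed.

Lemma min_exponent_gt : b < min_exponent.
Proof.
  assert (Hb := beta_range). unfold min_exponent. apply Rmin_case; lra.
Qed.

Lemma exponent_nonneg (i j : nat) : 0 <= exponent i j.
Proof.
  assert (Hb := beta_range). assert (Hi := pos_INR i). assert (Hj := pos_INR j).
  unfold exponent. nra.
Qed.

Lemma exponent_pos (i j : nat) : (i, j) <> (0, 0)%nat -> 0 < exponent i j.
Proof.
  intros H. assert (Hb := beta_range). assert (Hi := pos_INR i). assert (Hj := pos_INR j).
  unfold exponent. destruct i as [|i]; [destruct j as [|j]; [congruence|]|];
    rewrite S_INR; simpl; [assert (H' := pos_INR j)|assert (H' := pos_INR i)]; nra.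
Qed.

(** The reason for convergence: the divisor grows like g^3, matching the three weights of [theta3].
    The third factor is at least g because b (b + 3 nu - 4) = n mu > 0. *)
Lemma indicial_lower (g : R) :
  min_exponent <= g -> (1 - b / min_exponent) * g ^ 3 <= indicial g.
Proof.
  intros Hg. assert (Hb := beta_range). assert (Hm := min_exponent_gt).
  rewrite indicial_factor.
  set (k := 1 - b / min_exponent).
  assert (Hk : 0 < k).
  { unfold k. apply Rlt_0_minus. apply Rmult_lt_reg_r with min_exponent; [lra|].
    unfold Rdiv. rewrite Rmult_assoc, Rinv_l; lra. }
  assert (H1 : k * g <= g - b).
  { unfold k. assert (b <= b / min_exponent * g); [|lra].
    replace b with (b / min_exponent * min_exponent) at 1 by (field; lra).
    apply Rmult_le_compat_l; [|assumption]. apply Rdiv_le_0_compat; lra. }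
  assert (H2 : g <= g + b + 3 * nu - 4).
  { assert (Hq := beta_quadratic). assert (Hmu := mu_pos n n_range). nra. }
  assert (H3 : 0 <= k * g) by (apply Rmult_le_pos; lra).
  assert (H4 : g * (k * g) <= (g + 1) * (g - b)) by (apply Rmult_le_compat; lra).
  replace (k * g ^ 3) with (g * (k * g) * g) by ring.
  apply Rmult_le_compat; try lra. apply Rmult_le_pos; lra.
Qed.

Lemma indicial_pos (i j : nat) :
  (i, j) <> (0, 0)%nat -> (i, j) <> (0, 1)%nat -> 0 < indicial (exponent i j).
Proof.
  intros H0 H1. assert (Hb := beta_range). assert (Hm := min_exponent_gt).
  assert (Hg := exponent_ge i j H0 H1).
  eapply Rlt_le_trans; [|apply indicial_lower, Hg].
  apply Rmult_lt_0_compat; [|apply pow_lt; lra].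
  apply Rlt_0_minus. apply Rmult_lt_reg_r with min_exponent; [lra|].
  unfold Rdiv. rewrite Rmult_assoc, Rinv_l; lra.
Qed.

(* If z has the coefficients a, then [theta1 a], [theta2 a] and [theta3 a] are those of
   x^(k-nu) (x^nu z)^(k) for k = 1, 2, 3. *)
Definition theta1 (a : nat -> nat -> R) := weight b nu a.
Definition theta2 (a : nat -> nat -> R) := weight b (nu - 1) (theta1 a).
Definition theta3 (a : nat -> nat -> R) := weight b (nu - 2) (theta2 a).

(* Coefficient form of the profile equation multiplied by (1 - x)^2, for H = A x^nu z and
   w = z^(1-n): all terms but [theta3 z + m w] are shifted in the power of x. *)
Definition linear_rhs (z w : nat -> nat -> R) (i j : nat) : R :=
  2 * shift (theta3 z) i j - shift (shift (theta3 z)) i j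
  + INR e * (shift (theta2 z) i j - shift (shift (theta2 z)) i j)
  + INR e * shift (shift (theta1 z)) i j
  + m * (3 * shift w i j - 3 * shift (shift w) i j + shift (shift (shift w)) i j).

(* The part of z theta w + (n - 1) w theta z in which neither factor is the constant term. *)
Definition bilinear (z w : nat -> nat -> R) (i j : nat) : R :=
  conv2 (off0 z) (weight b 0 (off0 w)) i j
  + (n - 1) * conv2 (weight b 0 (off0 z)) (off0 w) i j.

(** At each index two linear equations hold for z and w: indicial3 z + m w = [linear_rhs], and
    exponent (w + (n-1) z) = -[bilinear]. Eliminating w leaves the divisor [indicial]. It vanishes
    at (0, 1), where the free coefficient is normalised to 1. *)
Definition step_fst (z w : nat -> nat -> R) (i j : nat) : R :=
  match i, j with
  | O, O => 1
  | O, S O => 1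
  | _, _ => (linear_rhs z w i j + m * bilinear z w i j / exponent i j)
            / indicial (exponent i j)
  end.

(** [step_fst z w] stands in place of z so that the step reads entries of lower degree only. *)
Definition step_snd (z w : nat -> nat -> R) (i j : nat) : R :=
  match i, j with
  | O, O => 1
  | _, _ => - (n - 1) * step_fst z w i j - bilinear z w i j / exponent i j
  end.

(** With the constant terms removed, both factors of every surviving product have degree below i +
    j. *)
Lemma bilinear_local (N : nat) (z w z' w' : nat -> nat -> R) :
  (forall i j, (i + j < N)%nat -> z i j = z' i j) ->
  (forall i j, (i + j < N)%nat -> w i j = w' i j) ->
  forall i j, (i + j <= N)%nat -> bilinear z w i j = bilinear z' w' i j.
Proof.
  intros Hz Hw i j Hij.
  assert (Hcase : forall k l k' l', (k + k' = i)%nat -> (l + l' = j)%nat ->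
    (k, l) = (0, 0)%nat \/ (k', l') = (0, 0)%nat \/
    (off0 z k l = off0 z' k l /\ off0 w k' l' = off0 w' k' l')).
  { intros k l k' l' Hk Hl.
    destruct (Nat.eq_dec (k + l) 0); [left; f_equal; lia|].
    destruct (Nat.eq_dec (k' + l') 0); [right; left; f_equal; lia|].
    right; right. unfold off0. rewrite Hz, Hw by lia. split; reflexivity. }
  unfold bilinear. f_equal; [|f_equal]; apply conv2_ext; intros k l k' l' Hk Hl;
    unfold weight; destruct (Hcase k l k' l' Hk Hl) as [H|[H|[H H']]];
    try (rewrite H, H'; ring); injection H as -> ->; simpl; ring.
Qed.

Lemma linear_rhs_local (N : nat) (z w z' w' : nat -> nat -> R) :
  (forall i j, (i + j < N)%nat -> z i j = z' i j) ->
  (forall i j, (i + j < N)%nat -> w i j = w' i j) ->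
  forall i j, (i + j <= N)%nat -> linear_rhs z w i j = linear_rhs z' w' i j.
Proof.
  intros Hz Hw i j Hij. unfold linear_rhs, theta3, theta2, theta1, weight.
  destruct i as [|[|[|i]]]; simpl; rewrite ?Hz, ?Hw by lia; reflexivity.
Qed.

Lemma formal_solution_exists :
  exists z w, (forall i j, z i j = step_fst z w i j) /\
              (forall i j, w i j = step_snd z w i j).
Proof.
  destruct (graded_fixpoint (0, 0) (fun s i j =>
    (step_fst (fun i j => fst (s i j)) (fun i j => snd (s i j)) i j,
     step_snd (fun i j => fst (s i j)) (fun i j => snd (s i j)) i j))) as [s Hs].
  - intros N s s' H i j Hij.
    assert (Hz : forall i j, (i + j < N)%nat -> fst (s i j) = fst (s' i j)).
    { intros i' j' H'. rewrite H by assumption. reflexivity. }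
    assert (Hw : forall i j, (i + j < N)%nat -> snd (s i j) = snd (s' i j)).
    { intros i' j' H'. rewrite H by assumption. reflexivity. }
    unfold step_snd, step_fst.
    rewrite (linear_rhs_local N _ _ _ _ Hz Hw i j Hij),
      (bilinear_local N _ _ _ _ Hz Hw i j Hij). reflexivity.
  - exists (fun i j => fst (s i j)), (fun i j => snd (s i j)).
    split; intros i j; rewrite Hs at 1; reflexivity.
Qed.

Section Coefficients.

Variables z w : nat -> nat -> R.
Hypothesis z_eq : forall i j, z i j = step_fst z w i j.
Hypothesis w_eq : forall i j, w i j = step_snd z w i j.

Lemma z00 : z 0%nat 0%nat = 1.
Proof. rewrite z_eq. reflexivity. Qed.

Lemma w00 : w 0%nat 0%nat = 1.
Proof. rewrite w_eq. reflexivity. Qed.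

Lemma z01 : z 0%nat 1%nat = 1.
Proof. rewrite z_eq. reflexivity. Qed.

Lemma z_generic (i j : nat) : (i, j) <> (0, 0)%nat -> (i, j) <> (0, 1)%nat ->
  z i j = (linear_rhs z w i j + m * bilinear z w i j / exponent i j)
            / indicial (exponent i j).
Proof.
  intros H0 H1. rewrite z_eq. destruct i as [|i], j as [|[|j]]; congruence || reflexivity.
Qed.

Lemma w_generic (i j : nat) : (i, j) <> (0, 0)%nat ->
  w i j = - (n - 1) * z i j - bilinear z w i j / exponent i j.
Proof.
  intros H0. rewrite z_eq, w_eq. destruct i as [|i], j as [|j]; congruence || reflexivity.
Qed.

Lemma bilinear_low (i j : nat) : i = 0%nat -> (j <= 1)%nat -> bilinear z w i j = 0.
Proof.
  intros -> Hj. unfold bilinear, conv2, weight.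
  destruct j as [|[|j]]; simpl; [ring|ring|lia].
Qed.

(** The numerator is m + e nu (nu-1): the contribution -2 m of [theta3] is outweighed by 3 m from w.
    Positivity makes z depend on x and puts the solution with c = 0 above A x^nu. *)
Lemma z10_pos : 0 < z 1%nat 0%nat.
Proof.
  assert (Hn := nu_range n n_range). assert (Hm := mu_pos n n_range).
  assert (He := pos_INR e).
  rewrite z_generic by congruence.
  apply Rdiv_lt_0_compat; [|apply indicial_pos; congruence].
  replace (linear_rhs z w 1 0 + m * bilinear z w 1 0 / exponent 1 0)
    with (m + INR e * (nu * (nu - 1))).
  - assert (0 <= INR e * (nu * (nu - 1))); [|lra].
    apply Rmult_le_pos; [assumption|]. apply Rmult_le_pos; lra.
  - unfold linear_rhs, theta3, theta2, theta1, weight, bilinear, conv2, exponent. simpl.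
    rewrite z00, w00.
    replace (b * 0) with 0 by ring. unfold weight, off0. unfold mu. field. lra.
Qed.

(** At (0, 0) this is the definition of mu, at (0, 1) the vanishing of the indicial polynomial at b,
    and elsewhere the recursion. *)
Lemma linear_identity (i j : nat) : theta3 z i j + m * w i j = linear_rhs z w i j.
Proof.
  assert (E : theta3 z i j = indicial3 (exponent i j) * z i j).
  { unfold theta3, theta2, theta1, weight, indicial3, exponent. ring. }
  rewrite E.
  assert (Hdec : (i, j) = (0, 0)%nat \/ (i, j) = (0, 1)%nat \/
     ((i, j) <> (0, 0)%nat /\ (i, j) <> (0, 1)%nat)).
  { destruct i as [|i]; [destruct j as [|[|j]]|]; auto; right; right; split; congruence. }
  destruct Hdec as [H|[H|[H0 H1]]].
  - injection H as -> ->. rewrite z00, w00. unfold linear_rhs, indicial3, exponent, mu.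
    simpl. ring.
  - injection H as -> ->. rewrite w_generic, bilinear_low, z01 by (congruence || lia).
    assert (Hi := indicial_factor b). unfold indicial in Hi.
    assert (Hb := exponent_pos 0 1 ltac:(congruence)).
    replace (exponent 0 1) with b by (unfold exponent; simpl; ring).
    replace (linear_rhs z w 0 1) with 0 by (unfold linear_rhs; simpl; ring).
    assert (E1 : indicial3 b = (n - 1) * m) by lra.
    rewrite E1. unfold Rdiv. ring.
  - rewrite w_generic by assumption.
    assert (Hp := indicial_pos i j H0 H1). assert (Hg := exponent_pos i j H0).
    assert (E1 : indicial (exponent i j) * z i j
       = linear_rhs z w i j + m * bilinear z w i j / exponent i j).
    { rewrite (z_generic i j H0 H1) at 1. field. lra. }
    unfold indicial in E1 at 1. unfold Rdiv in *. lra.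
Qed.

(** Coefficient form of z theta w + (n-1) w theta z = 0, that is, of z^(n-1) w being constant. *)
Lemma bilinear_identity (i j : nat) :
  conv2 z (weight b 0 w) i j + (n - 1) * conv2 (weight b 0 z) w i j = 0.
Proof.
  (* The weight with s = 0 annihilates the constant term, so dropping that term changes nothing. *)
  assert (Hw : forall k l, weight b 0 w k l = weight b 0 (off0 w) k l).
  { intros [|k] [|l]; unfold weight; simpl; ring. }
  assert (Hz : forall k l, weight b 0 z k l = weight b 0 (off0 z) k l).
  { intros [|k] [|l]; unfold weight; simpl; ring. }
  assert (E1 : conv2 z (weight b 0 w) i j
    = weight b 0 w i j + conv2 (off0 z) (weight b 0 (off0 w)) i j).
  { rewrite <- (conv2_delta00_l (weight b 0 w)).
    transitivity (conv2 (fun i j => delta00 i j + off0 z i j) (weight b 0 w) i j).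
    - apply conv2_ext. intros k l k' l' _ _. rewrite (off0_split z k l), z00. ring.
    - rewrite conv2_plus_l. f_equal. apply conv2_ext. intros. rewrite Hw. reflexivity. }
  assert (E2 : conv2 (weight b 0 z) w i j
    = weight b 0 z i j + conv2 (weight b 0 (off0 z)) (off0 w) i j).
  { rewrite <- (conv2_delta00_r (weight b 0 z)).
    transitivity (conv2 (weight b 0 z) (fun i j => delta00 i j + off0 w i j) i j).
    - apply conv2_ext. intros k l k' l' _ _. rewrite (off0_split w k' l'), w00. ring.
    - rewrite conv2_plus_r. f_equal. apply conv2_ext. intros. rewrite Hz. reflexivity. }
  rewrite E1, E2.
  transitivity (exponent i j * (w i j + (n - 1) * z i j) + bilinear z w i j).
  { unfold bilinear, weight, exponent. ring. }
  destruct (Nat.eq_dec (i + j) 0) as [H0|H0].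
  - assert (i = 0%nat) by lia. assert (j = 0%nat) by lia. subst.
    rewrite bilinear_low by lia. unfold exponent. simpl. ring.
  - assert (Hne : (i, j) <> (0, 0)%nat) by (intros H; injection H; lia).
    rewrite (w_generic i j Hne). assert (Hg := exponent_pos i j Hne). field. lra.
Qed.

(** * Majorants for the coefficients *)

Definition abs_sum (i j : nat) : R := Rabs (off0 z i j) + Rabs (off0 w i j).

Definition abs_sum2 (i j : nat) : R := abs_sum i j + 2 * delta00 i j.

Lemma abs_sum_nonneg (i j : nat) : 0 <= abs_sum i j.
Proof. apply Rplus_le_le_0_compat; apply Rabs_pos. Qed.

Lemma abs_le_abs_sum2 (i j : nat) : Rabs (z i j) <= abs_sum2 i j /\ Rabs (w i j) <= abs_sum2 i j.
Proof.
  unfold abs_sum2, abs_sum. assert (Hz := Rabs_pos (off0 z i j)).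
  assert (Hw := Rabs_pos (off0 w i j)).
  destruct i as [|i]; [destruct j as [|j]|]; simpl in *; [|lra|lra].
  rewrite z00, w00, Rabs_R0, Rabs_R1. lra.
Qed.

Lemma abs_sum2_nonneg (i j : nat) : 0 <= abs_sum2 i j.
Proof. eapply Rle_trans; [apply Rabs_pos|apply abs_le_abs_sum2]. Qed.

(** The weight of a factor is at most the exponent of the whole product. The division by
    [exponent i j] in the recursion therefore undoes the derivative in the quadratic part. *)
Lemma bilinear_bound (i j : nat) :
  Rabs (bilinear z w i j) <= n * exponent i j * conv2 abs_sum abs_sum i j.
Proof.
  assert (Hb := beta_range).
  assert (Hmon : forall k l k' l', (k + k' = i)%nat -> (l + l' = j)%nat ->
    exponent k l <= exponent i j /\ exponent k' l' <= exponent i j).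
  { intros k l k' l' <- <-. unfold exponent. rewrite !plus_INR.
    assert (H1 := pos_INR k). assert (H2 := pos_INR k').
    assert (H3 := pos_INR l). assert (H4 := pos_INR l'). nra. }
  assert (Hz : forall k l, Rabs (off0 z k l) <= abs_sum k l).
  { intros k l. unfold abs_sum. assert (H := Rabs_pos (off0 w k l)). lra. }
  assert (Hw : forall k l, Rabs (off0 w k l) <= abs_sum k l).
  { intros k l. unfold abs_sum. assert (H := Rabs_pos (off0 z k l)). lra. }
  assert (Hwt : forall a k l, Rabs (weight b 0 a k l) = exponent k l * Rabs (a k l)).
  { intros a k l. unfold weight. rewrite Rabs_mult, Rplus_0_l.
    rewrite Rabs_pos_eq; [reflexivity|apply exponent_nonneg]. }
  assert (H1 : Rabs (conv2 (off0 z) (weight b 0 (off0 w)) i j)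
     <= exponent i j * conv2 abs_sum abs_sum i j).
  { eapply Rle_trans; [apply conv2_abs_le|]. rewrite <- conv2_scal_l.
    apply conv2_le. intros k l k' l' Hk Hl. rewrite Hwt.
    destruct (Hmon k l k' l' Hk Hl) as [_ Hle]. assert (Hp := exponent_nonneg k' l').
    replace (Rabs (off0 z k l) * (exponent k' l' * Rabs (off0 w k' l')))
      with (exponent k' l' * Rabs (off0 z k l) * Rabs (off0 w k' l')) by ring.
    apply Rmult_le_compat; [|apply Rabs_pos| |apply Hw].
    - apply Rmult_le_pos; [assumption|apply Rabs_pos].
    - apply Rmult_le_compat; [assumption|apply Rabs_pos|assumption|apply Hz]. }
  assert (H2 : Rabs (conv2 (weight b 0 (off0 z)) (off0 w) i j)
     <= exponent i j * conv2 abs_sum abs_sum i j).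
  { eapply Rle_trans; [apply conv2_abs_le|]. rewrite <- conv2_scal_l.
    apply conv2_le. intros k l k' l' Hk Hl. rewrite Hwt.
    destruct (Hmon k l k' l' Hk Hl) as [Hle _]. assert (Hp := exponent_nonneg k l).
    apply Rmult_le_compat; [|apply Rabs_pos| |apply Hw].
    - apply Rmult_le_pos; [assumption|apply Rabs_pos].
    - apply Rmult_le_compat; [assumption|apply Rabs_pos|assumption|apply Hz]. }
  unfold bilinear. eapply Rle_trans; [apply Rabs_triang|].
  rewrite Rabs_mult, (Rabs_pos_eq (n - 1)) by lra.
  set (T := exponent i j * conv2 abs_sum abs_sum i j) in *.
  replace (n * exponent i j * conv2 abs_sum abs_sum i j) with (T + (n - 1) * T)
    by (unfold T; ring).
  apply Rplus_le_compat; [exact H1|]. apply Rmult_le_compat_l; [lra|exact H2].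
Qed.

(** Every weight has the form s + exponent with |s| <= 2, hence is at most P in absolute value. The
    common power P^3 serves all four bounds since P >= 1. *)
Lemma theta_bound (i j k : nat) (P : R) :
  (k <= i)%nat -> 2 + exponent i j <= P ->
  Rabs (theta3 z k j) <= P ^ 3 * abs_sum2 k j /\
  Rabs (theta2 z k j) <= P ^ 3 * abs_sum2 k j /\
  Rabs (theta1 z k j) <= P ^ 3 * abs_sum2 k j /\
  Rabs (w k j) <= P ^ 3 * abs_sum2 k j.
Proof.
  intros Hk HP. assert (Hn := nu_range n n_range). assert (Hb := beta_range).
  destruct (abs_le_abs_sum2 k j) as [Hz Hw].
  assert (HP1 : 1 <= P) by (assert (H := exponent_nonneg i j); lra).
  assert (Hw1 : forall s a C, -2 <= s <= 2 -> Rabs (a k j) <= C ->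
     Rabs (weight b s a k j) <= P * C).
  { intros s a C Hs Ha. unfold weight. rewrite Rabs_mult, Rplus_assoc.
    apply Rmult_le_compat; try apply Rabs_pos; [|assumption].
    change (INR k + b * INR j) with (exponent k j).
    assert (Hkj := exponent_nonneg k j).
    assert (exponent k j <= exponent i j).
    { unfold exponent. assert (INR k <= INR i) by (apply le_INR; assumption). lra. }
    apply Rabs_le. lra. }
  assert (H1 : Rabs (theta1 z k j) <= P * abs_sum2 k j) by (apply Hw1; [lra|assumption]).
  assert (H2 : Rabs (theta2 z k j) <= P * (P * abs_sum2 k j)) by (apply Hw1; [lra|assumption]).
  assert (H3 : Rabs (theta3 z k j) <= P * (P * (P * abs_sum2 k j)))
    by (apply Hw1; [lra|assumption]).
  assert (Hg := abs_sum2_nonneg k j). set (g := abs_sum2 k j) in *.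
  assert (Hg1 : g <= P * g) by nra.
  assert (Hg2 : P * g <= P * (P * g)) by (apply Rmult_le_compat_l; lra).
  assert (Hg3 : P * (P * g) <= P * (P * (P * g))) by (apply Rmult_le_compat_l; lra).
  replace (P ^ 3 * g) with (P * (P * (P * g))) by ring.
  repeat split; lra.
Qed.

Lemma linear_rhs_bound (i j : nat) (P : R) :
  2 + exponent i j <= P ->
  Rabs (linear_rhs z w i j) <= P ^ 3 * ((2 + 2 * INR e + 3 * m) *
    (shift abs_sum2 i j + shift (shift abs_sum2) i j + shift (shift (shift abs_sum2)) i j)).
Proof.
  intros HP. assert (Hm := mu_pos n n_range). assert (He := pos_INR e).
  assert (HP3 : 0 <= P ^ 3).
  { apply pow_le. assert (H := exponent_nonneg i j). lra. }
  assert (H1 : Rabs (shift (theta3 z) i j) <= P ^ 3 * shift abs_sum2 i j /\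
     Rabs (shift (theta2 z) i j) <= P ^ 3 * shift abs_sum2 i j /\
     Rabs (shift w i j) <= P ^ 3 * shift abs_sum2 i j /\ 0 <= P ^ 3 * shift abs_sum2 i j).
  { destruct i as [|i]; simpl shift.
    - rewrite Rabs_R0. lra.
    - destruct (theta_bound (S i) j i P ltac:(lia) HP) as (? & ? & ? & ?).
      assert (H' := abs_sum2_nonneg i j).
      repeat split; try assumption. apply Rmult_le_pos; assumption. }
  assert (H2 : Rabs (shift (shift (theta3 z)) i j) <= P ^ 3 * shift (shift abs_sum2) i j /\
     Rabs (shift (shift (theta2 z)) i j) <= P ^ 3 * shift (shift abs_sum2) i j /\
     Rabs (shift (shift (theta1 z)) i j) <= P ^ 3 * shift (shift abs_sum2) i j /\
     Rabs (shift (shift w) i j) <= P ^ 3 * shift (shift abs_sum2) i j /\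
     0 <= P ^ 3 * shift (shift abs_sum2) i j).
  { destruct i as [|[|i]]; simpl shift.
    - rewrite Rabs_R0. lra.
    - rewrite Rabs_R0. lra.
    - destruct (theta_bound (S (S i)) j i P ltac:(lia) HP) as (? & ? & ? & ?).
      assert (H' := abs_sum2_nonneg i j).
      repeat split; try assumption. apply Rmult_le_pos; assumption. }
  assert (H3 : Rabs (shift (shift (shift w)) i j) <= P ^ 3 * shift (shift (shift abs_sum2)) i j /\
     0 <= P ^ 3 * shift (shift (shift abs_sum2)) i j).
  { destruct i as [|[|[|i]]]; simpl shift; try (rewrite Rabs_R0; lra).
    destruct (theta_bound (S (S (S i))) j i P ltac:(lia) HP) as (? & ? & ? & ?).
    assert (H' := abs_sum2_nonneg i j).
    split; [assumption|]. apply Rmult_le_pos; assumption. }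
  unfold linear_rhs.
  set (g1 := shift abs_sum2 i j) in *. set (g2 := shift (shift abs_sum2) i j) in *.
  set (g3 := shift (shift (shift abs_sum2)) i j) in *.
  destruct H1 as (A1 & A2 & A3 & A4). destruct H2 as (B1 & B2 & B3 & B4 & B5).
  destruct H3 as (C1 & C2).
  apply Rabs_le_between in A1, A2, A3, B1, B2, B3, B4, C1.
  replace (P ^ 3 * ((2 + 2 * INR e + 3 * m) * (g1 + g2 + g3)))
    with ((2 + 2 * INR e + 3 * m) * (P ^ 3 * g1 + P ^ 3 * g2 + P ^ 3 * g3)) by ring.
  set (G1 := P ^ 3 * g1) in *. set (G2 := P ^ 3 * g2) in *. set (G3 := P ^ 3 * g3) in *.
  set (E := INR e) in *.
  assert (He1 : - (E * (G1 + 2 * G2)) <=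
     E * (shift (theta2 z) i j - shift (shift (theta2 z)) i j) + E * shift (shift (theta1 z)) i j
     <= E * (G1 + 2 * G2)).
  { rewrite <- Rmult_plus_distr_l, <- Ropp_mult_distr_r_reverse.
    split; apply Rmult_le_compat_l; lra. }
  assert (Hm1 : - (m * (3 * G1 + 3 * G2 + G3)) <=
     m * (3 * shift w i j - 3 * shift (shift w) i j + shift (shift (shift w)) i j)
     <= m * (3 * G1 + 3 * G2 + G3)).
  { rewrite <- Ropp_mult_distr_r_reverse. split; apply Rmult_le_compat_l; lra. }
  assert (He2 : 0 <= E * G1 + 2 * (E * G3)).
  { assert (0 <= E * G1) by (apply Rmult_le_pos; lra).
    assert (0 <= E * G3) by (apply Rmult_le_pos; lra). lra. }
  assert (Hm2 : 0 <= m * G3) by (apply Rmult_le_pos; lra).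
  apply Rabs_le. lra.
Qed.

(** The cubic growth of the linear terms and that of the divisor cancel up to a constant, which
    leaves exactly the recursion of [graded_quadratic_bound]. *)
Lemma coefficients_dominated : exists K, 1 <= K /\ dominated K z /\ dominated K w.
Proof.
  assert (Hm := mu_pos n n_range). assert (He := pos_INR e).
  assert (Hb := beta_range). assert (Hg0 := min_exponent_gt).
  set (g0 := min_exponent) in *.
  (* For g >= g0 one has 2 + g <= B g and k g^3 <= [indicial g], so Q bounds the quotient of (B g)^3
     by the divisor. *)
  set (B := 1 + 2 / g0). set (k := 1 - b / g0). set (Q := B ^ 3 / k).
  set (D := 2 + 2 * INR e + 3 * m + m * n).
  assert (HB : 0 < B).
  { unfold B. assert (0 < 2 / g0) by (apply Rdiv_lt_0_compat; lra). lra. }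
  assert (Hk : 0 < k).
  { unfold k. apply Rlt_0_minus. apply Rmult_lt_reg_r with g0; [lra|].
    unfold Rdiv. rewrite Rmult_assoc, Rinv_l; lra. }
  assert (HQ : 0 < Q) by (apply Rdiv_lt_0_compat; [apply pow_lt|]; assumption).
  assert (Hmn : 0 < m * n) by (apply Rmult_lt_0_compat; lra).
  assert (HD : 0 < D) by (unfold D; lra).
  set (C := n * (Q * D) + n).
  assert (HQD : 0 < Q * D) by (apply Rmult_lt_0_compat; assumption).
  assert (HC : n <= C) by (unfold C; nra).
  destruct (graded_quadratic_bound abs_sum C) as (M & K & HK & HM & H).
  - lra.
  - unfold abs_sum. simpl. rewrite Rabs_R0. lra.
  - apply abs_sum_nonneg.
  - cbv zeta. intros i j. change (fun i0 j0 => abs_sum i0 j0 + 2 * delta00 i0 j0) with abs_sum2.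
    set (X := shift abs_sum2 i j + shift (shift abs_sum2) i j
                 + shift (shift (shift abs_sum2)) i j).
    set (Y := conv2 abs_sum abs_sum i j).
    assert (HX : 0 <= X).
    { unfold X. destruct i as [|[|[|i]]]; cbn [shift];
        repeat (lra || apply abs_sum2_nonneg || apply Rplus_le_le_0_compat). }
    assert (HY : 0 <= Y).
    { unfold Y, conv2. apply sum_f_R0_nonneg. intros. apply sum_f_R0_nonneg. intros.
      apply Rmult_le_pos; apply abs_sum_nonneg. }
    replace (delta01 i j + shift abs_sum2 i j + shift (shift abs_sum2) i j
       + shift (shift (shift abs_sum2)) i j + Y) with (delta01 i j + X + Y) by (unfold X; ring).
    assert (Hdec : (i, j) = (0, 0)%nat \/ (i, j) = (0, 1)%nat \/
       ((i, j) <> (0, 0)%nat /\ (i, j) <> (0, 1)%nat)).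
    { destruct i as [|i]; [destruct j as [|[|j]]|]; auto; right; right; split; congruence. }
    destruct Hdec as [E|[E|[H0 H1]]].
    + injection E as -> ->. unfold abs_sum at 1. simpl. rewrite Rabs_R0.
      apply Rle_trans with 0; [lra|]. apply Rmult_le_pos; lra.
    + injection E as -> ->. unfold abs_sum at 1. simpl off0. simpl delta01.
      rewrite w_generic, bilinear_low, z01 by (congruence || lia).
      unfold Rdiv. rewrite Rmult_0_l, Rabs_R1, Rabs_left1 by lra. nra.
    + assert (Hy : abs_sum i j = Rabs (z i j) + Rabs (w i j)).
      { unfold abs_sum. destruct i as [|i], j as [|j]; reflexivity || congruence. }
      set (g := exponent i j).
      assert (Hg : g0 <= g) by (apply exponent_ge; assumption).
      assert (Hind : k * g ^ 3 <= indicial g) by (apply indicial_lower, Hg).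
      assert (Hindp : 0 < indicial g) by (apply indicial_pos; assumption).
      assert (HP : 2 + g <= B * g).
      { unfold B. assert (2 <= 2 / g0 * g); [|lra].
        apply Rmult_le_reg_r with g0; [lra|].
        replace (2 / g0 * g * g0) with (2 * g) by (field; lra). lra. }
      assert (HP3 : (B * g) ^ 3 <= Q * indicial g).
      { apply Rle_trans with (Q * (k * g ^ 3)).
        - right. unfold Q. field. lra.
        - apply Rmult_le_compat_l; lra. }
      assert (HP3' : 1 <= (B * g) ^ 3) by (apply pow_R1_Rle; lra).
      assert (Hlin := linear_rhs_bound i j (B * g) HP). fold X in Hlin.
      assert (Hbil := bilinear_bound i j). fold g Y in Hbil.
      assert (Hbg : Rabs (bilinear z w i j / g) <= n * Y).
      { unfold Rdiv. rewrite Rabs_mult, (Rabs_pos_eq (/ g)).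
        2:{ left. apply Rinv_0_lt_compat. lra. }
        apply (Rle_div_l _ _ g); [lra|]. lra. }
      assert (Hz : Rabs (z i j) <= Q * D * (X + Y)).
      { rewrite z_generic by assumption. fold g.
        unfold Rdiv at 1. rewrite Rabs_mult, (Rabs_pos_eq (/ indicial g)).
        2:{ left. apply Rinv_0_lt_compat. lra. }
        apply (Rle_div_l _ _ (indicial g)); [lra|].
        eapply Rle_trans; [apply Rabs_triang|].
        replace (m * bilinear z w i j / g) with (m * (bilinear z w i j / g)) by (field; lra).
        rewrite (Rabs_mult m), (Rabs_pos_eq m) by lra.
        assert (Hmb : m * Rabs (bilinear z w i j / g) <= m * (n * Y))
          by (apply Rmult_le_compat_l; lra).
        set (P3 := (B * g) ^ 3) in *. set (D0 := 2 + 2 * INR e + 3 * m) in *.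
        assert (HD0 : 0 <= D0) by (unfold D0; lra).
        assert (HmY : 0 <= m * n * Y) by (apply Rmult_le_pos; lra).
        apply Rle_trans with (P3 * (D0 * X) + P3 * (m * n * Y)); [nra|].
        rewrite <- Rmult_plus_distr_l.
        replace (Q * D * (X + Y) * indicial g) with (Q * indicial g * (D * (X + Y))) by ring.
        assert (HDX : 0 <= D0 * X) by (apply Rmult_le_pos; assumption).
        apply Rmult_le_compat; try lra.
        replace D with (D0 + m * n) by reflexivity.
        assert (0 <= D0 * Y) by (apply Rmult_le_pos; assumption).
        assert (0 <= m * n * X) by (apply Rmult_le_pos; lra). lra. }
      assert (Hw : Rabs (w i j) <= (n - 1) * Rabs (z i j) + n * Y).
      { rewrite w_generic by assumption. fold g. unfold Rminus at 1.
        eapply Rle_trans; [apply Rabs_triang|].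
        rewrite Rabs_Ropp, Rabs_mult, Rabs_Ropp, (Rabs_pos_eq (n - 1)) by lra. lra. }
      assert (Hd : 0 <= delta01 i j).
      { destruct i as [|i]; [destruct j as [|[|j]]|]; simpl; lra. }
      rewrite Hy.
      apply Rle_trans with (n * (Q * D * (X + Y)) + n * Y).
      { assert (n * Rabs (z i j) <= n * (Q * D * (X + Y))) by (apply Rmult_le_compat_l; lra).
        lra. }
      apply Rle_trans with (C * (X + Y)); [|apply Rmult_le_compat_l; lra].
      unfold C. assert (0 <= n * X) by (apply Rmult_le_pos; lra). nra.
  - exists K. split; [assumption|].
    assert (Hdom : forall a, (forall i j, Rabs (a i j) <= abs_sum2 i j) -> dominated K a).
    { intros a Ha. exists (M + 2). split; [lra|]. intros N.
      apply Rle_trans with (diag abs_sum2 N); [apply diag_le; intros; apply Ha|].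
      unfold abs_sum2. rewrite diag_plus, diag_scal.
      assert (H1 := diag_delta00_le N). assert (H2 := H N).
      assert (1 <= K ^ N) by (apply pow_R1_Rle; assumption). lra. }
    split; apply Hdom; intros; apply abs_le_abs_sum2.
Qed.

End Coefficients.

End FormalSolution.

(** * Limits at 0 along the curve y = c x^b *)

Lemma vanishes0_comp (F g : R -> R) (l : R) :
  continuity_pt F l -> vanishes0 (fun x => g x - l) -> vanishes0 (fun x => F (g x) - F l).
Proof.
  intros HF Hg eps Heps. destruct (HF eps Heps) as [al [Hal H]].
  destruct (Hg (al / 2)) as [d [Hd Hgd]]; [lra|].
  exists d. split; [assumption|]. intros x Hx. specialize (Hgd x Hx).
  destruct (Req_dec (g x) l) as [->|Hne]. { rewrite Rminus_diag, Rabs_R0. lra. }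
  left. apply (H (g x)). split.
  - split; [exact I|]. intros E. apply Hne. symmetry. exact E.
  - simpl. unfold R_dist. lra.
Qed.

Lemma vanishes0_mult_lim (g h : R -> R) (l : R) :
  vanishes0 (fun x => g x - l) -> vanishes0 h -> vanishes0 (fun x => g x * h x).
Proof.
  intros Hg Hh. apply (vanishes0_ext _ (fun x => (g x - l) * h x + l * h x) 1); [lra| |].
  - intros; ring.
  - apply vanishes0_plus; [apply vanishes0_mult; assumption|apply vanishes0_scal, Hh].
Qed.

Lemma curve_le (b c u rho x : R) :
  0 < b -> u <= rho -> Rabs c * Rpower u b <= rho -> 0 < x < u ->
  Rabs x <= rho /\ Rabs (c * Rpower x b) <= rho.
Proof.
  intros Hb Hu Hc Hx. split. { rewrite Rabs_pos_eq; lra. }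
  rewrite Rabs_mult, (Rabs_pos_eq (Rpower x b)) by (left; apply Rpower_pos).
  eapply Rle_trans; [|exact Hc]. apply Rmult_le_compat_l; [apply Rabs_pos|].
  apply Rle_Rpower_l; lra.
Qed.

Lemma ev_curve_limit (K b c u rho : R) (a : nat -> nat -> R) :
  1 <= K -> dominated K a -> 0 < b -> 0 < rho <= 1 -> 2 * K * rho <= 1 -> 0 < u <= rho ->
  Rabs c * Rpower u b <= rho ->
  vanishes0 (fun x => ev a x (c * Rpower x b) - a 0%nat 0%nat).
Proof.
  intros HK Ha Hb Hrho HKr Hu Hc.
  destruct (ev_remainder K a HK Ha) as (C & HC & H).
  set (D := Rabs (a 1%nat 0%nat) + Rabs (a 0%nat 1%nat) + C).
  apply (vanishes0_le _ (fun x => D * (x + Rabs c * Rpower x b)) u); [lra| |].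
  2:{ apply vanishes0_scal, vanishes0_plus; [apply vanishes0_id|].
      apply vanishes0_scal, vanishes0_Rpower, Hb. }
  intros x Hx. destruct (curve_le b c u rho x Hb ltac:(lra) Hc Hx) as [Hx1 Hx2].
  set (y := c * Rpower x b) in *.
  assert (Hy : Rabs c * Rpower x b = Rabs y).
  { unfold y. rewrite Rabs_mult, (Rabs_pos_eq (Rpower x b)); [reflexivity|left; apply Rpower_pos]. }
  rewrite Hy.
  set (r := Rmax x (Rabs y)).
  assert (Hr : x <= r /\ Rabs y <= r /\ r <= x + Rabs y /\ r <= rho).
  { assert (H' := Rabs_pos y). rewrite (Rabs_pos_eq x) in Hx1 by lra.
    unfold r. apply Rmax_case_strong; lra. }
  specialize (H r x y ltac:(lra) ltac:(nra) ltac:(rewrite Rabs_pos_eq; lra) ltac:(lra)).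
  assert (HDr : C * r ^ 2 <= C * r) by (apply Rmult_le_compat_l; [assumption|]; nra).
  assert (Hlin : Rabs (a 1%nat 0%nat * x + a 0%nat 1%nat * y)
     <= (Rabs (a 1%nat 0%nat) + Rabs (a 0%nat 1%nat)) * r).
  { eapply Rle_trans; [apply Rabs_triang|]. rewrite !Rabs_mult, (Rabs_pos_eq x) by lra.
    assert (H1 := Rabs_pos (a 1%nat 0%nat)). assert (H2 := Rabs_pos (a 0%nat 1%nat)).
    rewrite Rmult_plus_distr_r. apply Rplus_le_compat; apply Rmult_le_compat_l; lra. }
  assert (HD : 0 <= D).
  { assert (H1 := Rabs_pos (a 1%nat 0%nat)). assert (H2 := Rabs_pos (a 0%nat 1%nat)).
    unfold D. lra. }
  rewrite (Rabs_pos_eq (D * _)).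
  2:{ apply Rmult_le_pos; [assumption|]. assert (H1 := Rabs_pos y). lra. }
  apply Rle_trans with (D * r); [|apply Rmult_le_compat_l; lra].
  replace (ev a x y - a 0%nat 0%nat) with
    ((ev a x y - (a 0%nat 0%nat + a 1%nat 0%nat * x + a 0%nat 1%nat * y))
      + (a 1%nat 0%nat * x + a 0%nat 1%nat * y)) by ring.
  eapply Rle_trans; [apply Rabs_triang|]. unfold D. lra.
Qed.

(** * The family of convergent solutions *)

Section SolutionFamily.

Variables (n : R) (e : nat) (z w : nat -> nat -> R) (K : R).
Hypothesis n_range : 3 / 2 < n < 3.
Hypothesis z_eq : forall i j, z i j = step_fst n e z w i j.
Hypothesis w_eq : forall i j, w i j = step_snd n e z w i j.
Hypothesis K_ge_1 : 1 <= K.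
Hypothesis z_dominated : dominated K z.
Hypothesis w_dominated : dominated K w.

Local Notation nu := (3 / n).
Local Notation b := (beta n).
Local Notation m := (mu n).
Local Notation A := (Rpower (mu n) (- (1 / n))).
Local Notation E0 := (ev z).
Local Notation E1 := (ev (theta1 n z)).
Local Notation E2 := (ev (theta2 n z)).
Local Notation E3 := (ev (theta3 n z)).
Local Notation W := (ev w).

Lemma theta_dominated :
  dominated (2 * K) (theta1 n z) /\ dominated (2 * (2 * K)) (theta2 n z) /\
  dominated (2 * (2 * (2 * K))) (theta3 n z).
Proof.
  assert (Hb := beta_range n n_range).
  assert (H1 : dominated (2 * K) (theta1 n z)) by (apply dominated_weight_exp; try assumption; lra).
  assert (H2 : dominated (2 * (2 * K)) (theta2 n z))
    by (apply dominated_weight_exp; try assumption; lra).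
  split; [assumption|]. split; [assumption|]. apply dominated_weight_exp; try assumption; lra.
Qed.

Lemma ev_profile_equation (rho x y : R) :
  0 <= rho -> 8 * K * rho < 1 -> Rabs x <= rho -> Rabs y <= rho ->
  (1 - x) ^ 2 * E3 x y = INR e * x * (1 - x) * E2 x y + INR e * x ^ 2 * E1 x y
     - m * (1 - x) ^ 3 * W x y.
Proof.
  intros Hrho HKr Hx Hy. destruct theta_dominated as (H1 & H2 & H3).
  assert (Hser : forall a, dominated (8 * K) a -> is_series (homog a x y) (ev a x y)).
  { intros a Ha. apply (is_series_ev (8 * K) rho); try assumption. lra. }
  assert (S1 := Hser _ (dominated_le (2 * K) (8 * K) _ ltac:(lra) ltac:(lra) H1)).
  assert (S2 := Hser _ (dominated_le (2 * (2 * K)) (8 * K) _ ltac:(lra) ltac:(lra) H2)).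
  assert (S3 := Hser _ (dominated_le (2 * (2 * (2 * K))) (8 * K) _ ltac:(lra) ltac:(lra) H3)).
  assert (SW := Hser _ (dominated_le K (8 * K) _ ltac:(lra) ltac:(lra) w_dominated)).
  assert (L := sums_plus _ _ _ _ _ _ S3 (sums_scal m _ _ _ _ SW)).
  assert (S3' := sums_shift _ _ _ _ S3). assert (S3'' := sums_shift _ _ _ _ S3').
  assert (S2' := sums_shift _ _ _ _ S2). assert (S2'' := sums_shift _ _ _ _ S2').
  assert (S1'' := sums_shift _ _ _ _ (sums_shift _ _ _ _ S1)).
  assert (SW' := sums_shift _ _ _ _ SW). assert (SW'' := sums_shift _ _ _ _ SW').
  assert (SW''' := sums_shift _ _ _ _ SW'').
  assert (T3 := sums_plus _ _ _ _ _ _ (sums_scal 2 _ _ _ _ S3') (sums_scal (-1) _ _ _ _ S3'')).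
  assert (T2 := sums_scal (INR e) _ _ _ _
     (sums_plus _ _ _ _ _ _ S2' (sums_scal (-1) _ _ _ _ S2''))).
  assert (TW := sums_scal m _ _ _ _ (sums_plus _ _ _ _ _ _ (sums_plus _ _ _ _ _ _
     (sums_scal 3 _ _ _ _ SW') (sums_scal (-3) _ _ _ _ SW'')) SW''')).
  assert (T := sums_plus _ _ _ _ _ _ (sums_plus _ _ _ _ _ _ (sums_plus _ _ _ _ _ _ T3 T2)
     (sums_scal (INR e) _ _ _ _ S1'')) TW).
  assert (L' := is_series_unique _ _ L).
  apply (is_series_ext _ (homog (fun i j => theta3 n z i j + m * w i j) x y)) in T.
  2:{ intros N. apply diag_ext. intros i j _. f_equal. f_equal.
      rewrite (linear_identity n e n_range z w z_eq w_eq). unfold linear_rhs. ring. }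
  cbv beta in L'. rewrite (is_series_unique _ _ T) in L'. lra.
Qed.

Lemma ev_power_equation (rho x y : R) :
  0 <= rho -> 2 * K * rho < 1 -> Rabs x <= rho -> Rabs y <= rho ->
  E0 x y * ev (weight b 0 w) x y + (n - 1) * (ev (weight b 0 z) x y * W x y) = 0.
Proof.
  intros Hrho HKr Hx Hy. assert (Hb := beta_range n n_range).
  assert (Dz : dominated (2 * K) (weight b 0 z)) by (apply dominated_weight_exp; try assumption; lra).
  assert (Dw : dominated (2 * K) (weight b 0 w)) by (apply dominated_weight_exp; try assumption; lra).
  assert (Hz' := dominated_le K (2 * K) _ ltac:(lra) ltac:(lra) z_dominated).
  assert (Hw' := dominated_le K (2 * K) _ ltac:(lra) ltac:(lra) w_dominated).
  assert (Hser : forall a, dominated (2 * K) a -> is_series (homog a x y) (ev a x y)).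
  { intros a Ha. apply (is_series_ev (2 * K) rho); try assumption. lra. }
  assert (Habs : forall a, dominated (2 * K) a -> ex_series (fun N => Rabs (homog a x y N))).
  { intros a Ha. apply (ex_series_homog_abs (2 * K) rho); try assumption. lra. }
  assert (T := sums_plus _ _ _ _ _ _
    (sums_conv2 _ _ _ _ _ _ (Habs _ Hz') (Habs _ Dw) (Hser _ Hz') (Hser _ Dw))
    (sums_scal (n - 1) _ _ _ _
      (sums_conv2 _ _ _ _ _ _ (Habs _ Dz) (Habs _ Hw') (Hser _ Dz) (Hser _ Hw')))).
  rewrite <- (is_series_unique _ _ T).
  apply is_series_unique. apply (is_series_ext (fun _ => 0)).
  - intros N. symmetry. apply sum_eq_R0. intros i _.
    rewrite (bilinear_identity n e n_range z w z_eq w_eq). ring.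
  - change (is_lim_seq (sum_n (fun _ => 0)) 0).
    apply is_lim_seq_ext with (u := fun _ => 0); [|apply is_lim_seq_const].
    intros N. rewrite sum_n_const. ring.
Qed.

(* z^(n-1) w is constant along the curve, by [ev_power_equation], and equals 1 at x = 0. *)
Lemma ev_w_power (c u rho : R) :
  0 < rho <= 1 -> 4 * K * rho < 1 -> 0 < u <= rho -> Rabs c * Rpower u b <= rho ->
  (forall x, 0 < x < u -> 0 < E0 x (c * Rpower x b)) ->
  forall x, 0 < x < u -> W x (c * Rpower x b) = Rpower (E0 x (c * Rpower x b)) (1 - n).
Proof.
  intros Hrho HKr Hu Hc Hpos x Hx. assert (Hb := beta_range n n_range).
  set (Zf := fun t => E0 t (c * Rpower t b)). set (Wf := fun t => W t (c * Rpower t b)).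
  assert (Hder : forall a, dominated K a -> forall t, 0 < t < u ->
    is_derive (fun t => ev a t (c * Rpower t b)) t
      (Rpower t (-1) * ev (weight b 0 a) t (c * Rpower t b))).
  { intros a Ha t Ht.
    apply (is_derive_ext_loc (fun t => Rpower t 0 * ev a t (c * Rpower t b))).
    - exists (mkposreal t (proj1 Ht)). intros s Hs.
      assert (0 < s).
      { apply Rabs_def2 in Hs. unfold minus, plus, opp in Hs; simpl in Hs. lra. }
      rewrite Rpower_O by assumption. apply Rmult_1_l.
    - replace (-1) with (0 - 1) by ring.
      apply (is_derive_ev_curve a K b c 0 rho u t); try assumption; lra. }
  set (Phi := fun t => Wf t * Rpower (Zf t) (n - 1)).
  (* The derivative is z^(n-2)/t times z theta w + (n-1) w theta z. *)
  assert (HPhi : forall t, 0 < t < u -> is_derive Phi t 0).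
  { intros t Ht. unfold Phi. evar_last.
    - apply (is_derive_mult Wf (fun t => Rpower (Zf t) (n - 1))).
      + apply Hder; assumption.
      + apply (is_derive_comp (fun s => Rpower s (n - 1)) Zf).
        * apply is_derive_Rpower, Hpos, Ht.
        * apply Hder; assumption.
      + intros; apply Rmult_comm.
    - unfold scal, plus; simpl. unfold mult; simpl.
      assert (HZ : 0 < Zf t) by apply Hpos, Ht.
      rewrite (Rpower_step (n - 1) (Zf t)) by assumption.
      destruct (curve_le b c u rho t ltac:(lra) ltac:(lra) Hc Ht) as [Ht1 Ht2].
      assert (HE := ev_power_equation rho t (c * Rpower t b) ltac:(lra) ltac:(lra) Ht1 Ht2).
      change (E0 t (c * Rpower t b)) with (Zf t) in HE.
      change (W t (c * Rpower t b)) with (Wf t) in HE.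
      set (dw := ev (weight b 0 w) t (c * Rpower t b)) in *.
      set (dz := ev (weight b 0 z) t (c * Rpower t b)) in *.
      set (P := Rpower (Zf t) (n - 1 - 1)). set (q := Rpower t (-1)).
      transitivity (q * P * (Zf t * dw + (n - 1) * (dz * Wf t))); [ring|].
      rewrite HE. ring. }
  assert (Hconst : forall s t, 0 < s -> s <= t -> t < u -> Phi s = Phi t).
  { intros s t Hs Hst Ht. apply Rle_antisym.
    - apply (derive_nonneg_incr Phi (fun _ => 0) 0 u); try assumption. intros; lra.
    - apply (derive_nonpos_decr Phi (fun _ => 0) 0 u); try assumption. intros; lra. }
  assert (HZlim : vanishes0 (fun x => Zf x - 1)).
  { rewrite <- (z00 n e z w z_eq). apply (ev_curve_limit K b c u rho); try assumption; lra. }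
  assert (HWlim : vanishes0 (fun x => Wf x - 1)).
  { rewrite <- (w00 n e z w w_eq). apply (ev_curve_limit K b c u rho); try assumption; lra. }
  assert (Hone : Rpower 1 (n - 1) = 1).
  { unfold Rpower. rewrite ln_1, Rmult_0_r, exp_0. reflexivity. }
  assert (HRlim : vanishes0 (fun x => Rpower (Zf x) (n - 1) - 1)).
  { assert (Hcont : continuity_pt (fun s => Rpower s (n - 1)) 1).
    { eapply is_derive_continuity_pt. apply is_derive_Rpower. lra. }
    assert (H := vanishes0_comp _ Zf 1 Hcont HZlim). cbv beta in H.
    rewrite Hone in H. exact H. }
  assert (HPlim : vanishes0 (fun x => Phi x - 1)).
  { apply (vanishes0_ext _ (fun x => Rpower (Zf x) (n - 1) * (Wf x - 1)
       + (Rpower (Zf x) (n - 1) - 1)) 1); [lra|intros; unfold Phi; ring|].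
    apply vanishes0_plus; [|assumption]. apply (vanishes0_mult_lim _ _ 1); assumption. }
  assert (HP1 : Phi x = 1).
  { apply Rminus_diag_uniq. apply cond_eq. intros eps Heps.
    destruct (HPlim (eps / 2)) as [d [Hd H]]; [lra|].
    assert (Hm : 0 < Rmin d x) by (apply Rmin_case; lra).
    assert (Hm1 := Rmin_l d x). assert (Hm2 := Rmin_r d x).
    rewrite <- (Hconst (Rmin d x / 2) x) by lra.
    specialize (H (Rmin d x / 2) ltac:(lra)). rewrite Rminus_0_r. lra. }
  change (Wf x = Rpower (Zf x) (1 - n)).
  replace (1 - n) with (- (n - 1)) by ring. rewrite Rpower_Ropp.
  assert (Hp := Rpower_pos (Zf x) (n - 1)). unfold Phi in HP1.
  apply Rmult_eq_reg_r with (Rpower (Zf x) (n - 1)); [|lra]. rewrite HP1, Rinv_l; lra.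
Qed.

(** The constant 16 arises from the third derivative: it differentiates the series of [theta2],
    dominated with 4 K, and [is_derive_ev_curve] asks for another factor 4. The conditions at 0 hold
    because nu > 1. *)
Lemma expansion_local_solution (c u rho : R) :
  0 < rho <= 1 -> 16 * K * rho < 1 -> 0 < u <= rho -> Rabs c * Rpower u b <= rho -> u <= 1 ->
  (forall x, 0 < x < u -> 0 < E0 x (c * Rpower x b)) ->
  exists f1 f2 f3,
    local_solution e n u (fun x => A * Rpower x nu * E0 x (c * Rpower x b)) f1 f2 f3.
Proof.
  intros Hrho HKr Hu Hc Hu1 Hpos.
  assert (Hb := beta_range n n_range). assert (Hnu := nu_range n n_range).
  destruct theta_dominated as (D1 & D2 & D3).
  exists (fun x => A * (Rpower x (nu - 1) * E1 x (c * Rpower x b))),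
    (fun x => A * (Rpower x (nu - 1 - 1) * E2 x (c * Rpower x b))),
    (fun x => A * (Rpower x (nu - 1 - 1 - 1) * E3 x (c * Rpower x b))).
  split; [|split; [|split]].
  - intros x Hx. split; [|split].
    + apply (is_derive_ext (fun x => A * (Rpower x nu * E0 x (c * Rpower x b)))).
      { intros t. symmetry. apply Rmult_assoc. }
      apply (is_derive_scal (fun x => Rpower x nu * E0 x (c * Rpower x b))).
      apply (is_derive_ev_curve z K b c nu rho u x); try assumption; lra.
    + apply (is_derive_scal (fun x => Rpower x (nu - 1) * E1 x (c * Rpower x b))).
      apply (is_derive_ev_curve (theta1 n z) (2 * K) b c (nu - 1) rho u x); try assumption; lra.
    + apply (is_derive_scal (fun x => Rpower x (nu - 1 - 1) * E2 x (c * Rpower x b))).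
      unfold theta3. replace (nu - 2) with (nu - 1 - 1) by ring.
      apply (is_derive_ev_curve (theta2 n z) (2 * (2 * K)) b c (nu - 1 - 1) rho u x);
        try assumption; lra.
  - apply (vanishes0_ext _ (fun x => E0 x (c * Rpower x b) * (A * Rpower x nu)) 1);
      [lra|intros; ring|].
    eapply vanishes0_mult_lim.
    + apply (ev_curve_limit K b c u rho); try assumption; lra.
    + apply vanishes0_scal, vanishes0_Rpower. lra.
  - apply (vanishes0_ext _ (fun x => E1 x (c * Rpower x b) * (A * Rpower x (nu - 1))) 1);
      [lra|intros; ring|].
    eapply vanishes0_mult_lim.
    + apply (ev_curve_limit (2 * K) b c u rho); try assumption; lra.
    + apply vanishes0_scal, vanishes0_Rpower. lra.
  - intros x Hx. assert (HZ := Hpos x Hx).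
    assert (HA := Rpower_pos m (- (1 / n))). assert (HX := Rpower_pos x nu).
    split. { repeat apply Rmult_lt_0_compat; assumption. }
    set (y := c * Rpower x b) in *.
    replace (A * Rpower x nu * E0 x y) with (E0 x y * A * Rpower x nu) by ring.
    rewrite profile_power by (lra || assumption).
    unfold y. rewrite <- (ev_w_power c u rho) by (lra || assumption). fold y.
    destruct (curve_le b c u rho x ltac:(lra) ltac:(lra) Hc Hx) as [Hx1 Hx2].
    assert (HE := ev_profile_equation rho x y ltac:(lra) ltac:(lra) Hx1 Hx2).
    unfold thin_op. fold y.
    rewrite (Rpower_step (nu - 1) x), (Rpower_step (nu - 1 - 1) x) by lra.
    replace (nu - 3) with (nu - 1 - 1 - 1) by ring.
    set (P := Rpower x (nu - 1 - 1 - 1)).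
    apply Rmult_eq_reg_l with ((1 - x) ^ 2); [|apply pow_nonzero; lra].
    transitivity (A * P * ((1 - x) ^ 2 * E3 x y - INR e * x * (1 - x) * E2 x y
      - INR e * x ^ 2 * E1 x y)); [field; lra|].
    rewrite HE. ring.
Qed.

End SolutionFamily.

(** * Matching the given solution *)

Lemma is_derive_within_eps (f : R -> R) (x l : R) :
  is_derive_within unit_cc f x l ->
  forall eps, 0 < eps -> exists delta, 0 < delta /\
    forall y, unit_cc y -> y <> x -> Rabs (y - x) < delta ->
      Rabs ((f y - f x) / (y - x) - l) < eps.
Proof.
  intros H eps Heps.
  assert (Hl : locally l (fun t => Rabs (t - l) < eps)) by (exists (mkposreal eps Heps); auto).
  destruct (H _ Hl) as [d Hd]. exists d. split; [apply cond_pos|].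
  intros y Hy Hne Hyx. apply Hd; auto.
Qed.

Lemma is_derive_within_unique (f : R -> R) (x l l' : R) :
  unit_cc x -> is_derive_within unit_cc f x l -> is_derive_within unit_cc f x l' -> l = l'.
Proof.
  intros Hx Hl Hl'. apply cond_eq. intros eps Heps.
  destruct (is_derive_within_eps f x l Hl (eps / 2)) as [d [Hd H]]; [lra|].
  destruct (is_derive_within_eps f x l' Hl' (eps / 2)) as [d' [Hd' H']]; [lra|].
  assert (Hy : exists y, unit_cc y /\ y <> x /\ Rabs (y - x) < d /\ Rabs (y - x) < d').
  { set (h := Rmin (Rmin d d') 1 / 2).
    assert (Hh : 0 < h <= 1 / 2 /\ h < d /\ h < d').
    { unfold h. assert (H1 := Rmin_l (Rmin d d') 1). assert (H2 := Rmin_r (Rmin d d') 1).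
      assert (H3 := Rmin_l d d'). assert (H4 := Rmin_r d d').
      assert (0 < Rmin (Rmin d d') 1) by (repeat apply Rmin_case; lra). lra. }
    unfold unit_cc in *. destruct (Rle_dec x (1 / 2)).
    - exists (x + h). replace (x + h - x) with h by ring. rewrite Rabs_pos_eq; lra.
    - exists (x - h). replace (x - h - x) with (- h) by ring.
      rewrite Rabs_Ropp, Rabs_pos_eq; lra. }
  destruct Hy as (y & Hy & Hne & Hyd & Hyd').
  specialize (H y Hy Hne Hyd). specialize (H' y Hy Hne Hyd').
  set (q := (f y - f x) / (y - x)) in *.
  replace (l - l') with ((q - l') - (q - l)) by ring.
  eapply Rle_lt_trans; [apply Rabs_triang|]. rewrite Rabs_Ropp. lra.
Qed.

Lemma is_derive_is_derive_within (f : R -> R) (x l : R) :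
  is_derive f x l -> is_derive_within unit_cc f x l.
Proof.
  intros H. apply is_derive_Reals in H.
  apply filterlim_locally. intros eps. destruct (H eps (cond_pos eps)) as [d Hd].
  exists d. intros y Hyx [_ Hne].
  assert (E : forall t : R, t = x + (t - x)) by (intros; ring).
  change (Rabs ((f y - f x) / (y - x) - l) < eps). rewrite (E y) at 1.
  apply Hd; [lra|exact Hyx].
Qed.

Lemma vanishes0_of_derive_within (f : R -> R) :
  f 0 = 0 -> is_derive_within unit_cc f 0 0 -> vanishes0 f.
Proof.
  intros Hf H eps Heps.
  destruct (is_derive_within_eps f 0 0 H 1 Rlt_0_1) as [d [Hd Hq]].
  exists (Rmin (Rmin d 1) eps). split. { repeat apply Rmin_case; lra. }
  intros x Hx. assert (H1 := Rmin_l (Rmin d 1) eps). assert (H2 := Rmin_r (Rmin d 1) eps).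
  assert (H3 := Rmin_l d 1). assert (H4 := Rmin_r d 1).
  specialize (Hq x ltac:(unfold unit_cc; lra) ltac:(lra)
    ltac:(rewrite Rminus_0_r, Rabs_pos_eq; lra)).
  rewrite Hf, !Rminus_0_r in Hq.
  replace (f x) with (f x / x * x) by (field; lra).
  rewrite Rabs_mult, (Rabs_pos_eq x) by lra.
  apply Rle_trans with (1 * x); [apply Rmult_le_compat_r; lra|lra].
Qed.

(** Uniqueness of the derivative relative to the interval identifies the continuous f' with
    [Derive f] inside; continuity then carries the one-sided end slope into the interior. *)
Lemma derivative_at_endpoint (f f' : R -> R) (x0 : R) :
  (forall x, unit_cc x -> is_derive_within unit_cc f x (f' x) /\ continuous_within unit_cc f' x) ->
  (forall x, 0 < x < 1 -> ex_derive f x) ->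
  unit_cc x0 -> is_derive_within unit_cc f x0 0 ->
  forall eps, 0 < eps -> exists delta, 0 < delta /\
    forall x, 0 < x < 1 -> Rabs (x - x0) < delta -> Rabs (Derive f x) < eps.
Proof.
  intros Hf Hex Hx0 H0 eps Heps.
  destruct (Hf x0 Hx0) as [Hd Hc].
  assert (E0 := is_derive_within_unique f x0 _ _ Hx0 Hd H0).
  assert (Hl : locally (f' x0) (fun t => Rabs (t - f' x0) < eps))
    by (exists (mkposreal eps Heps); auto).
  destruct (Hc _ Hl) as [d H]. exists d. split; [apply cond_pos|].
  intros x Hx Hxd. assert (Hux : unit_cc x) by (unfold unit_cc; lra).
  rewrite (is_derive_within_unique f x (Derive f x) (f' x) Hux).
  - specialize (H x Hxd Hux). rewrite E0, Rminus_0_r in H. exact H.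
  - apply is_derive_is_derive_within, Derive_correct, Hex, Hx.
  - apply Hf, Hux.
Qed.

Lemma profile_local_solution (e : nat) (n : R) (H : R -> R) :
  C3_oo01 H -> (forall x, 0 < x <= 1 -> 0 < H x) ->
  (forall x, 0 < x < 1 -> profile_equation (S e) n H x) ->
  vanishes0 H -> vanishes0 (Derive H) ->
  local_solution e n 1 H (Derive H) (Derive_n H 2) (Derive_n H 3).
Proof.
  intros HC3 Hpos Heq H0 H1. split; [|split; [|split]]; try assumption.
  - intros x Hx. destruct (HC3 x Hx) as [Hex _].
    split; [|split]; apply Derive_correct.
    + apply (Hex 1%nat). lia.
    + apply (Hex 2%nat). lia.
    + apply (Hex 3%nat). lia.
  - intros x Hx. assert (Hp := Hpos x ltac:(lra)). split; [assumption|].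
    specialize (Heq x Hx). unfold profile_equation in Heq. unfold thin_op.
    rewrite S_INR in Heq. replace (INR e + 1 - 1) with (INR e) in Heq by ring.
    change (Derive_n H 1 x) with (Derive H x) in Heq.
    replace (1 - n) with (- (n - 1)) by ring. rewrite Rpower_Ropp.
    assert (HR := Rpower_pos (H x) (n - 1)).
    apply Rmult_eq_reg_l with (Rpower (H x) (n - 1)); [|lra].
    rewrite Heq. field. lra.
Qed.

Lemma dominated_off0 (K : R) (a : nat -> nat -> R) : dominated K a -> dominated K (off0 a).
Proof.
  intros (M & HM & H). exists M. split; [assumption|]. intros N.
  eapply Rle_trans; [|apply H]. apply diag_le. intros [|i] [|j] _; simpl; try lra.
  rewrite Rabs_R0. apply Rabs_pos.
Qed.

Lemma ev_off0 (K rho x y : R) (a : nat -> nat -> R) :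
  0 <= K -> 0 <= rho -> K * rho < 1 -> Rabs x <= rho -> Rabs y <= rho -> dominated K a ->
  ev a x y = a 0%nat 0%nat + ev (off0 a) x y.
Proof.
  intros HK Hrho HKr Hx Hy Ha.
  assert (Ha' := dominated_off0 K a Ha).
  unfold ev. rewrite (Series_incr_1 (homog a x y)), (Series_incr_1 (homog (off0 a) x y)).
  - rewrite (Series_ext (fun k => homog (off0 a) x y (S k)) (fun k => homog a x y (S k))).
    + unfold homog at 1 3. unfold diag. simpl. ring.
    + intros k. apply diag_ext. intros [|i] [|j] Hij; try reflexivity. simpl in Hij. lia.
  - eexists. apply (is_series_ev K rho); assumption.
  - eexists. apply (is_series_ev K rho); assumption.
Qed.

Lemma ev_0_0 (K : R) (a : nat -> nat -> R) :
  1 <= K -> dominated K a -> ev a 0 0 = a 0%nat 0%nat.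
Proof.
  intros HK Ha. destruct (ev_remainder K a HK Ha) as (C & HC & H).
  specialize (H 0 0 0 (Rle_refl 0) ltac:(lra) ltac:(rewrite Rabs_R0; lra)
    ltac:(rewrite Rabs_R0; lra)).
  assert (E : C * 0 ^ 2 = 0) by ring. rewrite E in H.
  apply Rabs_le_between in H. lra.
Qed.

(** On either axis the linear term beats the quadratic remainder. This supplies nonzero values of v
    arbitrarily close to the origin, on both axes. *)
Lemma ev_axis_positive (K : R) (a : nat -> nat -> R) :
  1 <= K -> dominated K a -> a 0%nat 0%nat = 0 ->
  0 < a 1%nat 0%nat -> 0 < a 0%nat 1%nat ->
  exists r, 0 < r /\ forall t, 0 < t < r -> 0 < ev a t 0 /\ 0 < ev a 0 t.
Proof.
  intros HK Ha H00 H10 H01. destruct (ev_remainder K a HK Ha) as (C & HC & H).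
  set (k := Rmin (a 1%nat 0%nat) (a 0%nat 1%nat)).
  assert (Hk : 0 < k) by (unfold k; apply Rmin_case; assumption).
  assert (Hk1 := Rmin_l (a 1%nat 0%nat) (a 0%nat 1%nat)).
  assert (Hk2 := Rmin_r (a 1%nat 0%nat) (a 0%nat 1%nat)). fold k in Hk1, Hk2.
  exists (Rmin (/ (2 * K)) (k / (C + 1))). split.
  { apply Rmin_case; [apply Rinv_0_lt_compat; lra|apply Rdiv_lt_0_compat; lra]. }
  intros t Ht. assert (H1 := Rmin_l (/ (2 * K)) (k / (C + 1))).
  assert (H2 := Rmin_r (/ (2 * K)) (k / (C + 1))).
  assert (HtK : 2 * K * t <= 1).
  { replace 1 with (2 * K * / (2 * K)) by (field; lra). apply Rmult_le_compat_l; lra. }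
  assert (HtC : (C + 1) * t < k).
  { replace k with ((C + 1) * (k / (C + 1))) by (field; lra). apply Rmult_lt_compat_l; lra. }
  assert (Hq : C * t ^ 2 < k * t) by (simpl; nra).
  assert (Ht0 : Rabs t <= t) by (rewrite Rabs_pos_eq; lra).
  assert (H0t : Rabs 0 <= t) by (rewrite Rabs_R0; lra).
  assert (A1 := H t t 0 ltac:(lra) HtK Ht0 H0t).
  assert (A2 := H t 0 t ltac:(lra) HtK H0t Ht0).
  rewrite H00, Rmult_0_r in A1, A2. apply Rabs_le_between in A1, A2.
  split; nra.
Qed.

Lemma Rpower_2_le (s : R) : 0 <= s <= 1 -> Rpower 2 s <= 2.
Proof.
  intros Hs. rewrite <- (Rpower_1 2) at 2 by lra. apply Rle_Rpower; lra.
Qed.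

(* The free coefficient c is found by matching the value of H at a single small point: the
   ratio H / (A x^nu) gets close to 1 there, and the intermediate value theorem applies to
   the second argument of the expansion. *)
Lemma profile_expansion (e : nat) (n K : R) (z w : nat -> nat -> R) (f f1 f2 f3 : R -> R) :
  3 / 2 < n < 3 ->
  (forall i j, z i j = step_fst n e z w i j) ->
  (forall i j, w i j = step_snd n e z w i j) ->
  1 <= K -> dominated K z -> dominated K w ->
  local_solution e n 1 f f1 f2 f3 ->
  exists c x1 rho, 0 < x1 <= rho /\ x1 < 1 /\ 0 < rho /\ 4 * K * rho < 1 /\
    Rabs c * Rpower x1 (beta n) <= rho /\
    forall x, 0 < x <= x1 ->
      f x = Rpower (mu n) (- (1 / n)) * Rpower x (3 / n) * ev z x (c * Rpower x (beta n)).
Proof.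
  intros Hn Hz Hw HK Dz Dw Hsol.
  assert (Hb := beta_range n Hn).
  destruct (ev_remainder K z HK Dz) as (C & HC & Hrem).
  assert (E00 := z00 n e z w Hz). assert (E01 := z01 n e z w Hz).
  assert (E10 := z10_pos n e Hn z w Hz Hw).
  set (b := beta n) in *. set (a10 := z 1%nat 0%nat) in *.
  set (L := a10 + 1 + C).
  (* The box of half-width 2 rho is used: 64 K ensures 16 K (2 rho) < 1, and 8 L keeps |z - 1| <=
     1/4 there, so z is positive. *)
  set (rho := Rmin (/ (64 * K)) (/ (8 * L))).
  assert (HL : 1 <= L) by (unfold L; lra).
  assert (Hrho : 0 < rho) by (unfold rho; apply Rmin_case; apply Rinv_0_lt_compat; lra).
  assert (HrK : 64 * K * rho <= 1).
  { replace 1 with (64 * K * / (64 * K)) by (field; lra).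
    apply Rmult_le_compat_l; [lra|apply Rmin_l]. }
  assert (HrL : 8 * L * rho <= 1).
  { replace 1 with (8 * L * / (8 * L)) by (field; lra).
    apply Rmult_le_compat_l; [lra|apply Rmin_r]. }
  assert (Hr1 : 64 * rho <= 1) by nra.
  assert (HCr : 8 * (C * rho) <= 1).
  { assert (C * rho <= L * rho) by (apply Rmult_le_compat_r; unfold L; lra). lra. }
  clearbody rho.
  assert (Hbox : forall x y, Rabs x <= 2 * rho -> Rabs y <= 2 * rho -> 0 < ev z x y).
  { intros x y Hx Hy. specialize (Hrem (2 * rho) x y ltac:(lra) ltac:(nra) Hx Hy).
    rewrite E00, E01 in Hrem. fold a10 in Hrem. apply Rabs_le_between in Hrem.
    apply Rabs_le_between in Hx, Hy.
    assert (H1 : - (a10 * (2 * rho)) <= a10 * x) by nra.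
    assert (H2 : C * (2 * rho) ^ 2 <= C * (2 * rho)).
    { apply Rmult_le_compat_l; [assumption|]. simpl. nra. }
    assert (H3 : (a10 + 1 + C) * (2 * rho) <= 1 / 4) by (unfold L in HrL; lra). lra. }
  (* For x1 < a the term a10 x1 is at most rho/4 and the remainder at most rho/8. Hence z(x1, -rho)
     and z(x1, rho) lie beyond 1 - rho/2 and 1 + rho/2, which enclose the ratio at x1. *)
  set (a := Rmin rho (rho / (4 * a10))).
  assert (Ha : 0 < a).
  { unfold a. apply Rmin_case; [assumption|apply Rdiv_lt_0_compat; lra]. }
  assert (Ha1 : a <= rho) by apply Rmin_l.
  assert (Ha2 : 4 * a10 * a <= rho).
  { apply Rle_trans with (4 * a10 * (rho / (4 * a10))); [|right; field; lra].
    apply Rmult_le_compat_l; [lra|apply Rmin_r]. }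
  clearbody a.
  destruct (ratio_close_to_1 e n a (rho / 2) f f1 f2 f3 Hn) as (x1 & Hx1 & Hlow & Hup);
    [lra|lra|apply (local_solution_restrict e n 1); [lra|assumption]|].
  set (A := Rpower (mu n) (- (1 / n))) in *. set (X := Rpower x1 (3 / n)) in *.
  assert (HAX : 0 < A * X) by (apply Rmult_lt_0_compat; apply Rpower_pos).
  assert (Hrem1 : forall y, Rabs y <= rho ->
     Rabs (ev z x1 y - (1 + a10 * x1 + 1 * y)) <= C * rho * rho).
  { intros y Hy. assert (Hx1' : Rabs x1 <= rho) by (rewrite Rabs_pos_eq; lra).
    assert (H := Hrem rho x1 y ltac:(lra) ltac:(nra) Hx1' Hy).
    rewrite E00, E01 in H. fold a10 in H. simpl in H. lra. }
  assert (HCrr : C * rho * rho <= rho / 8) by nra.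
  assert (Hplus := Hrem1 rho ltac:(rewrite Rabs_pos_eq; lra)).
  assert (Hminus := Hrem1 (- rho) ltac:(rewrite Rabs_Ropp, Rabs_pos_eq; lra)).
  apply Rabs_le_between in Hplus, Hminus.
  assert (Ha10 : 0 < a10 * x1 <= rho / 4) by nra.
  destruct (ev_lipschitz_snd K (2 * rho) x1 z HK Dz) as (Lc & HLc & Hlip);
    [lra|nra|rewrite Rabs_pos_eq; lra|].
  destruct (IVT_interv (fun y => A * X * ev z x1 y - f x1) (- rho) rho) as [y [Hy Ey]].
  - intros t Ht eps Heps. set (k := A * X * (Lc + 1)).
    assert (Hk : 0 < k) by (unfold k; nra).
    exists (Rmin rho (eps / k)). split.
    { apply Rmin_case; [assumption|]. apply Rdiv_lt_0_compat; lra. }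
    intros s [_ Hs]. simpl in Hs. unfold R_dist in Hs.
    assert (H1 := Rmin_l rho (eps / k)). assert (H2 := Rmin_r rho (eps / k)).
    assert (Hst : Rabs (s - t) < rho) by lra. apply Rabs_def2 in Hst.
    simpl. unfold R_dist.
    replace (_ - _) with (A * X * (ev z x1 s - ev z x1 t)) by ring.
    rewrite Rabs_mult, (Rabs_pos_eq (A * X)) by lra.
    specialize (Hlip s t ltac:(apply Rabs_le; lra) ltac:(apply Rabs_le; lra)).
    assert (Hp := Rabs_pos (s - t)).
    apply Rle_lt_trans with (k * Rabs (s - t)).
    + set (q := Rabs (s - t)) in *. clearbody q.
      replace (k * q) with (A * X * ((Lc + 1) * q)) by (unfold k; ring).
      apply Rmult_le_compat_l; lra.
    + replace eps with (k * (eps / k)) by (field; lra). apply Rmult_lt_compat_l; lra.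
  - lra.
  - assert (ev z x1 (- rho) <= 1 - rho / 2) by lra. nra.
  - assert (1 + rho / 2 <= ev z x1 rho) by lra. nra.
  - assert (HXb := Rpower_pos x1 b).
    set (c := y / Rpower x1 b).
    assert (Ec : c * Rpower x1 b = y) by (unfold c; field; lra).
    assert (Hcx : Rabs c * Rpower x1 b = Rabs y).
    { rewrite <- Ec, Rabs_mult, (Rabs_pos_eq (Rpower x1 b)); lra. }
    assert (Hy' : Rabs y <= rho) by (apply Rabs_le; lra).
    (* The series solution is needed on (0, 2 x1), because uniqueness requires x1 to be an interior
       point. As 2^b <= 2, doubling the box suffices. *)
    assert (Hcu : Rabs c * Rpower (2 * x1) b <= 2 * rho).
    { rewrite <- Rpower_mult_distr by lra.
      replace (Rabs c * (Rpower 2 b * Rpower x1 b)) with (Rpower 2 b * Rabs y)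
        by (rewrite <- Hcx; ring).
      apply Rmult_le_compat; [left; apply Rpower_pos|apply Rabs_pos| |assumption].
      apply Rpower_2_le. lra. }
    destruct (expansion_local_solution n e z w K Hn Hz Hw HK Dz Dw c (2 * x1) (2 * rho))
      as (g1 & g2 & g3 & Hg); try assumption; try lra.
    { intros x Hx. fold b. destruct (curve_le b c (2 * x1) (2 * rho) x) as [H1 H2];
        try assumption; try lra. apply Hbox; assumption. }
    exists c, x1, rho. fold b.
    split; [lra|]. split; [lra|]. split; [lra|]. split; [lra|]. split; [lra|].
    apply (local_solution_unique e n (2 * x1) x1 f f1 f2 f3
      (fun x => A * Rpower x (3 / n) * ev z x (c * Rpower x b)) g1 g2 g3);
      try assumption; try lra.
    + apply (local_solution_restrict e n 1); [lra|assumption].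
    + fold X. rewrite Ec. lra.
Qed.

Theorem theoremA2 (d : nat) (n : R) (H : R -> R)
  (d_pos : (1 <= d)%nat)
  (n_range : 3 / 2 < n < 3)
  (H_C3 : C3_oo01 H)
  (H_C1 : C1_cc01 H)
  (H_pos : forall x, 0 < x <= 1 -> 0 < H x)
  (H_eq : forall x, 0 < x < 1 -> profile_equation d n H x)
  (H_0 : H 0 = 0)
  (dH_0 : is_derive_within unit_cc H 0 0)
  (dH_1 : is_derive_within unit_cc H 1 0) :
  0 < beta n < 1 /\
  exists v : R -> R -> R,
    analytic2_at v 0 0 /\
    v 0 0 = 0 /\
    nontrivial_near0 v /\
    depends_on_fst_near0 v /\
    depends_on_snd_near0 v /\
    exists c : R, 0 < c /\
      forall x, 0 <= x <= c ->
        H x = Rpower (mu n) (- (1 / n)) * rpow x (3 / n)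
              * (1 + v x (rpow x (beta n))).
Proof.
  assert (Hb := beta_range n n_range). split; [exact Hb|].
  destruct d as [|e]; [lia|].
  assert (Hex : forall x, 0 < x < 1 -> ex_derive H x).
  { intros x Hx. apply (proj1 (H_C3 x Hx) 1%nat). lia. }
  destruct H_C1 as [H' HH'].
  assert (Hsol : local_solution e n 1 H (Derive H) (Derive_n H 2) (Derive_n H 3)).
  { apply profile_local_solution; try assumption.
    - apply vanishes0_of_derive_within; assumption.
    - intros eps Heps.
      destruct (derivative_at_endpoint H H' 0 HH' Hex ltac:(unfold unit_cc; lra) dH_0 eps Heps)
        as [dl [Hdl Hd]].
      exists (Rmin dl 1). split. { apply Rmin_case; lra. }
      intros x Hx. assert (H1 := Rmin_l dl 1). assert (H2 := Rmin_r dl 1).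
      left. apply Hd; [lra|]. rewrite Rminus_0_r, Rabs_pos_eq; lra. }
  destruct (formal_solution_exists n e) as (z & w & Hz & Hw).
  destruct (coefficients_dominated n e n_range z w Hz Hw) as (K & HK & Dz & Dw).
  destruct (profile_expansion e n K z w _ _ _ _ n_range Hz Hw HK Dz Dw Hsol)
    as (c & x1 & rho & Hx1 & Hx1' & Hrho & HKr & Hc & Hexp).
  assert (Doz := dominated_off0 K z Dz).
  assert (E00 := z00 n e z w Hz). assert (E01 := z01 n e z w Hz).
  assert (E10 := z10_pos n e n_range z w Hz Hw).
  destruct (ev_axis_positive K (off0 z) HK Doz eq_refl E10) as (r & Hr & Hax);
    [simpl; lra|].
  assert (Hev : forall x y, Rabs x <= rho -> Rabs y <= rho -> ev z x y = 1 + ev (off0 z) x y).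
  { intros x y Hx Hy. rewrite <- E00. apply (ev_off0 K rho); try assumption; nra. }
  assert (Hcurve : forall x, 0 < x <= x1 -> Rabs x <= rho /\ Rabs (c * Rpower x (beta n)) <= rho).
  { intros x Hx. split. { rewrite Rabs_pos_eq; lra. }
    rewrite Rabs_mult, (Rabs_pos_eq (Rpower _ _)) by (left; apply Rpower_pos).
    eapply Rle_trans; [|exact Hc]. apply Rmult_le_compat_l; [apply Rabs_pos|].
    apply Rle_Rpower_l; lra. }
  assert (Hc0 : c <> 0).
  { intros E. set (dl := Rmin x1 r).
    assert (Hdl : 0 < dl) by (unfold dl; apply Rmin_case; lra).
    destruct (slope_above_power e n dl _ _ _ _ n_range Hsol Hdl) as (x0 & Hx0 & Hslope).
    - intros x Hx. assert (H1 := Rmin_l x1 r). assert (H2 := Rmin_r x1 r). fold dl in H1, H2.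
      rewrite Hexp by lra. destruct (Hcurve x ltac:(lra)) as [Hcx Hcx'].
      rewrite Hev by assumption. rewrite E, Rmult_0_l.
      destruct (Hax x ltac:(lra)) as [Hpos _].
      assert (HA : 0 < Rpower (mu n) (- (1 / n)) * Rpower x (3 / n))
        by (apply Rmult_lt_0_compat; apply Rpower_pos).
      nra.
    (* The slope of A x^nu at [x0]; as nu > 1 it bounds the slope of H from below on all of (x0, 1),
       so H' cannot tend to 0 at 1. *)
    - set (s := Rpower (mu n) (- (1 / n)) * (3 / n) * Rpower x0 (3 / n - 1)).
      assert (Hnu := nu_range n n_range).
      assert (HA := Rpower_pos (mu n) (- (1 / n))).
      assert (Hs : 0 < s).
      { unfold s. repeat apply Rmult_lt_0_compat; try apply Rpower_pos; lra. }
      destruct (derivative_at_endpoint H H' 1 HH' Hex ltac:(unfold unit_cc; lra) dH_1 s Hs)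
        as [d1 [Hd1 Hd]].
      set (x := Rmax ((1 + x0) / 2) (1 - d1 / 2)).
      assert (Hx : x0 < x < 1 /\ 1 - x < d1) by (unfold x; apply Rmax_case_strong; lra).
      specialize (Hslope x ltac:(lra)).
      specialize (Hd x ltac:(lra) ltac:(rewrite Rabs_left; lra)).
      apply Rabs_def2 in Hd.
      assert (s <= Rpower (mu n) (- (1 / n)) * (3 / n) * Rpower x (3 / n - 1)); [|lra].
      unfold s. apply Rmult_le_compat_l; [apply Rmult_le_pos; lra|].
      apply Rle_Rpower_l; lra. }
  assert (Hcp : 0 < Rabs c) by (apply Rabs_pos_lt, Hc0).
  set (v := fun x y => ev (off0 z) x (c * y)).
  assert (Hv00 : v 0 0 = 0).
  { unfold v. rewrite Rmult_0_r. apply (ev_0_0 K (off0 z)); assumption. }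
  assert (Hfst : depends_on_fst_near0 v).
  { intros eps Heps. set (x := Rmin eps r / 2).
    assert (Hm : 0 < Rmin eps r) by (apply Rmin_case; lra).
    assert (H1 := Rmin_l eps r). assert (H2 := Rmin_r eps r).
    exists x, 0, 0. rewrite Rabs_R0, Rabs_pos_eq by (unfold x; lra).
    split; [unfold x; lra|]. split; [lra|]. split; [lra|].
    rewrite Hv00. unfold v. rewrite Rmult_0_r.
    destruct (Hax x ltac:(unfold x; lra)) as [Hp _]. lra. }
  exists v. split; [|split; [|split; [|split; [|split]]]].
  (* On a square of this half-width both |x1| and |c x2| are at most rho. *)
  - exists (fun i j => off0 z i j * c ^ j), (rho / (1 + Rabs c)).
    split. { apply Rdiv_lt_0_compat; lra. }
    intros x1' x2 Hx Hy term. rewrite !Rminus_0_r in *.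
    assert (Hrr : rho / (1 + Rabs c) * (1 + Rabs c) = rho) by (field; lra).
    assert (Hx' : Rabs x1' <= rho) by nra.
    assert (Hy' : Rabs (c * x2) <= rho).
    { rewrite Rabs_mult. assert (H1 := Rabs_pos x2). nra. }
    assert (Hterm : forall i j, term i j = off0 z i j * x1' ^ i * (c * x2) ^ j).
    { intros i j. unfold term. rewrite !Rminus_0_r, Rpow_mult_distr. ring. }
    assert (HK0 : 0 <= K) by lra. assert (Hrho0 : 0 <= rho) by lra.
    assert (HKr' : K * rho < 1) by nra.
    split.
    + apply (ex_series_ext (diag (fun i j => Rabs (off0 z i j * x1' ^ i * (c * x2) ^ j)))).
      * intros N. rewrite sum_n_Reals. apply sum_eq. intros i Hi. rewrite Hterm. reflexivity.
      * apply (ex_series_term_abs K rho); assumption.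
    + apply (is_series_ext (homog (off0 z) x1' (c * x2))).
      * intros N. rewrite sum_n_Reals. apply sum_eq. intros i Hi. rewrite Hterm. reflexivity.
      * apply (is_series_ev K rho); assumption.
  - exact Hv00.
  - intros eps Heps. destruct (Hfst eps Heps) as (x & y & t & Hx & Hy & Ht & Hne).
    destruct (Req_dec (v x t) 0) as [E|E].
    + exists y, t. split; [assumption|]. split; [assumption|]. congruence.
    + exists x, t. auto.
  - exact Hfst.
  (* The second argument t/c is turned by v into the argument t of the series, where positivity on
     the axis is known. *)
  - intros eps Heps. set (t := Rmin (eps * Rabs c) r / 2).
    assert (Hec : 0 < eps * Rabs c) by (apply Rmult_lt_0_compat; assumption).
    assert (Hm : 0 < Rmin (eps * Rabs c) r) by (apply Rmin_case; lra).
    assert (H1 := Rmin_l (eps * Rabs c) r). assert (H2 := Rmin_r (eps * Rabs c) r).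
    assert (Ht : 0 < t /\ t < eps * Rabs c /\ t < r) by (unfold t; lra).
    exists 0, (t / c), 0. rewrite Rabs_R0.
    split; [lra|]. split; [|split; [lra|]].
    + unfold Rdiv. rewrite Rabs_mult, Rabs_inv, (Rabs_pos_eq t) by lra.
      apply (Rlt_div_l t _ (Rabs c)); lra.
    + rewrite Hv00. unfold v. replace (c * (t / c)) with t by (field; assumption).
      destruct (Hax t ltac:(lra)) as [_ Hp]. lra.
  - exists x1. split; [lra|]. intros x Hx. unfold rpow.
    destruct (Req_EM_T x 0) as [->|Hne].
    + rewrite H_0. ring.
    + rewrite Hexp by lra. f_equal. apply Hev; apply Hcurve; lra.
Qed.
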